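(* Let $u_0\in BV(I)$ and let $u$ be the corresponding solution of $u_t=(\mathcal L(u_x))_x$ in $I_T$ with $u(\cdot,0)=u_0$ and with either Dirichlet, periodic or Neumann boundary conditions. Then $u$ is a viscosity solution of $u_t=(\mathcal L(u_x))_x$ in $I_T$.
   Context: Fix reals $a<b$, $T>0$, $I=(a,b)$, $I_T=I\times(0,T)$. $\operatorname{sgn}$ is the multivalued sign graph ($1$ for $p>0$, $-1$ for $p<0$, $[-1,1]$ at $p=0$), $\mathcal L(p)=\operatorname{sgn}(p+1)+\operatorname{sgn}(p-1)$, $W(p)=|p+1|+|p-1|$. For $v\in BV(I)$, $\int_I W(Dv):=|D(v+x)|(I)+|D(v-x)|(I)$. $\gamma$ denotes the trace (one-sided limit from inside $I$ at an endpoint). Solution: $u\in L^\infty(0,T;BV(I))$ with $u_t\in L^2(0,T;L^2(I))$ is a solution of $u_t=(\mathcal L(u_x))_x$ if there is $\Omega\in L^2(0,T;W^{1,2}(I))$ such that for a.e. $t$: (i) $\int_I u_t\varphi\,dx=-\int_I\Omega\varphi_x\,dx$ for all $\varphi\in C_0^\infty(I)$; (ii) $\Omega(\cdot,t)$ is a selection of $\mathcal L\circ u_x(\cdot,t)$, understood in the subdifferential sense: $\int_I W(Dv)\ge\int_I W(Du(\cdot,t))+\int_I\Omega(\cdot,t)\,d(Dv-Du(\cdot,t))$ for all $v\in BV(I)$. Then $u\in C([0,T];L^2(I))$. For given $u_0\in BV(I)$ and any one of the boundary conditions below the solution exists and is unique. For each $t$, $u(\cdot,t)$ is represented by a $BV$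 function whose value at each point lies between its one-sided limits there. Boundary conditions (for a.e. $t>0$). Neumann: $\gamma\Omega(a)=\gamma\Omega(b)=0$. Dirichlet data $A,B\in\mathbb R$: at $x=a$ either $\gamma u(a)=A$, or $\gamma u(a)>A$ and $\gamma\Omega(a)=2$, or $\gamma u(a)<A$ and $\gamma\Omega(a)=-2$; at $x=b$ either $\gamma u(b)=B$, or $\gamma u(b)>B$ and $\gamma\Omega(b)=-2$, or $\gamma u(b)<B$ and $\gamma\Omega(b)=2$. Periodic: the problem is posed on the circle obtained by identifying $a$ and $b$. Test functions: $f\in C(I)$ is $p$-faceted at $x_0\in I$, $p\in\{-1,1\}$, if there is a closed nontrivial finite interval $\tilde I\subset I$ containing $x_0$ such that $f=\ell_p$ on $\tilde I$, where $\ell_p(x)=p(x-x_0)+f(x_0)$, and $f(x)\ne\ell_p(x)$ for all $x\in J\setminus\tilde I$ for some neighbourhood $J$ of $\tilde I$ in $I$. Write $R(f,x_0)=\tilde I$. The transition numbers of $f$ at $x_0$ are $\chi_l=+1$ (resp. $-1$) if $f\ge\ell_p$ (resp. $f\le\ell_p$) on $\{x\in J:x\le x_0\}$, and $\chi_r=+1$ (resp. $-1$) if $f\ge\ell_p$ (resp. $f\le\ell_p$) on $\{x\in J:x\ge x_0\}$ ($J$ being a sufficiently small interval neighbourhood of $R(f,x_0)$). $C^2_P(I)$ is the set of $f\in C^2(I)$ that are $p$-faceted at $x_0$ whenever $f'(x_0)=p\in\{-1,1\}$. $A_P(I_T)$ is the set of functions $\psi(x,t)=f(x)+g(t)$ with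 $f\in C^2_P(I)$, $g\in C^1(0,T)$. Nonlocal operator $\Lambda_W(f)(x_0)$ for $f\in C_P^2(I)$: if $f'(x_0)\notin\{-1,1\}$, then $\Lambda_W(f)(x_0)=(W'(f'))'(x_0)$. If $f$ is $p$-faceted at $x_0$ with $R(f,x_0)=[\alpha,\beta]$ and transition numbers $\chi_l,\chi_r$, then $\Lambda_W(f)(x_0)=\frac{d}{dx}\xi(x_0)$, where $\xi$ is the unique minimizer of $\int_\alpha^\beta|\zeta'|^2dx$ among $\zeta\in H^1(\alpha,\beta)$ with $Z-\frac\Delta2\le\zeta\le Z+\frac\Delta2$, $\zeta(\alpha)=Z-\chi_l\frac\Delta2$, $\zeta(\beta)=Z+\chi_r\frac\Delta2$, with the constant $Z=p$ and $\Delta=2$ (the jump of $W'$ at $p$). Viscosity solution: for $u:I_T\to\mathbb R$ let $u^*(x,t)=\lim_{\varepsilon\downarrow0}\sup\{u(y,s):|s-t|<\varepsilon,|x-y|<\varepsilon,(y,s)\in I_T\}$ for $(x,t)\in\overline{I_T}$ and $u_*=-(-u)^*$. $u$ is a subsolution if $u^*<\infty$ on $\overline{I_T}$ and $\psi_t(\hat x,\hat t)-\Lambda_W(\psi(\cdot,\hat t))(\hat x)\le0$ whenever $\psi\in A_P(I_T)$, $(\hat x,\hat t)\in I_T$ and $\max_{I_T}(u^*-\psi)=(u^*-\psi)(\hat x,\hat t)$. $u$ is a supersolution if $u_*>-\infty$ on $\overline{I_T}$ and the opposite inequality $\ge0$ holds whenever $\min_{I_T}(u_*-\psi)=(u_*-\psi)(\hat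 x,\hat t)$. A viscosity solution is both a sub- and a supersolution. *)

(* Defs.v *)
From HB Require Import structures.
From mathcomp Require Import all_boot all_order all_algebra.
From mathcomp Require Import all_classical all_reals all_analysis.

Set Implicit Arguments.
Unset Strict Implicit.
Unset Printing Implicit Defensive.

Import Order.TTheory GRing.Theory Num.Theory.
Import numFieldNormedType.Exports.

Local Open Scope classical_set_scope.
Local Open Scope ring_scope.

Notation leb := lebesgue_measure.

(* Finite signed Radon measures are charges; neither the variation nor the   *)
(* integral below depends on the Hahn decomposition that is chosen.          *)

Section SignedMeasures.
Context {R : realType}.
Implicit Type nu : {charge set (measurableTypeR R) -> \bar R}.

Definition hahn_pos nu : set (measurableTypeR R) :=
  sval (cid (Hahn_decomposition nu)).

Definition hahn_neg nu : set (measurableTypeR R) :=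
  sval (cid (svalP (cid (Hahn_decomposition nu)))).

Definition hahn nu : hahn_decomposition nu (hahn_pos nu) (hahn_neg nu) :=
  svalP (cid (svalP (cid (Hahn_decomposition nu)))).

(* |nu|(X) *)
Definition abs_charge nu (X : set R) : \bar R := charge_variation (hahn nu) X.

Definition charge_integral nu (X : set R) (f : R -> R) : R :=
  \int[jordan_pos (hahn nu)]_(x in X) f x
  - \int[jordan_neg (hahn nu)]_(x in X) f x.

End SignedMeasures.

(* Function spaces on I = (a, b) and on the circle obtained by identifying   *)
(* a and b.  Functions on the circle are given by their values on (a, b);    *)
(* measures on the circle live on [a, b), the point a standing for a = b.    *)

Inductive space_domain := OpenInterval | Circle.

Section Spaces.
Context {R : realType}.

Definition carrier (dom : space_domain) (a b : R) : set (measurableTypeR R) :=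
  match dom with OpenInterval => `]a, b[%classic | Circle => `[a, b[%classic end.

Lemma measurable_carrier dom (a b : R) : measurable (carrier dom a b).
Proof. by case: dom; exact: measurable_itv. Qed.

Lemma carrier_lty dom (a b : R) : (leb (carrier dom a b) < +oo)%E.
Proof.
by case: dom; rewrite /carrier lebesgue_measure_itv/=; case: ifP => _ //;
  rewrite -EFinD ltry.
Qed.

Definition lebesgue_charge dom (a b : R) :
    {charge set (measurableTypeR R) -> \bar R} :=
  charge_of_finite_measure
    (mfrestr (measurable_carrier dom a b) (carrier_lty dom a b)).

Definition smooth (phi : R -> R) : Prop :=
  forall (n : nat) (x : R), derivable (derive1n n phi) x 1.

(* C_0^oo(a, b), resp. C^oo of the circle *)
Definition test_function (dom : space_domain) (a b : R) (phi : R -> R) : Prop :=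
  smooth phi /\
  match dom with
  | OpenInterval => exists c d : R, [/\ a < c, d < b &
      forall x, x \notin `[c, d] -> phi x = 0]
  | Circle => forall x, phi (x + (b - a)) = phi x
  end.

Definition L2 (d : measure_display) (T : measurableType d)
    (mu : {measure set T -> \bar R}) (D : set T) (f : T -> R) : Prop :=
  measurable_fun D f /\ (\int[mu]_(x in D) ((f x) ^+ 2)%:E < +oo)%E.

(* f is in W^{1,2} with weak derivative g.  An element of W^{1,2} is always  *)
(* represented by its continuous representative on the closed interval       *)
(* (with f a = f b on the circle, forced by the periodic test functions).    *)
Definition W12 (dom : space_domain) (a b : R) (f g : R -> R) : Prop :=
  [/\ {within `[a, b], continuous f},
      L2 leb `]a, b[ f,
      L2 leb `]a, b[ g &
      forall phi, test_function dom a b phi ->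
        \int[leb]_(x in `]a, b[) (f x * (phi^`())%classic x) =
        - \int[leb]_(x in `]a, b[) (g x * phi x)].

(* v is in BV and Dv = nu *)
Definition BV_deriv (dom : space_domain) (a b : R) (v : R -> R)
    (nu : {charge set (measurableTypeR R) -> \bar R}) : Prop :=
  leb.-integrable `]a, b[ (EFin \o v) /\
  forall phi, test_function dom a b phi ->
    \int[leb]_(x in `]a, b[) (v x * (phi^`())%classic x) =
    - charge_integral nu (carrier dom a b) phi.

Definition is_BV (dom : space_domain) (a b : R) (v : R -> R) : Prop :=
  exists nu, BV_deriv dom a b v nu.

Definition BV_norm (dom : space_domain) (a b : R) (v : R -> R)
    (nu : {charge set (measurableTypeR R) -> \bar R}) : \bar R :=
  (\int[leb]_(x in `]a, b[) `|v x|%:E + abs_charge nu (carrier dom a b))%E.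

(* \int W(Dv) = |D(v + x)| + |D(v - x)| as a function of nu = Dv.  It is      *)
(* written with D(v +- x) = Dv +- dx, which also makes sense on the circle,  *)
(* where v +- x is not a function.                                           *)
Definition W_energy (dom : space_domain) (a b : R)
    (nu : {charge set (measurableTypeR R) -> \bar R}) : \bar R :=
  (abs_charge (cadd nu (lebesgue_charge dom a b)) (carrier dom a b)
   + abs_charge (cadd nu (copp (lebesgue_charge dom a b))) (carrier dom a b))%E.

(* one-sided limits exist at each point of (a, b) and the value lies between *)
(* them *)
Definition between_limits (a b : R) (v : R -> R) : Prop :=
  forall x, x \in `]a, b[ ->
    [/\ cvg (v @ x^'-), cvg (v @ x^'+) &
        Num.min (lim (v @ x^'-)) (lim (v @ x^'+)) <= v x
          <= Num.max (lim (v @ x^'-)) (lim (v @ x^'+))].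

Definition trace_left (a : R) (v : R -> R) : R := lim (v @ a^'+).
Definition trace_right (b : R) (v : R -> R) : R := lim (v @ b^'-).

End Spaces.

Inductive boundary_condition (R : realType) :=
  | Neumann
  | Dirichlet (A B : R)
  | Periodic.
Arguments Neumann {R}.
Arguments Periodic {R}.

Section Solutions.
Context {R : realType}.
Implicit Types (bc : boundary_condition R) (u w Om : R -> R -> R).

Definition domain_of bc : space_domain :=
  match bc with Periodic => Circle | _ => OpenInterval end.

Definition cylinder (a b T : R) : set (measurableTypeR R * measurableTypeR R) :=
  `]a, b[ `*` `]0, T[.

(* L^2(0, T; L^2(I)) *)
Definition L2L2 (a b T : R) w : Prop :=
  L2 (leb \x leb)%E (cylinder a b T) (fun z => w z.1 z.2).

(* u belongs to C([0, T]; L^2(I)) *)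
Definition continuous_L2 (a b T : R) u : Prop :=
  forall t, t \in `[0, T] -> L2 leb `]a, b[ (u ^~ t) /\
    (\int[leb]_(x in `]a, b[) ((u x s - u x t) ^+ 2)%:E)%E
      @[s --> within `[0, T] (nbhs t)] --> 0%E.

(* u belongs to L^oo(0, T; BV); strong measurability into L^2 comes from     *)
(* continuous_L2 *)
Definition Linfty_BV dom (a b T : R) u : Prop :=
  exists M : R, {ae leb, forall t, t \in `]0, T[ ->
    exists2 nu, BV_deriv dom a b (u ^~ t) nu &
                (BV_norm dom a b (u ^~ t) nu <= M%:E)%E}.

(* w is the weak derivative u_t of u : (0, T) -> L^2(I): the identity        *)
(*   int_0^T u phi' dt = - int_0^T w phi dt                                  *)
(* between elements of L^2(I), tested against every h in L^2(I) *)
Definition weak_dt (a b T : R) u w : Prop :=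
  forall phi h, test_function OpenInterval 0 T phi -> L2 leb `]a, b[ h ->
    \int[leb]_(t in `]0, T[)
      ((\int[leb]_(x in `]a, b[) (u x t * h x)) * (phi^`())%classic t) =
    - \int[leb]_(t in `]0, T[)
      ((\int[leb]_(x in `]a, b[) (w x t * h x)) * phi t).

(* Om belongs to L^2(0, T; W^{1,2}) *)
Definition L2W12 dom (a b T : R) Om : Prop :=
  exists Omx : R -> R -> R,
    [/\ L2L2 a b T Om, L2L2 a b T Omx &
        {ae leb, forall t, t \in `]0, T[ ->
          W12 dom a b (Om ^~ t) (Omx ^~ t)}].

(* om is a selection of L o u_x in the subdifferential sense *)
Definition selection dom (a b : R) (v om : R -> R) : Prop :=
  exists2 mu, BV_deriv dom a b v mu &
    forall v' nu, BV_deriv dom a b v' nu ->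
      (W_energy dom a b nu >= W_energy dom a b mu
        + (charge_integral (cadd nu (copp mu)) (carrier dom a b) om)%:E)%E.

Definition boundary_cond bc (a b : R) (v om : R -> R) : Prop :=
  match bc with
  | Neumann => trace_left a om = 0 /\ trace_right b om = 0
  | Dirichlet A B =>
      [\/ trace_left a v = A,
          trace_left a v > A /\ trace_left a om = 2 |
          trace_left a v < A /\ trace_left a om = - 2]
   /\ [\/ trace_right b v = B,
          trace_right b v > B /\ trace_right b om = - 2 |
          trace_right b v < B /\ trace_right b om = 2]
  | Periodic => True (* encoded in domain_of *)
  end.

Definition solution bc (a b T : R) u : Prop :=
  let dom := domain_of bc in
  [/\ continuous_L2 a b T u,
      Linfty_BV dom a b T u,
      (forall t, t \in `[0, T] ->
         is_BV dom a b (u ^~ t) /\ between_limits a b (u ^~ t)) &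
      exists ut Om : R -> R -> R,
        [/\ weak_dt a b T u ut, L2L2 a b T ut, L2W12 dom a b T Om &
          {ae leb, forall t, t \in `]0, T[ ->
            [/\ (forall phi, test_function dom a b phi ->
                   \int[leb]_(x in `]a, b[) (ut x t * phi x) =
                   - \int[leb]_(x in `]a, b[) (Om x t * (phi^`())%classic x)),
                selection dom a b (u ^~ t) (Om ^~ t) &
                boundary_cond bc a b (u ^~ t) (Om ^~ t)]}]].

Definition initial_value (a b : R) (u0 : R -> R) u : Prop :=
  {ae leb, forall x, x \in `]a, b[ -> u x 0 = u0 x}.

End Solutions.

Section Viscosity.
Context {R : realType}.
Implicit Types (f g : R -> R) (p x al be chi : R) (u psi : R -> R -> R).

Definition W (p : R) : R := `|p + 1| + `|p - 1|.

Definition ell f p (x0 x : R) : R := p * (x - x0) + f x0.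

(* f is p-faceted at x0 with R(f, x0) = [al, be] *)
Definition facet (a b : R) f p (x0 : R) al be : Prop :=
  [/\ a < al /\ be < b,
      al < be,
      x0 \in `[al, be],
      forall x, x \in `[al, be] -> f x = ell f p x0 x &
      exists c d : R, [/\ a <= c < al, be < d <= b &
        forall x, x \in `]c, d[ -> x \notin `[al, be] -> f x <> ell f p x0 x]].

Definition transition_left (a b : R) f p (x0 : R) al be chi : Prop :=
  exists c d : R, [/\ a <= c < al, be < d <= b &
    (chi = 1 /\ forall x, x \in `]c, d[ -> x <= x0 -> f x >= ell f p x0 x) \/
    (chi = - 1 /\ forall x, x \in `]c, d[ -> x <= x0 -> f x <= ell f p x0 x)].

Definition transition_right (a b : R) f p (x0 : R) al be chi : Prop :=
  exists c d : R, [/\ a <= c < al, be < d <= b &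
    (chi = 1 /\ forall x, x \in `]c, d[ -> x >= x0 -> f x >= ell f p x0 x) \/
    (chi = - 1 /\ forall x, x \in `]c, d[ -> x >= x0 -> f x <= ell f p x0 x)].

Definition C2 (a b : R) f : Prop :=
  forall x, x \in `]a, b[ ->
    [/\ derivable f x 1, derivable (f^`())%classic x 1 &
        {for x, continuous (f^`(2))%classic}].

Definition C1 (a b : R) g : Prop :=
  forall t, t \in `]a, b[ ->
    derivable g t 1 /\ {for t, continuous (g^`())%classic}.

Definition C2P (a b : R) f : Prop :=
  C2 a b f /\
  forall x0 p, x0 \in `]a, b[ -> p = 1 \/ p = - 1 ->
    (f^`())%classic x0 = p -> exists al be, facet a b f p x0 al be.

(* h is the weak derivative zeta' *)
Definition admissible (Z Delta al be chil chir : R) (zeta h : R -> R) : Prop :=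
  [/\ W12 OpenInterval al be zeta h,
      forall x, x \in `[al, be] -> Z - Delta / 2 <= zeta x <= Z + Delta / 2,
      zeta al = Z - chil * (Delta / 2) &
      zeta be = Z + chir * (Delta / 2)].

Definition obstacle_minimizer (Z Delta al be chil chir : R) (xi : R -> R) : Prop :=
  exists2 h, admissible Z Delta al be chil chir xi h &
    forall zeta k, admissible Z Delta al be chil chir zeta k ->
      \int[leb]_(x in `]al, be[) ((h x) ^+ 2) <=
      \int[leb]_(x in `]al, be[) ((k x) ^+ 2).

(* L is the value of Lambda_W(f) at x0; Delta = 2 is the jump of W' at p, and *)
(* xi'(x0) is one-sided when x0 is an end point of the facet                *)
Definition is_Lambda_W (a b : R) f (x0 L : R) : Prop :=
  [/\ (f^`())%classic x0 <> 1, (f^`())%classic x0 <> - 1 &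
      L = ((fun x => (W^`())%classic ((f^`())%classic x))^`())%classic x0]
  \/
  exists p al be chil chir : R, exists xi : R -> R,
    [/\ p = 1 \/ p = - 1,
        facet a b f p x0 al be,
        transition_left a b f p x0 al be chil
          /\ transition_right a b f p x0 al be chir,
        obstacle_minimizer p 2 al be chil chir xi &
        (xi y - xi x0) / (y - x0) @[y --> within `[al, be] (x0^')] --> L].

Definition Lambda_W (a b : R) f (x0 : R) : R := xget 0 (is_Lambda_W a b f x0).

Definition A_P (a b T : R) psi : Prop :=
  exists f g, [/\ C2P a b f, C1 0 T g &
    forall x t, x \in `]a, b[ -> t \in `]0, T[ -> psi x t = f x + g t].

Definition usc_env (a b T : R) u (x t : R) : \bar R :=
  lim (ereal_sup [set (u z.1 z.2)%:E | z in [set z : R * R |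
         [/\ `|z.2 - t| < e, `|x - z.1| < e,
             z.1 \in `]a, b[ & z.2 \in `]0, T[]]]
       @[e --> (0 : R)^'+]).

Definition lsc_env (a b T : R) u (x t : R) : \bar R :=
  (- usc_env a b T (fun y s => - u y s)%R x t)%E.

Definition viscosity_subsolution (a b T : R) u : Prop :=
  (forall x t, x \in `[a, b] -> t \in `[0, T] ->
     (usc_env a b T u x t < +oo)%E) /\
  forall psi xh th, A_P a b T psi -> xh \in `]a, b[ -> th \in `]0, T[ ->
    (forall x t, x \in `]a, b[ -> t \in `]0, T[ ->
       (usc_env a b T u x t - (psi x t)%:E
          <= usc_env a b T u xh th - (psi xh th)%:E)%E) ->
    ((psi xh)^`())%classic th - Lambda_W a b (psi ^~ th) xh <= 0.

Definition viscosity_supersolution (a b T : R) u : Prop :=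
  (forall x t, x \in `[a, b] -> t \in `[0, T] ->
     (lsc_env a b T u x t > -oo)%E) /\
  forall psi xh th, A_P a b T psi -> xh \in `]a, b[ -> th \in `]0, T[ ->
    (forall x t, x \in `]a, b[ -> t \in `]0, T[ ->
       (lsc_env a b T u x t - (psi x t)%:E
          >= lsc_env a b T u xh th - (psi xh th)%:E)%E) ->
    ((psi xh)^`())%classic th - Lambda_W a b (psi ^~ th) xh >= 0.

Definition viscosity_solution (a b T : R) u : Prop :=
  viscosity_subsolution a b T u /\ viscosity_supersolution a b T u.

End Viscosity.

(* Main.v *)
(* The equation is odd, so only the subsolution property has to be proved.  On a
   facet [al, be] the obstacle problem is solved by the affine function, hence
   Lambda_W is (chil + chir) / (be - al) there, and it is 0 where f' <> 1, -1.

   Suppose that psi = f + g touches u^* from above at (xh, th) and that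
   g'(th) > s > Lambda_W(f)(xh).  Then there is a piecewise affine w >= f on a small
   interval [c, d], with equality at xh and strict inequality at c and d, such that
   L o w' has a Lipschitz selection xi with xi' <= s.  Taking u - (u - w - s t)^+ as
   competitor in the subdifferential inequality for Omega gives
       int_c^d (u_t - s) (u - w - s t)^+ dx <= 0    for a.e. t,
   so that the L^2 norm of (u - w - s t)^+ does not increase in time.  A small
   translate of w + s t lies above u on the parabolic boundary of a rectangle around
   (xh, th) but below u^* at (xh, th), which is a contradiction. *)

Require Import Defs.
From HB Require Import structures.
From mathcomp Require Import all_boot all_order all_algebra.
From mathcomp Require Import all_classical all_reals all_analysis.
From mathcomp Require Import measurable_realfun.
From mathcomp Require Import ring lra.
Import Order.TTheory GRing.Theory Num.Theory.
Import numFieldNormedType.Exports.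
Local Open Scope classical_set_scope.
Local Open Scope ring_scope.

Set Implicit Arguments.
Unset Strict Implicit.
Unset Printing Implicit Defensive.

(** * Smooth cut-off functions *)

Section Smooth.
Context {R : realType}.
Implicit Types (f g : R -> R).

(** The barrier is piecewise affine because [Du] is only a measure. On a piece where [w + x] and
    [w - x] are monotone, replacing [u] by [min(u, w)] changes the two total variations in a way
    that can be checked on half-open intervals alone, by comparing increments, so [Du] is never
    split into absolutely continuous, jump and Cantor parts. The increments are those of the
    right-limit representative [U], for which [Du(]x, y]) = U y - U x] at all points; the values of
    [u] return only at the end, as they lie between one-sided limits. In time [u_t] is only square
    integrable, so the squared norm of [(u - w - s t)^+] is not differentiated: its increment over
    [[r, t]] is bounded by [2 (t - r)] times the increment of a fixed function, and refining the
    partition removes this error. The value of [u^*] need not be attained by [u], so contact is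
    expressed through points near [(xh, th)] at which [u] nearly reaches it. [Lambda_W] is defined
    by choice, hence facet, transition numbers and minimizer must all be shown to be determined. *)

Definition derivable_upto (n : nat) f :=
  forall k x, (k < n)%N -> derivable (derive1n k f) x 1.

Lemma derivable_uptoS n f : derivable_upto n.+1 f <->
  (forall x, derivable f x 1) /\ derivable_upto n (f^`())%classic.
Proof.
split=> [h|[h1 h2] [|k] x kn].
- split=> [x|k x kn]; first exact: (h 0%N).
  by rewrite -derive1Sn; exact: h.
- exact: h1.
- by rewrite derive1Sn; exact: h2.
Qed.

Lemma derivable_uptoW n f : derivable_upto n.+1 f -> derivable_upto n f.
Proof. by move=> h k x kn; apply: h; exact: ltnW. Qed.

Lemma smoothE f : smooth f <-> forall n, derivable_upto n f.
Proof. by split=> [h n k x _|h n x]; [exact: h|exact: (h n.+1)]. Qed.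

Lemma smooth_derivable f x : smooth f -> derivable f x 1.
Proof. by move=> h; exact: (h 0%N). Qed.

Lemma smooth_derive1 f : smooth f -> smooth (f^`())%classic.
Proof. by move=> h n x; rewrite -derive1Sn; exact: h. Qed.

Lemma smooth_derivedP f g :
  (forall x : R, is_derive x (1 : R) f (g x)) -> smooth g -> smooth f.
Proof.
move=> fg sg; have fE : (f^`())%classic = g.
  by apply/funext => x; rewrite derive1E; exact: derive_val.
by case=> [|n] x; [exact: (@ex_derive _ _ _ _ _ _ _ (fg x))|rewrite derive1Sn fE].
Qed.

Lemma smooth_continuous f : smooth f -> continuous f.
Proof.
move=> sf x; apply: differentiable_continuous.
exact/derivable1_diffP/smooth_derivable.
Qed.

Lemma derivable_upto_cst n (c : R) : derivable_upto n (cst c).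
Proof.
elim: n c => [|n IH] c; first by move=> k x; rewrite ltn0.
apply/derivable_uptoS; split => [x|]; first exact: derivable_cst.
rewrite (_ : (_^`())%classic = cst 0)//.
by apply/funext => x; rewrite derive1_cst.
Qed.

Lemma derivable_uptoD n f g :
  derivable_upto n f -> derivable_upto n g -> derivable_upto n (f \+ g).
Proof.
elim: n f g => [|n IH] f g; first by move=> _ _ k x; rewrite ltn0.
move=> /derivable_uptoS[f1 f2] /derivable_uptoS[g1 g2].
apply/derivable_uptoS; split => [x|]; first exact: derivableD.
rewrite (_ : (_^`())%classic = (f^`() \+ g^`())%classic); first exact: IH.
by apply/funext => x /=; rewrite !derive1E deriveD.
Qed.

Lemma derivable_uptoB n f g :
  derivable_upto n f -> derivable_upto n g -> derivable_upto n (f \- g).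
Proof.
elim: n f g => [|n IH] f g; first by move=> _ _ k x; rewrite ltn0.
move=> /derivable_uptoS[f1 f2] /derivable_uptoS[g1 g2].
apply/derivable_uptoS; split => [x|]; first exact: derivableB.
rewrite (_ : (_^`())%classic = (f^`() \- g^`())%classic); first exact: IH.
by apply/funext => x /=; rewrite !derive1E deriveB.
Qed.

(** In the product rule one factor stays undifferentiated, so the induction needs regularity counted
    by [n] together with the weakening [derivable_uptoW]. *)
Lemma derivable_uptoM n f g :
  derivable_upto n f -> derivable_upto n g -> derivable_upto n (f \* g).
Proof.
elim: n f g => [|n IH] f g; first by move=> _ _ k x; rewrite ltn0.
move=> hf hg; move: (hf) (hg) => /derivable_uptoS[f1 f2] /derivable_uptoS[g1 g2].
apply/derivable_uptoS; split => [x|]; first exact: derivableM.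
rewrite (_ : (_^`())%classic = ((f \* g^`()) \+ (g \* f^`()))%classic).
  exact: (derivable_uptoD (IH _ _ (derivable_uptoW hf) g2) (IH _ _ (derivable_uptoW hg) f2)).
apply/funext => x; rewrite derive1E (deriveM (f1 x) (g1 x)).
by rewrite /= !derive1E.
Qed.

Lemma is_derive_affine f (k c x : R) : derivable f (k * x + c) 1 ->
  is_derive x (1 : R) (fun x => f (k * x + c)) (k * (f^`())%classic (k * x + c)).
Proof.
move=> df; have h : is_derive x (1 : R) (fun x => k * x + c) k.
  rewrite (_ : (fun x => _) = (k \*: (@id R)) + cst c); last by apply/funext.
  by apply: is_derive_eq; rewrite addr0 -[RHS]mulr1.
have h2 : is_derive (k * x + c) (1 : R) f ((f^`())%classic (k * x + c)).
  by rewrite derive1E; exact: derivableP.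
rewrite mulrC; exact: (@is_derive1_comp R f (fun x => k * x + c) x _ _ h2 h).
Qed.

Lemma derivable_upto_affine n f k c :
  derivable_upto n f -> derivable_upto n (fun x => f (k * x + c)).
Proof.
elim: n f => [|n IH] f; first by move=> _ j x; rewrite ltn0.
move=> /derivable_uptoS[f1 f2].
have D x := is_derive_affine (f1 (k * x + c)).
apply/derivable_uptoS; split => [x|]; first exact: ex_derive.
rewrite (_ : (_^`())%classic = (cst k \* (fun x => (f^`())%classic (k * x + c)))).
  by apply: derivable_uptoM; [exact: derivable_upto_cst|exact: IH].
by apply/funext => x /=; rewrite derive1E; exact: derive_val.
Qed.

Lemma smooth_cst (c : R) : smooth (cst c).
Proof. by apply/smoothE => n; exact: derivable_upto_cst. Qed.

Lemma smoothM f g : smooth f -> smooth g -> smooth (f \* g).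
Proof. by move=> /smoothE ? /smoothE ?; apply/smoothE => n; exact: derivable_uptoM. Qed.

Lemma smooth_affine f k c : smooth f -> smooth (fun x => f (k * x + c)).
Proof. by move=> /smoothE ?; apply/smoothE => n; exact: derivable_upto_affine. Qed.

Lemma smoothB f g : smooth f -> smooth g -> smooth (f \- g).
Proof.
move=> sf sg; move: sf sg => /smoothE sf /smoothE sg; apply/smoothE => n.
exact: derivable_uptoB.
Qed.

(** Each Horner step spends half of the rate [k]: the factor [y] is absorbed by
    [2 / k * expR (k / 2 * y)] and the previous polynomial by the other half. *)
Lemma poly_le_exp (p : {poly R}) (k : R) : 0 < k ->
  exists2 C, 0 <= C & forall y, 0 <= y -> `|p.[y]| <= C * expR (k * y).
Proof.
elim/poly_ind: p k => [|p c IH] k k0.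
  by exists 0 => // y _; rewrite horner0 normr0 mul0r.
have [C C0 hC] := IH (k / 2) ltac:(lra).
pose K := C * (2 / k).
exists (K + `|c|) => [|y y0].
  by rewrite addr_ge0// mulr_ge0// divr_ge0// ltW.
rewrite !hornerE (le_trans (ler_normD _ _))// mulrDl lerD//; last first.
  rewrite ler_peMr// (le_trans _ (expR_ge1Dx _))// lerDl mulr_ge0//; lra.
rewrite normrM (ger0_norm y0).
have e2 : expR (k * y) = expR (k / 2 * y) * expR (k / 2 * y).
  by rewrite -expRD; congr expR; lra.
have h1 : y <= 2 / k * expR (k / 2 * y).
  have := expR_ge1Dx (k / 2 * y) => h.
  have : 2 / k * (k / 2 * y) <= 2 / k * expR (k / 2 * y).
    by rewrite ler_wpM2l//; [rewrite divr_ge0//; lra|lra].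
  rewrite (_ : 2 / k * (k / 2 * y) = y)//.
  by field; rewrite gt_eqF.
have e0 := expR_ge0 (k / 2 * y).
have := hC _ y0 => h2.
rewrite e2; apply: (@le_trans _ _ ((C * expR (k / 2 * y)) * (2 / k * expR (k / 2 * y)))).
  by apply: ler_pM.
by rewrite le_eqVlt; apply/orP; left; apply/eqP; rewrite /K; ring.
Qed.

(** The family [p(1/t) exp(-1/t)] is closed under differentiation, with [p] replaced by
    [(p - p') X^2]; carrying the polynomial as a parameter makes smoothness an induction on the
    order. *)
Definition flat (p : {poly R}) (t : R) : R :=
  if 0 < t then p.[t^-1] * expR (- t^-1) else 0.

(** The exponential beats [p X^2] as well as [p]. A quadratic bound is what makes the derivative at
    the origin exist and vanish. *)
Lemma flat_le (p : {poly R}) : exists C, forall t, `|flat p t| <= C * t ^+ 2.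
Proof.
have [C C0 hC] := poly_le_exp (p * 'X^2) ltr01.
exists C => t; rewrite /flat; case: ifPn => t0; last first.
  by rewrite normr0 mulr_ge0// sqr_ge0.
have := hC t^-1; rewrite invr_ge0 ltW// => /(_ isT).
rewrite hornerM hornerXn mul1r !normrM (ger0_norm (expR_ge0 _)) -expr2 real_normK ?num_real// => h.
have t2 : t^-1 ^+ 2 * t ^+ 2 = 1 by rewrite -exprMn mulVf ?expr1n// gt_eqF.
have : `|p.[t^-1]| * t^-1 ^+ 2 * (t ^+ 2 * expR (- t^-1)) <=
    C * expR t^-1 * (t ^+ 2 * expR (- t^-1)).
  by rewrite ler_wpM2r// mulr_ge0 ?expR_ge0// sqr_ge0.
rewrite mulrA -[X in X * _]mulrA t2 mulr1.
rewrite (_ : C * _ * _ = C * t ^+ 2 * (expR t^-1 * expR (- t^-1))); last ring.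
by rewrite expRxMexpNx_1 mulr1.
Qed.

Lemma quadratic_is_derive0 f C x :
  (forall t, `|f (t + x) - f x| <= C * t ^+ 2) -> is_derive x (1 : R) f 0.
Proof.
move=> h; have C0 : 0 <= C by have := h 1; rewrite expr1n mulr1; exact: le_trans.
have cv : h^-1 *: (f (h *: (1 : R) + x) - f x) @[h --> (0 : R)^'] --> (0 : R).
  apply/cvgr0Pnorm_lt => e e0.
  have eC : 0 < e / (C + 1) by rewrite divr_gt0//; lra.
  near=> t.
  have t0 : t != 0 by near: t; exact: nbhs_dnbhs_neq.
  rewrite [t *: 1]mulr1 normrM normfV ltr_pdivrMl ?normr_gt0//.
  apply: le_lt_trans (h t) _.
  rewrite -(real_normK (num_real t)) expr2 mulrCA ltr_pM2l ?normr_gt0//.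
  have : `|t| < e / (C + 1) by near: t; apply: dnbhs0_lt.
  rewrite ltr_pdivlMr; last lra.
  by apply: le_lt_trans; rewrite mulrC ler_wpM2l//; lra.
apply: DeriveDef; first by apply/cvg_ex; exists 0.
exact/cvg_lim.
Unshelve. all: by end_near. Qed.

Lemma is_derive_flat (p : {poly R}) (t : R) :
  is_derive t (1 : R) (flat p) (flat ((p - p^`()%R) * 'X^2) t).
Proof.
have [C hC] := flat_le p.
case: (ltgtP t 0) => [t0|t0|->].
- rewrite /flat ltNge (ltW t0)/=.
  apply: (@near_eq_is_derive _ _ _ (cst 0) _ _ _ _ _) => //.
  near=> z; rewrite /flat ifF//; apply/negbTE; rewrite -leNgt ltW//.
  by near: z; exact: lt_nbhsl.
- have d1 : is_derive t (1 : R) (fun t : R => t^-1) (- t ^- 2).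
    apply: is_derive_eq; first exact: (@is_deriveV R id t 1 1 (lt0r_neq0 t0)).
    by rewrite /= [LHS]mulr1.
  have d2 : is_derive t (1 : R) (fun t : R => - t^-1) (t ^- 2).
    by rewrite -[t ^- 2]opprK; exact: (@is_deriveN _ _ _ (fun t : R => t^-1)).
  have d3 : is_derive t (1 : R) (fun t : R => p.[t^-1]) (- t ^- 2 * (p^`()%R).[t^-1]).
    by rewrite mulrC; exact: (is_derive1_comp (is_derive_poly p t^-1) d1).
  have d4 : is_derive t (1 : R) (fun t : R => expR (- t^-1)) (t ^- 2 * expR (- t^-1)).
    by rewrite mulrC; exact: (@is_derive1_comp R expR (fun t => - t^-1) t _ _ (is_derive_expR (- t^-1)) d2).
  apply: (@near_eq_is_derive R R R (fun t => p.[t^-1] * expR (- t^-1))) => //.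
    near=> z; rewrite /flat ifT//.
    by near: z; exact: lt_nbhsr.
  have d5 := @is_deriveM R R (fun t => p.[t^-1]) (fun t => expR (- t^-1)) t 1 _ _ d3 d4.
  rewrite (_ : flat _ _ = p.[t^-1] *: (t ^- 2 * expR (- t^-1)) +
    expR (- t^-1) *: (- t ^- 2 * p^`()%R.[t^-1])); first exact: d5.
  rewrite /flat t0 !hornerE /= -exprVn /GRing.scale/=; ring.
- rewrite {2}/flat ltxx; apply: (@quadratic_is_derive0 _ C) => t1.
  by rewrite {2}/flat ltxx subr0 addr0; exact: hC.
Unshelve. all: by end_near. Qed.

Lemma smooth_flat (p : {poly R}) : smooth (flat p).
Proof.
apply/smoothE => n; elim: n p => [|n IH] p; first by move=> k x; rewrite ltn0.
apply/derivable_uptoS; split => [x|].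
  exact: (@ex_derive _ _ _ _ _ _ _ (is_derive_flat p x)).
rewrite (_ : (_^`())%classic = flat ((p - p^`()%R) * 'X^2)); first exact: IH.
by apply/funext => x; rewrite derive1E; apply: derive_val; exact: is_derive_flat.
Qed.

Definition bump (t : R) : R := flat 1 t * flat 1 ((-1) * t + 1).

Lemma smooth_bump : smooth bump.
Proof.
by apply: smoothM; [exact: smooth_flat|apply: smooth_affine; exact: smooth_flat].
Qed.

Lemma bump_ge0 t : 0 <= bump t.
Proof.
by rewrite /bump /flat !hornerE; do 2 case: ifP => _; rewrite ?mulr0 ?mul0r// mul1r mulr_ge0 ?expR_ge0// mul1r expR_ge0.
Qed.

Lemma bump_gt0 t : 0 < t < 1 -> 0 < bump t.
Proof.
move=> /andP[t0 t1]; rewrite /bump /flat !hornerE t0 ifT; last lra.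
by rewrite mulr_gt0// expR_gt0.
Qed.

Lemma bump_eq0 t : ~~ (0 < t < 1) -> bump t = 0.
Proof.
rewrite /bump /flat; case: ifP => [t0|]; last by rewrite mul0r.
by case: ifP => [t1|]; [move=> /negP; case; rewrite /=; lra|rewrite mulr0].
Qed.

Lemma continuous_bump : continuous bump.
Proof. exact/smooth_continuous/smooth_bump. Qed.

Lemma integrable_bump y : leb.-integrable `]-oo, y] (EFin \o bump).
Proof.
have h : leb.-integrable `[0, 1] (EFin \o bump).
  apply: continuous_compact_integrable; first exact: segment_compact.
  by apply: continuous_subspaceT => x; exact: continuous_bump.
apply: (@integrableS _ _ _ _ setT) => //.
rewrite (_ : EFin \o bump = (EFin \o bump) \_ `[(0 : R), 1]); last first.
  apply/funext => x; rewrite patchE; case: ifPn => // /negP.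
  rewrite inE/= in_itv/= => /negP h1; rewrite bump_eq0//.
  by apply: contra h1 => /andP[? ?]; rewrite !ltW.
by apply/integrable_restrict => //; rewrite setTI.
Qed.

Definition bump_int (t : R) : R := \int[leb]_(x in `]-oo, t]) bump x.

Lemma is_derive_bump_int t : is_derive t (1 : R) bump_int (bump t).
Proof.
have [||] := @continuous_FTC1 R bump -oo%O t (t + 1) _ (integrable_bump _) _
  (@continuous_bump t).
- by rewrite ltrDl.
- by rewrite /= ltNyr.
by move=> d e; rewrite -e derive1E; exact: derivableP.
Qed.

Lemma bump_int0 t : t <= 0 -> bump_int t = 0.
Proof.
move=> t0; rewrite /bump_int (@eq_Rintegral _ _ _ _ _ (cst 0)).
  by rewrite Rintegral_cst// mul0r.
by move=> x; rewrite inE/= in_itv/= => xt; rewrite bump_eq0// negb_and -leNgt (le_trans xt).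
Qed.

Lemma continuous_bump_int : continuous bump_int.
Proof.
move=> x; apply: differentiable_continuous; apply/derivable1_diffP.
exact: (@ex_derive _ _ _ _ _ _ _ (is_derive_bump_int x)).
Qed.

Lemma bump_int_mono x y : x <= y -> bump_int x <= bump_int y.
Proof.
rewrite le_eqVlt => /predU1P[->//|xy].
have [c _ e] := @MVT_segment R bump_int bump x y (ltW xy)
  (fun z _ => is_derive_bump_int z)
  (continuous_subspaceT (fun z => @continuous_bump_int z)).
by rewrite -subr_ge0 e mulr_ge0 ?bump_ge0//; lra.
Qed.

(** If the total mass were zero, monotonicity would make the primitive vanish on [(0, 1)], yet its
    derivative at [1/2] is [bump (1/2) > 0]. *)
Lemma bump_int1 : 0 < bump_int 1.
Proof.
rewrite lt_neqAle -{2}(bump_int0 (lexx 0)) bump_int_mono// andbT.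
apply/negP => /eqP h.
have c0 z : 0 < z < 1 -> bump_int z = 0.
  move=> /andP[z0 z1]; apply/le_anti; rewrite {1}h bump_int_mono ?(ltW z1)//=.
  by rewrite -(bump_int0 (lexx 0)) bump_int_mono// ltW.
have : is_derive (2^-1 : R) (1 : R) bump_int 0.
  apply: (@near_eq_is_derive _ _ _ (cst 0)) => //.
  near=> z; rewrite c0//; near: z; apply: near_in_itvoo.
  by rewrite in_itv/=; lra.
move=> /(@derive_val _ _ _ _ _ _ _); rewrite (derive_val (is_derive := is_derive_bump_int _)).
by move/eqP; rewrite gt_eqF// bump_gt0//; lra.
Unshelve. all: by end_near. Qed.

Lemma bump_int_ge1 t : 1 <= t -> bump_int t = bump_int 1.
Proof.
rewrite le_eqVlt => /predU1P[<-//|t1].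
have [|z zt e] := @MVT R bump_int bump 1 t t1 (fun z _ => is_derive_bump_int z).
  exact: (continuous_subspaceT (fun z => @continuous_bump_int z)).
move/eqP: e; rewrite bump_eq0 ?mul0r ?subr_eq0; first by move/eqP.
by move: zt; rewrite in_itv/= => /andP[z1 _]; rewrite negb_and -!leNgt (ltW z1) orbT.
Qed.

(** The last clause turns the derivative of the step into a nonnegative kernel supported in
    [[0, 1]], of mass one because [S] climbs from 0 to 1. *)
Lemma smooth_step : exists S : R -> R,
  [/\ smooth S, forall x, x <= 0 -> S x = 0, forall x, 1 <= x -> S x = 1,
      forall x, 0 <= S x <= 1 &
      forall x, 0 <= (S^`())%classic x /\ ((x <= 0) || (1 <= x) -> (S^`())%classic x = 0)].
Proof.
have i1 := bump_int1.
pose S x := (bump_int 1)^-1 * bump_int x.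
have dS x : is_derive x (1 : R) S ((bump_int 1)^-1 * bump x).
  have dx := is_derive_bump_int x.
  exact: (@is_deriveZ _ _ _ bump_int (bump_int 1)^-1 x 1 (bump x)).
have S1 x : (S^`())%classic x = (bump_int 1)^-1 * bump x.
  by rewrite derive1E; exact: derive_val.
exists S; split=> [|x x0|x x1|x|x].
- apply: (smooth_derivedP dS); apply: smoothM; [exact: smooth_cst|exact: smooth_bump].
- by rewrite /S (bump_int0 x0) mulr0.
- by rewrite /S (bump_int_ge1 x1) mulVf// gt_eqF.
- rewrite /S mulr_ge0 ?invr_ge0 ?(ltW i1)//=; last first.
    case: (leP x 0) => x0; first by rewrite (bump_int0 x0).
    by rewrite -(bump_int0 (lexx 0)) bump_int_mono// ltW.
  rewrite ler_pdivrMl// mulr1.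
  case: (leP x 1) => x1; first by rewrite bump_int_mono.
  by rewrite (bump_int_ge1 (ltW x1)).
- rewrite S1; split; first by rewrite mulr_ge0 ?bump_ge0// invr_ge0 ltW.
  move=> h; rewrite bump_eq0 ?mulr0// negb_and -!leNgt//.
Qed.

End Smooth.

(** * Integrals of real-valued functions on intervals *)

Section IntegralTools.
Context {R : realType}.

Lemma boundedP (T : Type) (A : set T) (f : T -> R) (M : R) :
  (forall x, A x -> `|f x| <= M) -> [bounded f x | x in A].
Proof.
move=> h; exists M; split; first exact: num_real.
by move=> y My x Ax; apply: (le_trans (h _ Ax)); exact: ltW.
Qed.

Lemma continuous_itv_bound (a b : R) (f : R -> R) : continuous f ->
  exists M, forall x, a <= x <= b -> `|f x| <= M.
Proof.
move=> cf; case: (leP a b) => ab; last first.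
  by exists 0 => x /andP[ax xb]; move: (lt_le_trans ab (le_trans ax xb)); rewrite ltxx.
have cnf : {within `[a, b], continuous (fun x => `|f x|)}.
  apply: continuous_subspaceT => x.
  by apply: continuous_comp; [exact: cf|exact: norm_continuous].
have [c _ hc] := EVT_max ab cnf.
by exists `|f c| => x xab; apply: hc; rewrite in_itv.
Qed.

Lemma measurable_continuous (D : set (measurableTypeR R)) (f : R -> R) :
  continuous f -> measurable_fun D f.
Proof.
by move=> cf; apply: measurable_funTS; exact: continuous_measurable_fun.
Qed.

Lemma continuous_integrable_oo (a b : R) (f : R -> R) : continuous f ->
  leb.-integrable `]a, b[ (EFin \o f).
Proof.
move=> cf; have h : leb.-integrable `[a, b] (EFin \o f).
  apply: continuous_compact_integrable; first exact: segment_compact.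
  by apply: continuous_subspaceT => x; exact: cf.
by apply: (integrableS _ _ _ h) => //; exact: subset_itv_oo_cc.
Qed.

Lemma integrableRZl d (T : measurableType d) (mu : {measure set T -> \bar R})
    (D : set T) (f : T -> R) (l : R) : measurable D ->
  mu.-integrable D (EFin \o f) -> mu.-integrable D (EFin \o (fun z => l * f z)).
Proof. by move=> mD /(integrableZl mD l). Qed.

Lemma integrable_mul_continuous (a b : R) (v f : R -> R) :
  leb.-integrable `]a, b[ (EFin \o v) -> continuous f ->
  leb.-integrable `]a, b[ (EFin \o (v \* f)).
Proof.
move=> iv cf; have [M hM] := continuous_itv_bound a b cf.
have := @integrableMl _ _ _ leb `]a, b[%classic (measurable_itv _) _ f iv
  (measurable_continuous cf).
apply; apply: (@boundedP _ _ _ M) => x /=.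
by rewrite in_itv/= => /andP[ax xb]; apply: hM; rewrite !ltW.
Qed.

Lemma smooth_FTC (F : R -> R) (a b : R) : a < b -> smooth F ->
  \int[leb]_(x in `]a, b[) (F^`())%classic x = F b - F a.
Proof.
move=> ab sF; have cF' := smooth_continuous (smooth_derive1 sF).
have cF := smooth_continuous sF.
rewrite Rintegral_itv_bndo_bndc; last exact: continuous_integrable_oo.
rewrite Rintegral_itv_obnd_cbnd; last first.
  have h : leb.-integrable `[a, b] (EFin \o (F^`())%classic).
    apply: continuous_compact_integrable; first exact: segment_compact.
    by apply: continuous_subspaceT => x; exact: cF'.
  by apply: (integrableS _ _ _ h) => //; exact: subset_itv_oc_cc.
rewrite /Rintegral (@continuous_FTC2 _ _ F)//.
- by apply: continuous_subspaceT => x; exact: cF'.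
- split.
  + by move=> x _; exact: smooth_derivable.
  + by apply: cvg_at_right_filter; exact: cF.
  + by apply: cvg_at_left_filter; exact: cF.
Qed.

Lemma Rintegral_dct d (T : measurableType d) (mu : {measure set T -> \bar R})
    (D : set T) (f_ : nat -> T -> R) (f g : T -> R) :
  measurable D -> (forall n, measurable_fun D (f_ n)) -> measurable_fun D f ->
  (forall x, D x -> f_ n x @[n --> \oo] --> f x) ->
  mu.-integrable D (EFin \o g) -> (forall n x, D x -> `|f_ n x| <= g x) ->
  \int[mu]_(x in D) f_ n x @[n --> \oo] --> \int[mu]_(x in D) f x.
Proof.
move=> mD mf_ mf cf ig fg.
have [||||intf _ c] := @dominated_convergence _ _ _ mu D mD (fun n => EFin \o f_ n)
   (EFin \o f) (EFin \o g) _ _ _ ig.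
- by move=> n; exact/measurable_EFinP.
- exact/measurable_EFinP.
- by apply: aeW => x Dx; apply: cvg_EFin; [exact: nearW|exact: cf].
- by apply: aeW => x n Dx; rewrite /= lee_fin fg.
apply: fine_cvg; rewrite fineK//; exact: integrable_fin_num.
Qed.

End IntegralTools.

(** * Test functions approximating indicators of half-open intervals *)

Section TestFunctions.
Context {R : realType}.
Implicit Types (f g phi v : R -> R).

Lemma near_eq_derive1n f g n (x : R) : {near x, f =1 g} ->
  {near x, derive1n n f =1 derive1n n g}.
Proof.
elim: n f g => [//|n IH] f g fg; rewrite !derive1Sn; apply: IH.
apply: filterS (near_join fg) => y fgy; rewrite !derive1E.
exact: near_eq_derive.
Qed.

Lemma smooth_local f :
  (forall x : R, exists2 g, smooth g & {near x, g =1 f}) -> smooth f.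
Proof.
move=> h n x; have [g sg gf] := h x.
exact: near_eq_derivable (near_eq_derive1n n gf) (sg n x).
Qed.

(** Test functions on the circle must be periodic on the whole line. Near a given point the
    periodization is a single translate of [phi]: the index of the period changes only near
    multiples of the period, where [phi] vanishes on both sides. *)
Lemma smooth_periodize (a b c d : R) phi : a < c -> c < d -> d < b -> smooth phi ->
  (forall x, x \notin `[c, d] -> phi x = 0) ->
  exists2 psi, smooth psi /\ (forall x, psi (x + (b - a)) = psi x) &
    forall x, x \in `[a, b[ -> psi x = phi x.
Proof.
move=> ac cd db sphi phi0; pose L := b - a.
have L0 : 0 < L by rewrite /L; lra.
pose fl z : int := Num.floor ((z - a) / L).
have flP z : a <= z - (fl z)%:~R * L < b.
  have := Num.Theory.floor_itv ((z - a) / L); rewrite -/(fl z) => /andP[h1 h2].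
  rewrite ler_pdivlMr// in h1; rewrite ltr_pdivrMr// intrD mulrDl mul1r in h2.
  by apply/andP; split; [lra|rewrite /L in h2 *; lra].
pose psi z := phi (z - (fl z)%:~R * L).
exists psi; [split|].
- apply: smooth_local => x; set k := fl x.
  exists (fun z => phi (1 * z + - (k%:~R * L))); first exact: smooth_affine.
  near=> z; rewrite mul1r /psi; set j := fl z.
  have := flP x; have := flP z; rewrite -/j -/k => /andP[z1 z2] /andP[x1 x2].
  have xz1 : `|x - z| < c - a by near: z; apply/nbhs_ballP; exists (c - a) => //=; lra.
  have xz2 : `|x - z| < b - d by near: z; apply/nbhs_ballP; exists (b - d) => //=; lra.
  move: xz1 xz2; rewrite !ltr_norml => /andP[p1 p2] /andP[p3 p4].
  (* If the periods of [x] and [z] differ, a period boundary lies between these close points, so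
     both arguments of [phi] fall outside [[c, d]]. *)
  have [jk|kj|->//] := ltgtP j k.
  + have : (j + 1 <= k)%R by rewrite lezD1.
    rewrite -(ler_int R) intrD -(ler_pM2r L0) mulrDl mul1r => jkL.
    rewrite !phi0// in_itv/= negb_and -!ltNge; apply/orP; rewrite /L in jkL z1 z2 x1 x2 *; [right|left]; lra.
  + have : (k + 1 <= j)%R by rewrite lezD1.
    rewrite -(ler_int R) intrD -(ler_pM2r L0) mulrDl mul1r => jkL.
    rewrite !phi0// in_itv/= negb_and -!ltNge; apply/orP; rewrite /L in jkL z1 z2 x1 x2 *; [left|right]; lra.
- move=> x; rewrite /psi /fl -/L.
  rewrite (_ : (x + L - a) / L = (x - a) / L + 1); last by field; rewrite gt_eqF.
  rewrite Num.Theory.floorDrz ?rpred1// Num.Theory.floor1 intrD.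
  by congr phi; ring.
- move=> x; rewrite in_itv/= => /andP[ax xb].
  rewrite /psi (_ : fl x = 0) ?mul0r ?subr0//.
  apply: Num.Theory.floor_def; rewrite add0r divr_ge0 ?(ltW L0) ?subr_ge0 ?ax//=.
  by rewrite ltr_pdivrMr// mul1r /L; lra.
Unshelve. all: by end_near. Qed.

(** The derivative of the rescaled step is a probability density on [(x, x + 1/c)], so the integral
    is an average of values of [v] taken just to the right of [x]. *)
Lemma smooth_step_kernel_le (S : R -> R) (a b x c e l : R) v :
  smooth S -> (forall x, x <= 0 -> S x = 0) -> (forall x, 1 <= x -> S x = 1) ->
  (forall x, 0 <= (S^`())%classic x /\ ((x <= 0) || (1 <= x) -> (S^`())%classic x = 0)) ->
  a < x -> x < b -> 0 < c -> x + c^-1 <= b ->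
  leb.-integrable `]a, b[ (EFin \o v) ->
  (forall z, x < z < x + c^-1 -> `|v z - l| <= e) ->
  `|\int[leb]_(z in `]a, b[) (v z * ((fun z => S (c * z + - (c * x)))^`())%classic z) - l|
     <= e.
Proof.
move=> sS S0 S1 S'P ax xb c0 xcb iv hv.
set F := fun z => S (c * z + - (c * x)).
have sF : smooth F by exact: smooth_affine.
have F'E z : (F^`())%classic z = c * (S^`())%classic (c * z + - (c * x)).
  rewrite derive1E; apply: derive_val; apply: is_derive_affine; exact: smooth_derivable.
have F'0 z : 0 <= (F^`())%classic z by rewrite F'E mulr_ge0 ?(ltW c0)//; case: (S'P (c * z + - (c * x))).
have F'1 z : ~~ (x < z < x + c^-1) -> (F^`())%classic z = 0.
  move=> h; rewrite F'E; case: (S'P (c * z + - (c * x))) => _ ->; first by rewrite mulr0.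
  rewrite -mulrN -mulrDr pmulr_rle0// -[1 <= _](ler_pM2l (_ : 0 < c^-1)) ?invr_gt0//.
  by rewrite mulrA mulVf ?gt_eqF// mulr1 mul1r; apply: contraR h; rewrite negb_or -!ltNge => /andP[? ?]; apply/andP; split; lra.
have cF' := smooth_continuous (smooth_derive1 sF).
have iF' := @continuous_integrable_oo R a b _ cF'.
have intF : \int[leb]_(z in `]a, b[) (F^`())%classic z = 1.
  rewrite smooth_FTC//; last exact: lt_trans xb.
  rewrite /F S1 ?S0 ?subr0//.
    by rewrite -mulrN -mulrDr pmulr_rle0//; lra.
  rewrite -mulrN -mulrDr -(ler_pM2l (_ : 0 < c^-1)) ?invr_gt0//.
  by rewrite mulrA mulVf ?gt_eqF// mulr1 mul1r; lra.
have ivF := integrable_mul_continuous iv cF'.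
have ilF : leb.-integrable `]a, b[ (EFin \o (fun z => l * (F^`())%classic z)).
  exact: integrableRZl.
have ieF : leb.-integrable `]a, b[ (EFin \o (fun z => e * (F^`())%classic z)).
  exact: integrableRZl.
have -> : l = \int[leb]_(z in `]a, b[) (l * (F^`())%classic z).
  by rewrite RintegralZl// intF mulr1.
rewrite -RintegralB//.
have iB : leb.-integrable `]a, b[ (EFin \o (fun z => v z * (F^`())%classic z - l * (F^`())%classic z)).
  exact: (integrableB _ ivF ilF).
rewrite (le_trans (le_normr_Rintegral _ iB))//.
rewrite -[X in _ <= X]mulr1 -intF -RintegralZl//.
apply: le_Rintegral => //; first exact: (integrable_norm iB).
move=> z _; rewrite -mulrBl normrM (ger0_norm (F'0 z)).
have [zx|zx] := boolP (x < z < x + c^-1); first by rewrite ler_wpM2r// hv.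
by rewrite (F'1 _ zx) !mulr0.
Qed.

Lemma test_approx dom (a b x y : R) : a < x -> x < y -> y < b ->
  exists phi : nat -> R -> R, [/\
    forall n, test_function dom a b (phi n),
    forall n z, z \in `[a, b[ -> `|phi n z| <= 1,
    forall z, z \in `[a, b[ -> phi n z @[n --> \oo] --> (\1_(`]x, y]%classic) z : R) &
    forall v (l1 l2 : R), leb.-integrable `]a, b[ (EFin \o v) ->
      v z @[z --> x^'+] --> l1 -> v z @[z --> y^'+] --> l2 ->
      \int[leb]_(z in `]a, b[) (v z * ((phi n)^`())%classic z) @[n --> \oo] --> l1 - l2].
Proof.
move=> ax xy yb; have [S [sS S0 S1 S01 S'P]] := @smooth_step R.
have [c0 c0P] : exists c0 : R, [/\ 0 < c0 & forall c, c0 <= c -> y + c^-1 < (y + b) / 2].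
  (* With [1/c <= (b - y) / 3] the ramp starting at [y] ends before the midpoint of [y] and [b], so
     the support stays inside the open interval. *)
  exists (3 / (b - y)); split=> [|c]; first by rewrite divr_gt0//; lra.
  have by0 : 0 < b - y by lra.
  have t0 : 0 < 3 / (b - y) by rewrite divr_gt0//; lra.
  move=> hc; have c0 := lt_le_trans t0 hc.
  have : c^-1 <= (3 / (b - y))^-1 by rewrite lef_pV2// posrE.
  by rewrite invf_div; lra.
case: c0P => c00 c0P.
pose c n : R := c0 + n%:R.
have cc0 n : c0 <= c n by rewrite lerDl.
have cn0 n : 0 < c n by rewrite (lt_le_trans c00).
pose F w n z := S (c n * z + - (c n * w)).
have sF w n : smooth (F w n) by exact: smooth_affine.
pose f n := F x n \- F y n.
have sf n : smooth (f n) by exact: (smoothB (sF x n) (sF y n)).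
have Flt w n z : z <= w -> F w n z = 0.
  by move=> zw; rewrite /F S0// -mulrN -mulrDr pmulr_rle0//; lra.
have Fgt w n z : w + (c n)^-1 <= z -> F w n z = 1.
  move=> zw; rewrite /F S1// -mulrN -mulrDr -(ler_pM2l (_ : 0 < (c n)^-1)) ?invr_gt0//.
  by rewrite mulrA mulVf ?gt_eqF// mulr1 mul1r; lra.
have f0 n z : z \notin `[x, (y + b) / 2] -> f n z = 0.
  rewrite in_itv/= negb_and -!ltNge /f/= => /orP[zx|zb].
    by rewrite !Flt ?subr0//; lra.
  have := c0P _ (cc0 n) => h.
  rewrite !Fgt ?subrr//; lra.
have [phi phiP] : exists phi : nat -> R -> R, forall n, test_function dom a b (phi n) /\
    forall z, z \in `[a, b[ -> phi n z = f n z.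
  suff h n : exists phin, test_function dom a b phin /\
      forall z, z \in `[a, b[ -> phin z = f n z.
    by exists (fun n => sval (cid (h n))) => n; exact: (svalP (cid (h n))).
  case: dom => /=.
    exists (f n); split=> //; split; first exact: sf.
    by exists x, ((y + b) / 2); split; [exact: ax|lra|exact: f0].
  have [x1 b1] : x < (y + b) / 2 /\ (y + b) / 2 < b by split; lra.
  have [g [sg pg] gf] := smooth_periodize ax x1 b1 (sf n) (f0 n).
  by exists g.
have cinv e : 0 < e -> \forall n \near \oo, (c n)^-1 < e.
  move=> e0; near=> n; rewrite -[e]invrK ltf_pV2 ?posrE ?invr_gt0//.
  rewrite (@lt_trans _ _ n%:R)//; last by rewrite ltrDr.
  by near: n; exact: nbhs_infty_gtr.
exists phi; split.
- by move=> n; case: (phiP n).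
- move=> n z zab; case: (phiP n) => _ ->//; rewrite /f/= ler_norml.
  have := S01 (c n * z + - (c n * x)); have := S01 (c n * z + - (c n * y)).
  rewrite -/(F x n z) -/(F y n z); lra.
- move=> z zab; apply: cvg_near_cst.
  have [zx|xz] := leP z x.
    near=> n; case: (phiP n) => _ ->//; rewrite /f/= !Flt ?subr0//; last lra.
    by rewrite indicE memNset//= in_itv/= ltNge zx.
  have [zy|yz] := leP z y.
    near=> n; case: (phiP n) => _ ->//; rewrite /f/= (Flt y)// (Fgt x) ?subr0.
      by rewrite indicE mem_set//= in_itv/= xz zy.
    have : (c n)^-1 < z - x by near: n; apply: cinv; lra.
    lra.
  near=> n; case: (phiP n) => _ ->//; rewrite /f/=.
  have : (c n)^-1 < z - y by near: n; apply: cinv; lra.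
  move=> h; rewrite !Fgt ?subrr; [|lra|lra].
  by rewrite indicE memNset//= in_itv/= => /andP[_]; rewrite leNgt yz.
- move=> v l1 l2 iv hl1 hl2.
  have dF w n : continuous ((F w n)^`())%classic by exact/smooth_continuous/smooth_derive1.
  have key (w l : R) : a < w -> w < b -> (forall n, w + (c n)^-1 <= b) -> v z @[z --> w^'+] --> l ->
      \int[leb]_(z in `]a, b[) (v z * ((F w n)^`())%classic z) @[n --> \oo] --> l.
    move=> aw wb wcb hl; apply/cvgrPdist_le => e e0.
    move/cvgrPdist_le : hl => /(_ _ e0) [r /= r0 hr].
    near=> n; rewrite distrC.
    apply: (@smooth_step_kernel_le S) => // z /andP[wz zc].
    rewrite distrC; apply: hr => //=.
    have : (c n)^-1 < r by near: n; exact: cinv.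
    rewrite distrC gtr0_norm; lra.
  have dphi n (z : R) : a < z -> z < b ->
      ((phi n)^`())%classic z = ((F x n)^`())%classic z - ((F y n)^`())%classic z.
    move=> az zb; rewrite !derive1E -deriveB; [|exact: smooth_derivable..].
    apply: near_eq_derive; near=> t; case: (phiP n) => _ -> //.
    apply: subset_itv_oo_co; near: t; apply: near_in_itvoo.
    by rewrite in_itv/= az zb.
  have -> : (fun n => \int[leb]_(z in `]a, b[) (v z * ((phi n)^`())%classic z)) =
    (fun n => \int[leb]_(z in `]a, b[) (v z * ((F x n)^`())%classic z) -
              \int[leb]_(z in `]a, b[) (v z * ((F y n)^`())%classic z)).
    apply/funext => n; rewrite -RintegralB//; try exact: integrable_mul_continuous.
    apply: eq_Rintegral => z; rewrite inE/= in_itv/= => /andP[az zb].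
    by rewrite -mulrBr; congr (_ * _); exact: dphi.
  have hc n := c0P _ (cc0 n).
  apply: cvgB.
    by apply: key hl1 => [//||n]; [lra|have := hc n; lra].
  by apply: key hl2 => [|//|n]; [lra|have := hc n; lra].
Unshelve. all: by end_near. Qed.

End TestFunctions.

(** * Signed measures on intervals *)

Section FiniteMeasures.
Context {R : realType}.
Local Notation MR := (measurableTypeR R).

Lemma fin_num_fine_measure (m : {finite_measure set MR -> \bar R}) A :
  measurable A -> m A = (fine (m A))%:E.
Proof. by move=> mA; rewrite fineK// fin_num_measure. Qed.

Lemma measure_eq_oc (m1 m2 : {measure set MR -> \bar R}) :
  (forall x y : R, x < y -> m1 `]x, y]%classic = m2 `]x, y]%classic) ->
  (forall x y : R, (m1 `]x, y]%classic < +oo)%E) ->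
  forall A, measurable A -> m1 A = m2 A.
Proof.
move=> h f; apply: (measure_unique (@ocitv R : set (set MR))
  (fun n : nat => `](- n%:R), n%:R]%classic)) => //.
- exact: ocitvI.
- by move=> n; exact: is_ocitv.
- apply/seteqP; split=> // x _; exists (Num.truncn `|x|).+1 => //=.
  have := truncnS_gt `|x|; rewrite in_itv/= ltr_norml => /andP[h1 h2].
  by rewrite h1 ltW.
- move=> A /ocitvP[->|[[x y] /= xy ->]]; first by rewrite !measure0.
  exact: h.
Qed.

Lemma cdf_mono (m : {finite_measure set MR -> \bar R}) x y : x <= y ->
  fine (m `]-oo, x]%classic) <= fine (m `]-oo, y]%classic).
Proof.
move=> xy; apply: fine_le; rewrite ?fin_num_measure//.
apply: le_measure; rewrite ?inE//; exact: subset_itvl.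
Qed.

Lemma cdfB (m : {finite_measure set MR -> \bar R}) x y : x <= y ->
  fine (m `]x, y]%classic) = fine (m `]-oo, y]%classic) - fine (m `]-oo, x]%classic).
Proof.
move=> xy; have -> : m `]-oo, y]%classic = (m `]-oo, x]%classic + m `]x, y]%classic)%E.
  rewrite -measureU//; first by rewrite -itv_bndbnd_setU.
  by apply/seteqP; split => // z [/=]; rewrite !in_itv/= leNgt => /negbTE->.
by rewrite fineD ?fin_num_measure// addrAC subrr add0r.
Qed.

Lemma cdf_rc (m : {finite_measure set MR -> \bar R}) :
  right_continuous (fun x : R => fine (m `]-oo, x]%classic)).
Proof.
move=> a; pose F n := `]-oo, (a + n.+1%:R^-1)%R]%classic : set MR.
have c : m (F n) @[n --> \oo] --> m `]-oo, a]%classic.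
  suff : m (F n) @[n --> \oo] --> m (\bigcap_n F n) by rewrite -itvNycEbigcap.
  apply: nonincreasing_cvg_mu => [| | |n k nk].
  - by rewrite /F ltey_eq fin_num_measure.
  - by move=> n; exact: measurable_itv.
  - by apply: bigcap_measurable => // k _; exact: measurable_itv.
  - apply/subsetPset; apply: subset_itvl; rewrite bnd_simp lerD2l.
    by rewrite lef_pV2 ?posrE// ler_nat.
have {}c : fine (m (F n)) @[n --> \oo] --> fine (m `]-oo, a]%classic).
  by apply: fine_cvg; rewrite fineK// fin_num_measure.
apply/cvgrPdist_lt => e e0; move/cvgrPdist_lt : c => /(_ _ e0)[N _ /(_ N (leqnn N)) hN].
near=> x; rewrite distrC ger0_norm; last by rewrite subr_ge0 cdf_mono.
apply: le_lt_trans hN; rewrite distrC ger0_norm ?lerD2r ?cdf_mono//.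
  near: x; apply: nbhs_right_le; by rewrite ltrDl.
by rewrite subr_ge0 cdf_mono// lerDl.
Unshelve. all: by end_near. Qed.

Lemma stieltjes (f : R -> R) : {homo f : x y / x <= y} -> right_continuous f ->
  exists m : {measure set MR -> \bar R},
    forall x y, x <= y -> m `]x, y]%classic = (f y - f x)%:E.
Proof.
move=> ndf rcf.
pose C : cumulative R R := HB.pack f (isCumulative.Build R _ R f ndf rcf).
exists (lebesgue_stieltjes_measure C) => x y xy.
apply: etrans (measurable_mu_extE (wlength C) (is_ocitv x y)) _.
exact: wlength_itv_bnd.
Qed.

(** An inequality, unlike an equality, does not pass from a generating pi-system to all Borel sets.
    Here the difference of the distribution functions is nondecreasing and right continuous, so it
    defines a Stieltjes measure [m], and uniqueness gives [p = n + m]. *)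
Lemma measure_le_oc (p n : {finite_measure set MR -> \bar R}) :
  (forall x y : R, x < y -> fine (n `]x, y]%classic) <= fine (p `]x, y]%classic)) ->
  forall A, measurable A -> fine (n A) <= fine (p A).
Proof.
move=> h A mA; pose f x := fine (p `]-oo, x]%classic) - fine (n `]-oo, x]%classic).
have fB x y : x <= y -> f y - f x = fine (p `]x, y]%classic) - fine (n `]x, y]%classic).
  by move=> xy; rewrite !cdfB// /f; ring.
have ndf : {homo f : x y / x <= y}.
  move=> x y; rewrite le_eqVlt => /predU1P[->//|xy].
  by rewrite -subr_ge0 (fB _ _ (ltW xy)) subr_ge0; exact: h.
have rcf : right_continuous f by move=> x; apply: cvgB; exact: cdf_rc.
have [m mE] := stieltjes ndf rcf.
have : p A = measure_add n m A.
  apply: (@measure_eq_oc p (measure_add n m)) => [x y xy|x y|//]; last first.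
    by rewrite ltey_eq fin_num_measure.
  rewrite [RHS]measure_addE mE ?ltW// fB ?ltW// EFinB -!fin_num_fine_measure//.
  by rewrite [RHS]addeC subeK// fin_num_measure.
rewrite measure_addE => pE.
apply: fine_le; rewrite ?fin_num_measure//.
by rewrite pE leeDl.
Qed.

(** The identity [p - n = m1 - m2] of signed measures is moved to [p + m2 = n + m1], where only
    positive measures are integrated. The bound on [f] keeps all four integrals finite. *)
Lemma Rintegral_measureB (p n m1 m2 : {finite_measure set MR -> \bar R})
    (X : set MR) (f : R -> R) (M : R) :
  (forall A, measurable A -> fine (p A) - fine (n A) = fine (m1 A) - fine (m2 A)) ->
  measurable X -> measurable_fun X f -> (forall x, X x -> `|f x| <= M) ->
  \int[p]_(x in X) f x - \int[n]_(x in X) f x =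
  \int[m1]_(x in X) f x - \int[m2]_(x in X) f x.
Proof.
move=> nuE mX mf fM.
have int (m : {finite_measure set MR -> \bar R}) : m.-integrable X (EFin \o f).
  apply: measurable_bounded_integrable => //.
    by rewrite ltey_eq fin_num_measure.
  exact: boundedP fM.
have e : (\int[measure_add p m2]_(x in X) (EFin \o f) x =
          \int[measure_add n m1]_(x in X) (EFin \o f) x)%E.
  apply: eq_measure_integral => A mA _.
  have E : (p A + m2 A = n A + m1 A)%E.
    rewrite (fin_num_fine_measure p mA) (fin_num_fine_measure n mA).
    rewrite (fin_num_fine_measure m1 mA) (fin_num_fine_measure m2 mA) -!EFinD.
    by congr EFin; have := nuE _ mA; lra.
  exact: etrans (measure_addE p m2 A) (etrans E (esym (measure_addE n m1 A))).
rewrite !integral_measure_add in e; [|by []|exact: int..|by []|exact: int|exact: int].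
have fin (m : {finite_measure set MR -> \bar R}) :
    (\int[m]_(x in X) (EFin \o f) x)%E = (fine (\int[m]_(x in X) (EFin \o f) x))%:E.
  by rewrite fineK//; exact: (integrable_fin_num mX (int m)).
rewrite (fin p) (fin n) (fin m1) (fin m2) -!EFinD in e.
rewrite /Rintegral; case: e; rewrite /=; lra.
Qed.

End FiniteMeasures.

(** * Jordan parts, total variation and truncation of charges *)

Section Charges.
Context {R : realType}.
Local Notation MR := (measurableTypeR R).
Local Notation scharge := (charge MR R).
Implicit Types (nu sg : scharge) (A X : set MR).

(** Charges are finite on measurable sets, so [fine] loses nothing there and measure identities
    become real arithmetic. *)
Definition rc nu A : R := fine (nu A).

Lemma rc_add (n1 n2 : scharge) A : measurable A ->
  rc (cadd n1 n2) A = rc n1 A + rc n2 A.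
Proof. by move=> mA; rewrite /rc /= /cadd fineD ?fin_num_measure. Qed.

Lemma rc_opp nu A : measurable A -> rc (copp nu) A = - rc nu A.
Proof. by move=> mA; rewrite /rc /= /copp fineN. Qed.

Lemma rc_set0 nu : rc nu set0 = 0.
Proof. by rewrite /rc charge0. Qed.

Definition posp nu A : R := fine (jordan_pos (hahn nu) A).
Definition negp nu A : R := fine (jordan_neg (hahn nu) A).

Lemma measurable_hahn nu : measurable (hahn_pos nu) /\ measurable (hahn_neg nu).
Proof. by have [[mP _] [mN _] _ _] := hahn nu. Qed.

Lemma pospE nu A : measurable A -> posp nu A = rc nu (A `&` hahn_pos nu).
Proof. by move=> mA; rewrite /posp jordan_posE cjordan_posE /crestr0 mem_set. Qed.

Lemma negpE nu A : measurable A -> negp nu A = - rc nu (A `&` hahn_neg nu).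
Proof. by move=> mA; rewrite /negp jordan_negE cjordan_negE /crestr0 mem_set// fineN. Qed.

Lemma posp_ge0 nu A : 0 <= posp nu A.
Proof. exact: fine_ge0. Qed.

Lemma negp_ge0 nu A : 0 <= negp nu A.
Proof. exact: fine_ge0. Qed.

Lemma posp_le nu A B : measurable A -> measurable B -> A `<=` B ->
  posp nu A <= posp nu B.
Proof.
by move=> mA mB AB; apply: fine_le; rewrite ?fin_num_measure//; apply: le_measure; rewrite ?inE.
Qed.

Lemma negp_le nu A B : measurable A -> measurable B -> A `<=` B ->
  negp nu A <= negp nu B.
Proof.
by move=> mA mB AB; apply: fine_le; rewrite ?fin_num_measure//; apply: le_measure; rewrite ?inE.
Qed.

Lemma rc_jordan nu A : measurable A -> rc nu A = posp nu A - negp nu A.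
Proof.
move=> mA; rewrite /rc (jordan_decomp (hahn nu) mA) /cadd/= cscaleN1.
by rewrite fineD ?fin_num_measure//= ?fin_numN ?fin_num_measure// fineN.
Qed.

Definition tv nu A : R := posp nu A + negp nu A.

Lemma abs_chargeE nu A : measurable A -> abs_charge nu A = (tv nu A)%:E.
Proof.
move=> mA; rewrite /abs_charge /charge_variation/= EFinD.
by congr (_ + _)%E; rewrite -fin_num_fine_measure.
Qed.

Lemma tv_ge0 nu A : 0 <= tv nu A.
Proof. by rewrite addr_ge0 ?posp_ge0 ?negp_ge0. Qed.

Lemma tv_rc nu A : measurable A -> `|rc nu A| <= tv nu A.
Proof.
move=> mA; rewrite rc_jordan// /tv; have := posp_ge0 nu A; have := negp_ge0 nu A.
by rewrite ler_norml; lra.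
Qed.

Lemma tvU nu A B : measurable A -> measurable B -> A `&` B = set0 ->
  tv nu (A `|` B) = tv nu A + tv nu B.
Proof.
move=> mA mB AB; rewrite /tv /posp /negp !measureU// !fineD ?fin_num_measure//; lra.
Qed.

Lemma charge_ge0_oc nu : (forall x y : R, x < y -> 0 <= rc nu `]x, y]%classic) ->
  forall A, measurable A -> 0 <= rc nu A.
Proof.
move=> h A mA; rewrite rc_jordan// subr_ge0; apply: measure_le_oc => // x y xy.
by rewrite -subr_ge0 -[X in 0 <= X]rc_jordan// h.
Qed.

Lemma itv_ocI (x y s t : R) :
  `]x, y]%classic `&` `]s, t]%classic = `]Num.max x s, Num.min y t]%classic :> set R.
Proof.
apply/seteqP; split => z /=; rewrite !in_itv/= gt_max le_min.
  by move=> [/andP[-> ->] /andP[-> ->]].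
by move=> /andP[/andP[-> ->] /andP[-> ->]].
Qed.

Lemma charge_ge0_oc_in nu (s t : R) :
  (forall x y : R, s <= x -> x < y -> y <= t -> 0 <= rc nu `]x, y]%classic) ->
  forall A, measurable A -> A `<=` `]s, t]%classic -> 0 <= rc nu A.
Proof.
move=> h A mA As; have mE : measurable (`]s, t]%classic : set MR) by exact: measurable_itv.
have rE B : measurable B -> rc (crestr0 nu mE) B = rc nu (B `&` `]s, t]%classic).
  by move=> mB; rewrite /rc /= /crestr0 mem_set.
suff : 0 <= rc (crestr0 nu mE) A by rewrite rE// setIidl.
apply: charge_ge0_oc => // x y xy; rewrite rE//= itv_ocI.
case: (ltP (Num.max x s) (Num.min y t)) => st; last first.
  by rewrite set_itv_ge ?rc_set0// bnd_simp -leNgt.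
by apply: h => //; [rewrite le_max lexx orbT|rewrite ge_min lexx orbT].
Qed.

(** The linear core of the truncation estimate on a set: [p1, n1] and [p2, n2] are the Jordan parts
    of [mu] and of [mu - sg], while [k1] and [k2] are the values, on the part of the set that is
    negative for [mu - sg], of the negative variation of [mu] and of [mu - sg]. *)
Lemma variation_arith (p1 n1 p2 n2 m s k1 k2 : R) :
  m = p1 - n1 -> m - s = p2 - n2 -> 0 <= k1 + k2 -> n2 = - k2 -> k1 <= n1 ->
  s <= p1 + n1 - (p2 + n2).
Proof. by move=> *; lra. Qed.

Lemma variation_arith' (p1 n1 p2 n2 m s k1 k2 : R) :
  m = p1 - n1 -> m - s = p2 - n2 -> 0 <= k1 - k2 -> p2 = k2 -> k1 <= p1 ->
  - s <= p1 + n1 - (p2 + n2).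
Proof. by move=> *; lra. Qed.

(* [|a| - |a - s| >= s] is equivalent to [(a - s)^- <= a^-]: truncating by a
   nondecreasing barrier does not increase the negative variation. *)
Lemma tv_trunc_nondecreasing (mu sg : scharge) (A B h : R -> R) (s t : R) :
  (forall x y, s <= x -> x < y -> y <= t -> rc mu `]x, y]%classic = A y - A x) ->
  (forall x y, s <= x -> x < y -> y <= t -> rc sg `]x, y]%classic = h y - h x) ->
  (forall x, s <= x <= t -> h x = Num.max 0 (A x - B x)) ->
  (forall x y, s <= x -> x <= y -> y <= t -> B x <= B y) ->
  forall X, measurable X -> X `<=` `]s, t]%classic ->
    rc sg X <= tv mu X - tv (cadd mu (copp sg)) X.
Proof.
move=> muE sgE hE Bnd X mX Xst; set nu := cadd mu (copp sg).
have nuE Y : measurable Y -> rc nu Y = rc mu Y - rc sg Y.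
  by move=> mY; rewrite rc_add// rc_opp.
pose ng := charge_of_finite_measure (jordan_neg (hahn mu)).
have [_ mN] := measurable_hahn nu.
(* [nu] is the derivative of [A - h = min(A, B)]. As [B] does not decrease, this minimum can only
   drop where [A] drops, so [ng + nu] is nonnegative on half-open intervals, hence on every Borel
   subset, in particular on the negative set of [nu]. *)
have key : 0 <= rc (cadd ng nu) (X `&` hahn_neg nu).
  apply: (@charge_ge0_oc_in _ s t); last 2 first.
  - exact: measurableI.
  - by apply: subset_trans Xst; exact: subIsetl.
  move=> x y sx xy yt; rewrite rc_add// nuE// muE// sgE//.
  have := negp_ge0 mu `]x, y]%classic; have := posp_ge0 mu `]x, y]%classic.
  have := rc_jordan mu (measurable_itv `]x, y]); rewrite muE//.
  rewrite -[rc ng _]/(negp mu `]x, y]%classic) !hE; [|apply/andP; split; lra..].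
  have := Bnd x y sx (ltW xy) yt.
  by case: (leP 0 (A x - B x)); case: (leP 0 (A y - B y)); lra.
rewrite rc_add in key; last exact: measurableI.
have n1 := negpE nu mX.
have n2 : rc ng (X `&` hahn_neg nu) <= negp mu X.
  by apply: negp_le => //; exact: measurableI.
have := rc_jordan nu mX; rewrite nuE// => e2.
exact: (variation_arith (rc_jordan mu mX) e2 key n1 n2).
Qed.

(** The mirror image: under a nonincreasing [B], the function [min(A, B)] can only rise where [A]
    rises, so it is the positive variation that does not grow. *)
Lemma tv_trunc_nonincreasing (mu sg : scharge) (A B h : R -> R) (s t : R) :
  (forall x y, s <= x -> x < y -> y <= t -> rc mu `]x, y]%classic = A y - A x) ->
  (forall x y, s <= x -> x < y -> y <= t -> rc sg `]x, y]%classic = h y - h x) ->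
  (forall x, s <= x <= t -> h x = Num.max 0 (A x - B x)) ->
  (forall x y, s <= x -> x <= y -> y <= t -> B y <= B x) ->
  forall X, measurable X -> X `<=` `]s, t]%classic ->
    - rc sg X <= tv mu X - tv (cadd mu (copp sg)) X.
Proof.
move=> muE sgE hE Bnd X mX Xst; set nu := cadd mu (copp sg).
have nuE Y : measurable Y -> rc nu Y = rc mu Y - rc sg Y.
  by move=> mY; rewrite rc_add// rc_opp.
pose ps := charge_of_finite_measure (jordan_pos (hahn mu)).
have [mP _] := measurable_hahn nu.
have key : 0 <= rc (cadd ps (copp nu)) (X `&` hahn_pos nu).
  apply: (@charge_ge0_oc_in _ s t); last 2 first.
  - exact: measurableI.
  - by apply: subset_trans Xst; exact: subIsetl.
  move=> x y sx xy yt; rewrite rc_add// rc_opp// nuE// muE// sgE//.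
  have := negp_ge0 mu `]x, y]%classic; have := posp_ge0 mu `]x, y]%classic.
  have := rc_jordan mu (measurable_itv `]x, y]); rewrite muE//.
  rewrite -[rc ps _]/(posp mu `]x, y]%classic) !hE; [|apply/andP; split; lra..].
  have := Bnd x y sx (ltW xy) yt.
  by case: (leP 0 (A x - B x)); case: (leP 0 (A y - B y)); lra.
have mXP : measurable (X `&` hahn_pos nu) by exact: measurableI.
rewrite rc_add// rc_opp// in key.
have n1 := pospE nu mX.
have n2 : rc ps (X `&` hahn_pos nu) <= posp mu X.
  by apply: posp_le => //; exact: subIsetl.
have := rc_jordan nu mX; rewrite nuE// => e2; have e1 := rc_jordan mu mX.
exact: (variation_arith' e1 e2 key n1 n2).
Qed.

(** Frees the integral from the chosen Hahn decomposition: any representation of [nu] as a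
    difference of finite measures may be integrated instead. *)
Lemma charge_integralE nu (m1 m2 : {finite_measure set MR -> \bar R}) X (f : R -> R) (M : R) :
  (forall A, measurable A -> rc nu A = fine (m1 A) - fine (m2 A)) ->
  measurable X -> measurable_fun X f -> (forall x, X x -> `|f x| <= M) ->
  charge_integral nu X f = \int[m1]_(x in X) f x - \int[m2]_(x in X) f x.
Proof.
move=> nuE mX mf fM; apply: (@Rintegral_measureB _ _ _ _ _ _ _ M) => // A mA.
by rewrite -nuE// rc_jordan.
Qed.

End Charges.

(** * Increments of weakly differentiable functions *)

Section Increments.
Context {R : realType}.
Local Notation MR := (measurableTypeR R).

Lemma continuous_integrable_oc (a b : R) (f : R -> R) : continuous f ->
  leb.-integrable `]a, b] (EFin \o f).
Proof.
move=> cf; have h : leb.-integrable `[a, b] (EFin \o f).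
  apply: continuous_compact_integrable; first exact: segment_compact.
  by apply: continuous_subspaceT => x; exact: cf.
by apply: (integrableS _ _ _ h) => //; exact: subset_itv_oc_cc.
Qed.

Lemma integrableRB d (T : measurableType d) (mu : {measure set T -> \bar R})
    (D : set T) (f g : T -> R) : measurable D -> mu.-integrable D (EFin \o f) ->
  mu.-integrable D (EFin \o g) -> mu.-integrable D (EFin \o (fun z => f z - g z)).
Proof. by move=> mD h1 h2; exact: (integrableB mD h1 h2). Qed.

Lemma integrableRD d (T : measurableType d) (mu : {measure set T -> \bar R})
    (D : set T) (f g : T -> R) : measurable D -> mu.-integrable D (EFin \o f) ->
  mu.-integrable D (EFin \o g) -> mu.-integrable D (EFin \o (fun z => f z + g z)).
Proof. by move=> mD h1 h2; exact: (integrableD mD h1 h2). Qed.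

Lemma ae_imp (P Q : R -> Prop) : {ae leb, forall x, P x} ->
  (forall x, P x -> Q x) -> {ae leb, forall x, Q x}.
Proof. by move=> h PQ; apply: (@filterS _ _ (ae_filter_ringOfSetsType _)) h. Qed.

Lemma ae_and (P Q : R -> Prop) : {ae leb, forall x, P x} ->
  {ae leb, forall x, Q x} -> {ae leb, forall x, P x /\ Q x}.
Proof. exact: (@filterI _ _ (ae_filter_ringOfSetsType _)). Qed.

Lemma Rintegral_indic_cvg (m : {finite_measure set MR -> \bar R}) (X : set MR)
    (phi : nat -> R -> R) (A : set MR) :
  measurable X -> measurable A -> A `<=` X ->
  (forall n, continuous (phi n)) -> (forall n z, X z -> `|phi n z| <= 1) ->
  (forall z, X z -> phi n z @[n --> \oo] --> (\1_A z : R)) ->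
  \int[m]_(x in X) phi n x @[n --> \oo] --> fine (m A).
Proof.
move=> mX mA AX cphi phi1 phiA.
have -> : fine (m A) = \int[m]_(x in X) (\1_A x : R).
  by rewrite /Rintegral integral_indic// setIidl.
apply: (@Rintegral_dct _ _ _ _ _ _ _ (cst 1)) => //.
- by move=> n; exact: measurable_continuous.
- exact: finite_measure_integrable_cst.
Qed.

Lemma carrier_itv dom (a b z : R) : carrier dom a b z -> z \in `[a, b[.
Proof. by case: dom => /=; rewrite !in_itv/= => // /andP[/ltW-> ->]. Qed.

Lemma itv_carrier dom (a b z : R) : a < z < b -> carrier dom a b z.
Proof. by case: dom => /=; rewrite !in_itv/= => // /andP[/ltW-> ->]. Qed.

(** The definition of [Dv] is tested with functions tending to the indicator of []x, y]]. Dominated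
    convergence yields the mass of this interval on one side, and the averages against the
    derivatives yield the right limits on the other. *)
Lemma BV_deriv_increment dom (a b : R) (v : R -> R)
    (nu : {charge set (measurableTypeR R) -> \bar R}) (x y l1 l2 : R) :
  BV_deriv dom a b v nu -> a < x -> x < y -> y < b ->
  v z @[z --> x^'+] --> l1 -> v z @[z --> y^'+] --> l2 ->
  rc nu `]x, y]%classic = l2 - l1.
Proof.
move=> [iv hv] ax xy yb v1 v2.
have [phi [tphi phi1 phicvg philim]] := test_approx dom ax xy yb.
have mC := measurable_carrier dom a b.
have sub : `]x, y]%classic `<=` carrier dom a b.
  move=> z /=; rewrite in_itv/= => /andP[xz zy]; apply: itv_carrier.
  by rewrite (lt_trans ax)//= (le_lt_trans zy).
have c0 := philim v l1 l2 iv v1 v2.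
have cm (m : {finite_measure set MR -> \bar R}) :
    \int[m]_(z in carrier dom a b) phi n z @[n --> \oo] --> fine (m `]x, y]%classic).
  apply: Rintegral_indic_cvg => //.
  - by move=> n; apply: smooth_continuous; case: (tphi n).
  - by move=> n z /carrier_itv; exact: phi1.
  - by move=> z /carrier_itv; exact: phicvg.
have c2 : charge_integral nu (carrier dom a b) (phi n) @[n --> \oo] -->
    rc nu `]x, y]%classic.
  by rewrite rc_jordan//; apply: cvgB; exact: cm.
have c3 : - charge_integral nu (carrier dom a b) (phi n) @[n --> \oo] --> l1 - l2.
  by rewrite (_ : (fun n => _) = fun n => \int[leb]_(x in `]a, b[)
    (v x * ((phi n)^`())%classic x))//; apply/funext => n; rewrite hv.
have := cvg_unique (@Rhausdorff R) (cvgN c2) c3.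
by move=> e; rewrite -[LHS]opprK e opprB.
Qed.

(** The same passage to the limit with a density [k] in place of a measure. It serves the flux in
    space, the pairings of [u] in time and the competitors of the obstacle problem. *)
Lemma weak_deriv_increment dom (a b : R) (v k : R -> R) (x y l1 l2 : R) :
  leb.-integrable `]a, b[ (EFin \o v) -> leb.-integrable `]a, b[ (EFin \o k) ->
  (forall phi, test_function dom a b phi ->
    \int[leb]_(x in `]a, b[) (k x * phi x) =
    - \int[leb]_(x in `]a, b[) (v x * (phi^`())%classic x)) ->
  a < x -> x < y -> y < b ->
  v z @[z --> x^'+] --> l1 -> v z @[z --> y^'+] --> l2 ->
  \int[leb]_(z in `]x, y]) k z = l2 - l1.
Proof.
move=> iv ik hv ax xy yb v1 v2.
have [phi [tphi phi1 phicvg philim]] := test_approx dom ax xy yb.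
have c0 := philim v l1 l2 iv v1 v2.
have mab : measurable (`]a, b[%classic : set MR) by exact: measurable_itv.
have mk : measurable_fun (`]a, b[%classic : set MR) k.
  by case/integrableP : ik => /measurable_EFinP.
have cphi n : continuous (phi n) by apply: smooth_continuous; case: (tphi n).
have mxy : measurable (`]x, y]%classic : set MR) by exact: measurable_itv.
have sub : `]x, y]%classic `<=` `]a, b[%classic.
  move=> z /=; rewrite !in_itv/= => /andP[xz zy].
  by rewrite (lt_trans ax)//= (le_lt_trans zy).
have inab z : `]a, b[%classic z -> z \in `[a, b[ by exact: subset_itv_oo_co.
have c2 : \int[leb]_(z in `]a, b[) (k z * phi n z) @[n --> \oo] -->
    \int[leb]_(z in `]x, y]) k z.
  have -> : \int[leb]_(z in `]x, y]) k z =
      \int[leb]_(z in `]a, b[) (k z * (\1_(`]x, y]%classic) z : R)).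
    rewrite -{1}(setIidr sub) Rintegral_mkcondr; apply: eq_Rintegral => z _.
    by rewrite patchE indicE; case: ifP => _; rewrite ?mulr1 ?mulr0.
  apply: (@Rintegral_dct R _ MR leb `]a, b[%classic (fun n z => k z * phi n z)
    (fun z => k z * (\1_(`]x, y]%classic) z : R)) (fun z => `|k z|)) => //.
  - by move=> n; apply: measurable_funM => //; exact: measurable_continuous.
  - by apply: measurable_funM => //; exact: measurable_indic.
  - by move=> z zab; apply: cvgM; [exact: cvg_cst|exact: phicvg (inab _ zab)].
  - exact: integrable_norm.
  - by move=> n z zab; rewrite normrM ler_piMr// phi1// inab.
have c3 : \int[leb]_(z in `]a, b[) (k z * phi n z) @[n --> \oo] --> - (l1 - l2).
  rewrite (_ : (fun n => _) = fun n => - \int[leb]_(x in `]a, b[)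
    (v x * ((phi n)^`())%classic x)); first exact: cvgN.
  by apply/funext => n; rewrite hv.
by rewrite (cvg_unique (@Rhausdorff R) c2 c3) opprB.
Qed.

Lemma right_limit_dist (v : R -> R) (y l0 l e : R) :
  v z @[z --> y^'+] --> l -> (\forall z \near y^'+, `|l0 - v z| <= e) ->
  `|l0 - l| <= e.
Proof.
move=> vl h; rewrite leNgt; apply/negP => el.
move/cvgrPdist_lt : vl => /(_ (`|l0 - l| - e)); rewrite subr_gt0 => /(_ el) h2.
near y^'+ => z.
have h3 : `|l0 - v z| <= e by near: z.
have h4 : `|l - v z| < `|l0 - l| - e by near: z.
have := ler_distD (v z) l0 l; rewrite (distrC (v z) l) => h5.
by move: h3 h4 h5; lra.
Unshelve. all: by end_near. Qed.

Lemma right_limit_rc (a b x : R) (v U : R -> R) :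
  (forall y, a < y < b -> v z @[z --> y^'+] --> U y) -> a < x < b ->
  U y @[y --> x^'+] --> U x.
Proof.
move=> vU /andP[ax xb]; apply/cvgrPdist_le => e e0.
have /cvgrPdist_le/(_ _ e0)[r /= r0 hr] := vU x (introT andP (conj ax xb)).
near=> y.
have xy : x < y by near: y; exact: nbhs_right_gt.
have yb : y < b by near: y; exact: nbhs_right_lt.
have yr : y < x + r by near: y; apply: nbhs_right_lt; rewrite ltrDl.
apply: (@right_limit_dist v y); first by apply: vU; rewrite (lt_trans ax xy) yb.
near=> z.
have yz : y < z by near: z; exact: nbhs_right_gt.
have zr : z < x + r by near: z; exact: nbhs_right_lt.
apply: hr => /=; last exact: lt_trans yz.
by rewrite distrC gtr0_norm; lra.
Unshelve. all: by end_near. Qed.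

(* At a Lebesgue point the value is the derivative of the primitive, which the
   right limit determines. *)
Lemma right_limit_ae (a b : R) (v U : R -> R) :
  leb.-integrable `]a, b[ (EFin \o v) ->
  (forall y, a < y < b -> v z @[z --> y^'+] --> U y) ->
  {ae leb, forall x, x \in `]a, b[ -> v x = U x}.
Proof.
move=> iv vU; pose f := v \_ `]a, b[%classic.
have mab : measurable (`]a, b[%classic : set MR) by exact: measurable_itv.
have intf (E : set MR) : measurable E -> leb.-integrable E (EFin \o f).
  move=> mE; rewrite /f -restrict_EFin; apply/integrable_restrict => //.
  by apply: (integrableS _ _ _ iv) => //; exact: measurableI.
have lf : locally_integrable [set: R] f by exact: integrable_locally.
pose F (x : R) := \int[leb]_(t in `]-oo, x]) f t.
apply: ae_imp (FTC1Ny (fun y => intf _ (measurable_itv `]-oo, y])) lf) _.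
rewrite -/F => x [dF F'x]; rewrite in_itv/= => /andP[ax xb].
have <- : f x = v x by rewrite /f patchE mem_set//= in_itv/= ax xb.
rewrite -F'x derive1E.
have h1 : h^-1 *: (F (h *: 1 + x) - F x) @[h --> (0 : R)^'] --> 'D_1 F x.
  exact: dF.
have h2 : h^-1 *: (F (h *: 1 + x) - F x) @[h --> (0 : R)^'+] --> 'D_1 F x.
  apply: cvg_trans h1; apply: cvg_app; apply: within_subset.
  by move=> u /= u0; rewrite gt_eqF.
apply: (cvg_unique (@Rhausdorff R) h2).
(* The right difference quotient of [F] is the mean of [v] over []x, x + h]], and all these values
   are close to the right limit [U x]. *)
apply/cvgrPdist_le => e e0.
have /cvgrPdist_le/(_ _ e0)[r /= r0 hr] := vU x (introT andP (conj ax xb)).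
near=> h.
have h0 : 0 < h by near: h; exact: nbhs_right_gt.
have hb : h < b - x by near: h; apply: nbhs_right_lt; rewrite subr_gt0.
have hr' : h < r by near: h; exact: nbhs_right_lt.
have Fh : F (h *: 1 + x) - F x = \int[leb]_(z in `]x, x + h]) f z.
  rewrite [h *: 1]mulr1 (addrC h) -(@Rintegral_itvB _ f -oo%O (BRight (x + h)) x)//.
  - exact: intf.
  - by rewrite bnd_simp lerDl ltW.
have mh : fine (leb (`]x, x + h]%classic : set R)) = h.
  by rewrite lebesgue_measure_itv/= lte_fin ltrDl h0/= addrAC subrr add0r.
have icst (c : R) : leb.-integrable `]x, x + h] (EFin \o cst c).
  by apply: continuous_integrable_oc => z; exact: cvg_cst.
rewrite Fh; set I := Rintegral _ _ _.
have -> : U x - h^-1 *: I = h^-1 * (U x * h - I).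
  by rewrite mulrBr mulrCA mulVf ?gt_eqF// mulr1.
rewrite normrM ger0_norm ?invr_ge0 ?(ltW h0)// ler_pdivrMl//.
have -> : U x * h = \int[leb]_(z in `]x, x + h]) U x by rewrite Rintegral_cst// mh.
have -> : h * e = \int[leb]_(z in `]x, x + h]) e by rewrite Rintegral_cst// mh mulrC.
have iUf : leb.-integrable `]x, x + h] (EFin \o (fun z => U x - f z)).
  by apply: integrableRB => //; [exact: icst|exact: intf].
rewrite /I -RintegralB//; [|exact: icst|exact: intf].
apply: le_trans (le_normr_Rintegral _ iUf) _ => //.
apply: le_Rintegral => //.
- exact: (integrable_norm iUf).
- exact: icst.
- move=> z /=; rewrite in_itv/= => /andP[xz zh].
  have -> : f z = v z by rewrite /f patchE mem_set//= in_itv/=; apply/andP; split; lra.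
  by apply: hr => //=; rewrite distrC gtr0_norm; lra.
Unshelve. all: by end_near. Qed.

End Increments.

(** * Integration by parts against a finite measure *)

Section ByParts.
Context {R : realType}.
Local Notation MR := (measurableTypeR R).

Lemma measurable_triangle (c : R) : measurable [set z : MR * MR | c < z.1 /\ z.1 <= z.2].
Proof.
have -> : [set z : MR * MR | c < z.1 /\ z.1 <= z.2] =
    (fst @^-1` `]c, +oo[%classic) `&` (setT `&` [set z | z.1 <= z.2]).
  by apply/seteqP; split => z /=; rewrite in_itv/= andbT => -[]// ? [].
apply: measurableI.
- by rewrite -[X in measurable X]setTI; apply: measurable_fst => //; exact: measurable_itv.
- by apply: measurable_fun_le.
Qed.

(** Write [F y] as [F d] minus the integral of [k] over [[y, d]] and exchange the integrals of
    [dm(y)] and [dx] on the triangle [c < y <= x <= d]. The set [X] is kept apart from []c, d]] so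
    that integrals over the whole domain are covered; [m] has no mass on the rest of [X]. *)
Lemma measure_by_parts (m : {finite_measure set MR -> \bar R}) (c d : R) (X : set MR)
    (F k : R -> R) (M : R) : c < d -> measurable X ->
  `]c, d]%classic `<=` X -> m (X `\` `]c, d]%classic) = 0%E ->
  measurable_fun X F -> (forall x, X x -> `|F x| <= M) ->
  leb.-integrable `]c, d] (EFin \o k) ->
  (forall y, c < y <= d -> F d - F y = \int[leb]_(x in `[y, d]) k x) ->
  \int[m]_(y in X) F y = F d * fine (m `]c, d]%classic) -
    \int[leb]_(x in `]c, d]) (k x * fine (m `]c, x]%classic)) /\
  leb.-integrable `]c, d] (EFin \o (fun x => k x * fine (m `]c, x]%classic))).
Proof.
move=> cd mX cdX mX0 mF FM ik hF.
have mcd : measurable (`]c, d]%classic : set MR) by exact: measurable_itv.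
have finm (A : set MR) : measurable A -> (m A < +oo)%E.
  by move=> mA; rewrite ltey_eq fin_num_measure.
have bint (A : set MR) (g : R -> R) (K : R) : measurable A -> measurable_fun A g ->
    (forall x, A x -> `|g x| <= K) -> m.-integrable A (EFin \o g).
  move=> mA mg gK; apply: measurable_bounded_integrable => //; first exact: finm.
  exact: boundedP gK.
have iF : m.-integrable X (EFin \o F) by exact: bint FM.
(* Cutting [k] off supplies the bound [x <= d] of the triangle, so the set [A] below only has to
   express [c < y <= x]. *)
pose k0 := k \_ `]c, d]%classic.
have ik0 : leb.-integrable setT (EFin \o k0).
  by rewrite /k0 -restrict_EFin; apply/integrable_restrict => //; rewrite setTI.
have mk0 : measurable_fun setT k0 by case/integrableP : ik0 => /measurable_EFinP.
pose A := [set z : MR * MR | c < z.1 /\ z.1 <= z.2].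
have mA : measurable A by exact: measurable_triangle.
pose f (z : MR * MR) := ((\1_A z : R) * k0 z.2)%:E.
have mf : measurable_fun setT f.
  apply/measurable_EFinP; apply: measurable_funM; first exact: measurable_indic.
  by apply: measurableT_comp => //; exact: measurable_snd.
have intf : (m \x leb)%E.-integrable setT f.
  apply/integrable12ltyP => //.
  have C0 : (\int[leb]_x `|k0 x|%:E < +oo)%E by case/integrableP : ik0.
  apply: (@le_lt_trans _ _ (\int[m]_y (cst (\int[leb]_x `|k0 x|%:E) y))%E).
    apply: ge0_le_integral => //.
    - by move=> y _; apply: integral_ge0.
    - apply: (@measurable_fun_fubini_tonelli_F _ _ _ _ _ leb (fun z => `|f z|%E)) => //.
      exact: measurableT_comp.
    - move=> y _; apply: ge0_le_integral => //.
      + by apply: measurableT_comp => //; apply: measurableT_comp mf _; exact: pair1_measurable.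
      + by apply/measurable_EFinP; exact: measurableT_comp.
      + move=> x _; rewrite /f /= lee_fin normrM ler_piMl//.
        by rewrite indicE; case: (_ \in _); rewrite ?normr1 ?normr0.
  rewrite integral_cst// lte_mul_pinfty//; first exact: integral_ge0.
  - by rewrite ge0_fin_numE//; exact: integral_ge0.
  - exact: finm.
have fub := Fubini intf.
have inner1 y : (\int[leb]_x f (y, x))%E =
    (if (c < y) && (y <= d) then F d - F y else 0)%:E.
  case: ifPn => [/andP[cy yd]|h].
    rewrite hF ?cy// /Rintegral fineK; last first.
      apply: integrable_fin_num => //; apply: (integrableS _ _ _ ik) => // x /=.
      by rewrite !in_itv/= => /andP[yx ->]; rewrite (lt_le_trans cy).
    rewrite [RHS]integral_mkcond; apply: eq_integral => x _.
    have e1 : ((y, x) \in A) = (y <= x).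
      by apply/idP/idP => [/set_mem/=[]//|yx]; apply/mem_set.
    have e2 : (x \in `]c, d]%classic) = (c < x <= d).
      by apply/idP/idP => [/set_mem|h]; [rewrite /= in_itv|apply/mem_set; rewrite /= in_itv].
    have e3 : (x \in `[y, d]%classic) = (y <= x <= d).
      by apply/idP/idP => [/set_mem|h]; [rewrite /= in_itv|apply/mem_set; rewrite /= in_itv].
    rewrite /f /= patchE indicE /k0 patchE e1 e2 e3.
    case: (leP y x) => yx /=; last by rewrite mul0r.
    by rewrite (lt_le_trans cy yx)/=; case: (x <= d); rewrite ?mul1r ?mulr0.
  rewrite integral0_eq// => x _; rewrite /f indicE.
  have [/set_mem/=[cy yx]|_] := boolP ((y, x) \in A); last by rewrite mul0r.
  rewrite /k0 patchE memNset ?mulr0//= in_itv/= => /andP[cx xd].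
  by move: h; rewrite cy (le_trans yx).
have inner2 x : (\int[m]_y f (y, x))%E = (k0 x * fine (m `]c, x]%classic))%:E.
  rewrite (_ : (fun y => f (y, x)) = fun y => ((k0 x)%:E * (\1_(`]c, x]%classic) y)%:E)%E); last first.
    apply/funext => y; rewrite /f -EFinM mulrC; congr ((_ * _)%:E).
    rewrite !indicE; congr ((_ : bool)%:R).
    by apply/idP/idP => /set_mem h; apply/mem_set; move: h; rewrite /A /= in_itv/= => /andP.
  rewrite integralZl//; last first.
    by apply: (@bint _ _ 1) => // z _; rewrite indicE; case: (_ \in _); rewrite ?normr1 ?normr0.
  rewrite integral_indic// setIT EFinM; congr (_ * _)%E.
  exact: fin_num_fine_measure.
have ih : leb.-integrable setT (EFin \o (fun x => k0 x * fine (m `]c, x]%classic))).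
  have mh : measurable_fun setT (fun x : R => fine (m `]c, x]%classic)).
    apply: nondecreasing_measurable => // x y xy.
    apply: fine_le; rewrite ?fin_num_measure//; apply: le_measure; rewrite ?inE//.
    exact: subset_itvl.
  have := @integrableMl _ _ _ leb setT measurableT _ _ ik0 mh.
  apply; apply: (@boundedP _ _ _ _ (fine (m setT))) => x _.
  rewrite ger0_norm ?fine_ge0//.
  by apply: fine_le; rewrite ?fin_num_measure//; apply: le_measure; rewrite ?inE.
have ih' : leb.-integrable `]c, d] (EFin \o (fun x => k x * fine (m `]c, x]%classic))).
  have ihS : leb.-integrable `]c, d] (EFin \o (fun x => k0 x * fine (m `]c, x]%classic))).
    by apply: integrableS ih.
  by apply: eq_integrable ihS => // x xcd; rewrite /= /k0 patchE xcd.
split=> //.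
have -> : \int[m]_(y in X) F y = \int[m]_(y in `]c, d]) F y.
  rewrite /Rintegral (@negligible_integral _ _ _ m X (X `\` `]c, d]%classic))//; last first.
    exact: measurableD.
  by rewrite setDD setIidr.
have mFcd : measurable_fun (`]c, d]%classic : set MR) F by exact: measurable_funS mF.
have iFcd : m.-integrable `]c, d] (EFin \o F) by exact: integrableS iF.
have -> : F d * fine (m `]c, d]%classic) = \int[m]_(y in `]c, d]) F d.
  by rewrite Rintegral_cst.
have iFd : m.-integrable `]c, d] (EFin \o cst (F d)) by exact: (@bint _ _ `|F d|).
have -> : \int[leb]_(x in `]c, d]) (k x * fine (m `]c, x]%classic)) =
    \int[m]_(y in `]c, d]) (F d - F y).
  have -> : \int[m]_(y in `]c, d]) (F d - F y) = fine (\int[m]_y \int[leb]_x f (y, x))%E.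
    rewrite Rintegral_mkcond /Rintegral; congr fine; apply: eq_integral => y _.
    rewrite inner1 patchE; congr EFin; case: ifPn.
      by rewrite inE/= in_itv/= => ->.
    by rewrite notin_setE/= in_itv/= => /negP/negbTE ->.
  rewrite fub Rintegral_mkcond /Rintegral; congr fine; apply: eq_integral => x _.
  by rewrite inner2 /k0 !patchE; case: ifP => _ //; rewrite mul0r.
by rewrite RintegralB//; ring.
Qed.

End ByParts.

(** * The static comparison inequality *)

Section ChargeTools.
Context {R : realType}.
Local Notation MR := (measurableTypeR R).
Local Notation scharge := (charge MR R).
Implicit Types (nu sg mu : scharge).

Lemma rc_le_posp nu (A X : set MR) : measurable A -> measurable X -> A `<=` X ->
  rc nu A <= posp nu X.
Proof.
move=> mA mX AX; apply: le_trans (posp_le nu mA mX AX).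
by rewrite rc_jordan// lerBlDr lerDl negp_ge0.
Qed.

Lemma rc_ge_negp nu (A X : set MR) : measurable A -> measurable X -> A `<=` X ->
  - rc nu A <= negp nu X.
Proof.
move=> mA mX AX; apply: le_trans (negp_le nu mA mX AX).
by rewrite rc_jordan// opprB lerBlDr lerDl posp_ge0.
Qed.

(** The positive variation is attained on a Hahn set. Together with [rc_le_posp] this describes it
    as a supremum over subsets, with no trace of the decomposition. *)
Lemma posp_le_rc nu (X : set MR) (M : R) : measurable X ->
  (forall A, measurable A -> A `<=` X -> rc nu A <= M) -> posp nu X <= M.
Proof.
move=> mX h; rewrite pospE//; apply: h; last exact: subIsetl.
by apply: measurableI => //; case: (measurable_hahn nu).
Qed.

Lemma negp_le_rc nu (X : set MR) (M : R) : measurable X ->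
  (forall A, measurable A -> A `<=` X -> - rc nu A <= M) -> negp nu X <= M.
Proof.
move=> mX h; rewrite negpE//; apply: h; last exact: subIsetl.
by apply: measurableI => //; case: (measurable_hahn nu).
Qed.

(** The Hahn sets chosen for two charges may differ even where the charges agree, so the Jordan
    parts are compared through suprema over subsets of [X]. *)
Lemma tv_ext nu mu (X : set MR) : measurable X ->
  (forall A, measurable A -> A `<=` X -> rc nu A = rc mu A) -> tv nu X = tv mu X.
Proof.
move=> mX h; rewrite /tv; congr (_ + _); apply/le_anti/andP; split.
- by apply: posp_le_rc => // A mA AX; rewrite h// rc_le_posp.
- by apply: posp_le_rc => // A mA AX; rewrite -h// rc_le_posp.
- by apply: negp_le_rc => // A mA AX; rewrite h// rc_ge_negp.
- by apply: negp_le_rc => // A mA AX; rewrite -h// rc_ge_negp.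
Qed.

Lemma tv_opp nu mu (X : set MR) : measurable X ->
  (forall A, measurable A -> A `<=` X -> rc nu A = - rc mu A) -> tv nu X = tv mu X.
Proof.
move=> mX h; rewrite /tv [RHS]addrC; congr (_ + _); apply/le_anti/andP; split.
- by apply: posp_le_rc => // A mA AX; rewrite h// rc_ge_negp.
- by apply: negp_le_rc => // A mA AX; rewrite -h// rc_le_posp.
- by apply: negp_le_rc => // A mA AX; rewrite h// opprK rc_le_posp.
- apply: posp_le_rc => // A mA AX; rewrite -[rc mu A]opprK -h//.
  exact: rc_ge_negp.
Qed.

Lemma bounded_integrable (m : {finite_measure set MR -> \bar R}) (X : set MR)
    (f : R -> R) (M : R) : measurable X -> measurable_fun X f ->
  (forall x, X x -> `|f x| <= M) -> m.-integrable X (EFin \o f).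
Proof.
move=> mX mf fM; apply: measurable_bounded_integrable => //.
  by rewrite ltey_eq fin_num_measure.
exact: boundedP fM.
Qed.

Lemma finite_measure_sum (m1 m2 : {finite_measure set MR -> \bar R}) :
  exists2 m : {finite_measure set MR -> \bar R},
    forall A, measurable A -> fine (m A) = fine (m1 A) + fine (m2 A) &
    forall (X : set MR) (f : R -> R) (M : R), measurable X -> measurable_fun X f ->
      (forall x, X x -> `|f x| <= M) ->
      \int[m]_(x in X) f x = \int[m1]_(x in X) f x + \int[m2]_(x in X) f x.
Proof.
have fin : (measure_add m1 m2 setT < +oo)%E.
  by rewrite measure_addE ltey_eq fin_numD !fin_num_measure.
pose m : {finite_measure set MR -> \bar R} := mfrestr (@measurableT _ MR) fin.
have mE A : m A = (m1 A + m2 A)%E.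
  by rewrite /m /= /mfrestr /mrestr setIT; exact: measure_addE.
exists m => [A mA|X f M mX mf fM].
  by rewrite mE fineD ?fin_num_measure.
have i1 := bounded_integrable m1 mX mf fM.
have i2 := bounded_integrable m2 mX mf fM.
rewrite /Rintegral -fineD; [|exact: integrable_fin_num|exact: integrable_fin_num].
congr fine; rewrite -(integral_measure_add mX i1 i2).
apply: eq_measure_integral => A mA _.
exact: etrans (mE A) (esym (measure_addE m1 m2 A)).
Qed.

Lemma charge_integralD nu mu sg (X : set MR) (f : R -> R) (M : R) :
  (forall A, measurable A -> rc nu A = rc mu A + rc sg A) ->
  measurable X -> measurable_fun X f -> (forall x, X x -> `|f x| <= M) ->
  charge_integral nu X f = charge_integral mu X f + charge_integral sg X f.
Proof.
move=> nuE mX mf fM.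
have [p pE pI] := finite_measure_sum (jordan_pos (hahn mu)) (jordan_pos (hahn sg)).
have [n nE nI] := finite_measure_sum (jordan_neg (hahn mu)) (jordan_neg (hahn sg)).
rewrite (@charge_integralE _ nu p n _ _ M)// => [|A mA]; last first.
  by rewrite nuE// (rc_jordan mu)// (rc_jordan sg)// pE// nE// /posp /negp; ring.
by rewrite (pI _ _ M)// (nI _ _ M)// /charge_integral; ring.
Qed.

Lemma charge_integralN nu mu (X : set MR) (f : R -> R) (M : R) :
  (forall A, measurable A -> rc nu A = - rc mu A) ->
  measurable X -> measurable_fun X f -> (forall x, X x -> `|f x| <= M) ->
  charge_integral nu X f = - charge_integral mu X f.
Proof.
move=> nuE mX mf fM.
rewrite (@charge_integralE _ nu (jordan_neg (hahn mu)) (jordan_pos (hahn mu)) _ _ M)//.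
  by rewrite /charge_integral; ring.
by move=> A mA; rewrite nuE// rc_jordan// /posp /negp; ring.
Qed.

Lemma charge_integralDf nu (X : set MR) (f g : R -> R) (M : R) :
  measurable X -> measurable_fun X f -> (forall x, X x -> `|f x| <= M) ->
  measurable_fun X g -> (forall x, X x -> `|g x| <= M) ->
  charge_integral nu X (fun x => f x + g x) =
  charge_integral nu X f + charge_integral nu X g.
Proof.
move=> mX mf fM mg gM; rewrite /charge_integral.
rewrite !RintegralD//; try by apply: (@bounded_integrable _ _ _ M).
ring.
Qed.

Lemma charge_integralU nu (A B : set MR) (f : R -> R) (M : R) :
  measurable A -> measurable B -> A `&` B = set0 -> measurable_fun (A `|` B) f ->
  (forall x, (A `|` B) x -> `|f x| <= M) ->
  charge_integral nu (A `|` B) f = charge_integral nu A f + charge_integral nu B f.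
Proof.
move=> mA mB AB mf fM; rewrite /charge_integral.
have AB' : [disjoint A & B] by apply/disj_setPS; rewrite AB.
have mAB := measurableU _ _ mA mB.
rewrite !Rintegral_setU//; try by apply: (@bounded_integrable _ _ _ M).
ring.
Qed.

(** A Jordan decomposition by hand: since [m] dominates the increments of [h], the sum of [h] and
    the distribution function of [m] is nondecreasing. Its Stieltjes measure and [m], both
    restricted to []c, d]], are the two parts. *)
Lemma stieltjes_charge (h : R -> R) (c d : R) (m : {finite_measure set MR -> \bar R}) :
  c < d -> right_continuous h -> (forall x, x <= c -> h x = 0) ->
  (forall x, d <= x -> h x = 0) ->
  (forall x y, c <= x -> x < y -> y <= d -> `|h y - h x| <= fine (m `]x, y]%classic)) ->
  measurable_fun setT h /\
  exists m1 m2 : {finite_measure set MR -> \bar R}, [/\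
    forall x y, c <= x -> x < y -> y <= d ->
      fine (m1 `]x, y]%classic) - fine (m2 `]x, y]%classic) = h y - h x,
    forall A, measurable A -> A `&` `]c, d]%classic = set0 -> m1 A = 0%E &
    forall A, measurable A -> A `&` `]c, d]%classic = set0 -> m2 A = 0%E].
Proof.
move=> cd rch hc hd hm.
pose f x := h x + fine (m `]-oo, x]%classic).
have ndf : {homo f : x y / x <= y}.
  move=> x y; rewrite le_eqVlt => /predU1P[->//|xy]; rewrite /f.
  have mono := @cdf_mono _ m _ _ (ltW xy).
  have [yc|cy] := leP y c; first by rewrite !hc ?add0r// (le_trans (ltW xy)).
  have [dx|xd] := leP d x; first by rewrite !hd ?add0r// (le_trans dx (ltW xy)).
  (* [h] vanishes outside [(c, d)], so its increment is unchanged when the end points are moved into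
     [[c, d]], where [hm] applies. *)
  pose x' := Num.max x c; pose y' := Num.min y d.
  have hx : h x = h x'.
    by rewrite /x'; have [xc|//] := ltP x c; rewrite !hc// ltW.
  have hy : h y = h y'.
    by rewrite /y'; have [//|dy] := ltP y d; rewrite !hd.
  have xy' : x' < y' by rewrite /x' /y' gt_max !lt_min xy xd cy cd.
  have cx' : c <= x' by rewrite /x' le_max lexx orbT.
  have yd' : y' <= d by rewrite /y' ge_min lexx orbT.
  have := hm x' y' cx' xy' yd'; rewrite (cdfB _ (ltW xy')) -hx -hy.
  have := @cdf_mono _ m x x' (ltac:(by rewrite /x' le_max lexx)).
  have := @cdf_mono _ m y' y (ltac:(by rewrite /y' ge_min lexx)).
  by rewrite ler_norml => e1 e2 /andP[e3 e4]; lra.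
have rcf : right_continuous f by move=> x; apply: cvgD; [exact: rch|exact: cdf_rc].
split.
  rewrite (_ : h = fun x => f x - fine (m `]-oo, x]%classic)); last first.
    by apply/funext => x; rewrite /f addrK.
  apply: measurable_funB; first exact: nondecreasing_measurable.
  by apply: nondecreasing_measurable => // x y xy; exact: cdf_mono.
have [L LE] := stieltjes ndf rcf.
have mcd : measurable (`]c, d]%classic : set MR) by exact: measurable_itv.
have fL : (L `]c, d]%classic < +oo)%E by rewrite LE ?ltry// ltW.
have fm : (m `]c, d]%classic < +oo)%E by rewrite ltey_eq fin_num_measure.
exists (mfrestr mcd fL), (mfrestr mcd fm); split.
- move=> x y cx xy yd; rewrite /= /mfrestr /mrestr.
  rewrite (setIidl (_ : `]x, y]%classic `<=` `]c, d]%classic)); last first.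
    by move=> z /=; rewrite !in_itv/= => /andP[xz zy]; rewrite (le_lt_trans cx)//= (le_trans zy).
  by rewrite LE ?ltW// (cdfB _ (ltW xy)) /f/=; ring.
- by move=> A mA A0; rewrite /= /mfrestr /mrestr A0 measure0.
- by move=> A mA A0; rewrite /= /mfrestr /mrestr A0 measure0.
Qed.

(* [xi] is a selection of [sgn (B')] on [(s, t]], where [B] is monotone or constant. *)
Definition half_slope (B xi : R -> R) (s t : R) : Prop :=
  [\/ (forall x y, s <= x -> x <= y -> y <= t -> B x <= B y) /\
      (forall z, s < z <= t -> xi z = 1),
      (forall x y, s <= x -> x <= y -> y <= t -> B y <= B x) /\
      (forall z, s < z <= t -> xi z = - 1) |
      (forall x y, s <= x -> x <= y -> y <= t -> B x = B y) /\
      (forall z, s < z <= t -> `|xi z| <= 1)].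

(** For monotone [B] the selection is the constant 1 or -1 and the claim is a truncation lemma. For
    constant [B] both truncation lemmas apply, and together they bound the whole variation of [sg],
    which dominates the integral of any [xi] with values in [[-1, 1]]. *)
Lemma half_slope_ineq (mu sg : scharge) (A B h xi : R -> R) (s t : R) :
  (forall x y, s <= x -> x < y -> y <= t -> rc mu `]x, y]%classic = A y - A x) ->
  (forall x y, s <= x -> x < y -> y <= t -> rc sg `]x, y]%classic = h y - h x) ->
  (forall x, s <= x <= t -> h x = Num.max 0 (A x - B x)) ->
  continuous xi -> half_slope B xi s t ->
  charge_integral sg `]s, t]%classic xi <=
    tv mu `]s, t]%classic - tv (cadd mu (copp sg)) `]s, t]%classic.
Proof.
move=> muE sgE hE cxi; pose E : set MR := `]s, t]%classic; rewrite -/E.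
have mE : measurable E by exact: measurable_itv.
have cstE (r : R) : (forall z, s < z <= t -> xi z = r) ->
    charge_integral sg E xi = r * rc sg E.
  move=> xir; rewrite /charge_integral !(@eq_Rintegral _ _ _ _ E (cst r) xi).
  - by rewrite !Rintegral_cst// rc_jordan// /posp /negp; ring.
  - by move=> z; rewrite inE /E/= in_itv/= => /xir.
  - by move=> z; rewrite inE /E/= in_itv/= => /xir.
case=> [[Bm xi1]|[Bm xi1]|[Bm xi1]].
- rewrite (cstE 1)// mul1r.
  by have := tv_trunc_nondecreasing muE sgE hE Bm mE; exact.
- rewrite (cstE (-1))// mulN1r.
  by have := tv_trunc_nonincreasing muE sgE hE Bm mE; exact.
have Bm1 x y : s <= x -> x <= y -> y <= t -> B x <= B y by move=> *; rewrite (Bm x y).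
have Bm2 x y : s <= x -> x <= y -> y <= t -> B y <= B x by move=> *; rewrite (Bm x y).
have [mP mN] := measurable_hahn sg; have [_ _ PNT PN0] := hahn sg.
have mEP := measurableI _ _ mE mP; have mEN := measurableI _ _ mE mN.
(* Each bound is used on the Hahn set of [sg] where it has the right sign, so that the sum of the
   two left sides is the total variation of [sg] on [E]. *)
have h1 := tv_trunc_nondecreasing muE sgE hE Bm1 mEP (@subIsetl _ _ _).
have h2 := tv_trunc_nonincreasing muE sgE hE Bm2 mEN (@subIsetl _ _ _).
have EPN : E = (E `&` hahn_pos sg) `|` (E `&` hahn_neg sg).
  by rewrite -setIUr PNT setIT.
have EPN0 : (E `&` hahn_pos sg) `&` (E `&` hahn_neg sg) = set0.
  by rewrite setIACA PN0 setI0.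
rewrite -pospE// in h1; rewrite -negpE// in h2.
have t1 := tvU mu mEP mEN EPN0; have t2 := tvU (cadd mu (copp sg)) mEP mEN EPN0.
rewrite -EPN in t1 t2.
have xib z : E z -> `|xi z| <= 1 by rewrite /E/= in_itv/= => /xi1.
have mxi : measurable_fun E xi by exact: measurable_continuous.
have ub (m : {finite_measure set MR -> \bar R}) : `|\int[m]_(x in E) xi x| <= fine (m E).
  have i1 := bounded_integrable m mE mxi xib.
  apply: le_trans (le_normr_Rintegral mE i1) _.
  rewrite -[fine _]mul1r -(Rintegral_cst _ mE); apply: le_Rintegral => //.
  - exact: integrable_norm.
  - exact: finite_measure_integrable_cst.
have u1 := ub (jordan_pos (hahn sg)); have u2 := ub (jordan_neg (hahn sg)).
rewrite /charge_integral.
move: u1 u2 h1 h2; rewrite -/(posp sg E) -/(negp sg E) !ler_norml t1 t2.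
by move=> /andP[_ u1] /andP[u2 _] h1 h2; lra.
Qed.

End ChargeTools.

(** * The subdifferential inequality tested with a truncation *)

Section StaticInequality.
Context {R : realType}.
Local Notation MR := (measurableTypeR R).
Local Notation scharge := (charge MR R).

Lemma lipschitz_continuous (w : R -> R) (K : R) :
  0 <= K -> (forall x y, `|w y - w x| <= K * `|y - x|) -> continuous w.
Proof.
move=> K0 wK x; apply/cvgrPdist_lt => e e0.
have K1 : 0 < K + 1 by rewrite ltr_wpDl.
near=> y; apply: (le_lt_trans (wK y x)).
have : `|x - y| < e / (K + 1).
  by near: y; apply/nbhs_ballP; exists (e / (K + 1)) => //=; rewrite divr_gt0.
rewrite ltr_pdivlMr// mulrDr mulr1 mulrC; apply: le_lt_trans.
by rewrite lerDl.
Unshelve. all: by end_near. Qed.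

Lemma pos_part_lip (p q : R) : `|Num.max 0 p - Num.max 0 q| <= `|p - q|.
Proof.
have : - `|p - q| <= p - q <= `|p - q| by rewrite -ler_norml.
move: `|p - q| => e /andP[h1 h2].
by case: (leP 0 p) => hp; case: (leP 0 q) => hq; rewrite ler_norml; apply/andP; split; lra.
Qed.

(** [h] is the distribution function of [sg] started at [c]; since [h d = 0], the boundary term at
    [d] drops out. *)
Lemma charge_by_parts (sg : scharge) (m1 m2 : {finite_measure set MR -> \bar R})
    (c d : R) (X : set MR) (F k h : R -> R) (M : R) :
  c < d -> measurable X -> `]c, d]%classic `<=` X ->
  (forall A, measurable A -> rc sg A = fine (m1 A) - fine (m2 A)) ->
  (forall A, measurable A -> A `&` `]c, d]%classic = set0 -> m1 A = 0%E) ->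
  (forall A, measurable A -> A `&` `]c, d]%classic = set0 -> m2 A = 0%E) ->
  (forall x, c < x <= d -> h x = rc sg `]c, x]%classic) -> h d = 0 ->
  measurable_fun X F -> (forall x, X x -> `|F x| <= M) ->
  leb.-integrable `]c, d] (EFin \o k) ->
  (forall y, c < y <= d -> F d - F y = \int[leb]_(x in `[y, d]) k x) ->
  charge_integral sg X F = - (\int[leb]_(x in `]c, d]) (k x * h x)) /\
  leb.-integrable `]c, d] (EFin \o (fun x => k x * h x)).
Proof.
move=> cd mX cdX sgE m10 m20 hE hd mF FM ik hF.
have mcd : measurable (`]c, d]%classic : set MR) by exact: measurable_itv.
have D0 : (X `\` `]c, d]%classic) `&` `]c, d]%classic = set0 :> set MR.
  by rewrite setDE -setIA setICl setI0.
have mD : measurable (X `\` `]c, d]%classic : set MR) by exact: measurableD.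
have [e1 i1] := measure_by_parts cd mX cdX (m10 _ mD D0) mF FM ik hF.
have [e2 i2] := measure_by_parts cd mX cdX (m20 _ mD D0) mF FM ik hF.
have kh x : x \in (`]c, d]%classic : set MR) -> k x * h x =
    k x * fine (m1 `]c, x]%classic) - k x * fine (m2 `]c, x]%classic).
  by rewrite inE/= in_itv/= => xcd; rewrite hE// sgE// mulrBr.
split.
  rewrite (charge_integralE sgE mX mF FM) e1 e2 (eq_Rintegral _ kh).
  rewrite RintegralB//.
  have : fine (m1 `]c, d]%classic) = fine (m2 `]c, d]%classic).
    by apply/eqP; rewrite -subr_eq0 -sgE// -hE ?hd// cd lexx.
  by move=> ->; ring.
have := integrableRB mcd i1 i2; apply: eq_integrable => // x xcd.
by rewrite /= kh.
Qed.

Lemma W_energyE dom (a b : R) (nu : scharge) :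
  W_energy dom a b nu = (tv (cadd nu (lebesgue_charge dom a b)) (carrier dom a b) +
    tv (cadd nu (copp (lebesgue_charge dom a b))) (carrier dom a b))%:E.
Proof.
have mC := measurable_carrier dom a b.
by rewrite /W_energy !abs_chargeE// EFinD.
Qed.

Lemma rc_lebesgue_charge dom (a b x y : R) : a < x -> x <= y -> y < b ->
  rc (lebesgue_charge dom a b) `]x, y]%classic = y - x.
Proof.
move=> ax xy yb; rewrite /rc /lebesgue_charge /charge_of_finite_measure/=.
rewrite /mfrestr /mrestr (setIidl (_ : `]x, y]%classic `<=` carrier dom a b)).
  rewrite lebesgue_measure_itv/= lte_fin; case: ltP => //= yx.
  by apply/esym/eqP; rewrite subr_eq0 eq_le xy yx.
move=> z /=; rewrite in_itv/= => /andP[xz zy]; apply: itv_carrier.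
by rewrite (lt_trans ax)//= (le_lt_trans zy).
Qed.

(** The selection of [L o w'] is kept as two summands because [W_energy] is a sum of two total
    variations, each with its own barrier [w + x] or [w - x]. *)
Definition subgradient_piece (w xip xim : R -> R) (s t : R) : Prop :=
  half_slope (fun x => w x + x) xip s t /\ half_slope (fun x => w x - x) xim s t.

(* The competitor [v - h] with [h = (U - w)^+] turns the subdifferential
   inequality for [om] into a comparison with [xip + xim], a selection of
   [L o w'] written as the sum of selections of [sgn (w' + 1)] and
   [sgn (w' - 1)]. *)
Lemma selection_comparison dom (a b c x1 x2 d K : R)
    (v U om k0 w xip xim kxi : R -> R) (mu : scharge) :
  a < c -> c <= x1 -> x1 <= x2 -> x2 <= d -> c < d -> d < b ->
  BV_deriv dom a b v mu ->
  (forall y, a < y < b -> v z @[z --> y^'+] --> U y) ->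
  (forall v' nu, BV_deriv dom a b v' nu ->
      (W_energy dom a b nu >= W_energy dom a b mu
        + (charge_integral (cadd nu (copp mu)) (carrier dom a b) om)%:E)%E) ->
  {within `[a, b], continuous om} ->
  leb.-integrable `]a, b[ (EFin \o k0) ->
  (forall phi, test_function dom a b phi ->
    \int[leb]_(x in `]a, b[) (k0 x * phi x) =
    - \int[leb]_(x in `]a, b[) (om x * (phi^`())%classic x)) ->
  0 <= K -> (forall x y, `|w y - w x| <= K * `|y - x|) ->
  U c <= w c -> U d <= w d ->
  subgradient_piece w xip xim c x1 -> subgradient_piece w xip xim x1 x2 ->
  subgradient_piece w xip xim x2 d ->
  continuous xip -> continuous xim -> leb.-integrable `]c, d] (EFin \o kxi) ->
  (forall y, c < y <= d -> (xip d + xim d) - (xip y + xim y) =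
     \int[leb]_(x in `[y, d]) kxi x) ->
  [/\ leb.-integrable `]c, d] (EFin \o (fun x => Num.max 0 (U x - w x))),
      leb.-integrable `]c, d] (EFin \o (fun x => k0 x * Num.max 0 (U x - w x))),
      leb.-integrable `]c, d] (EFin \o (fun x => kxi x * Num.max 0 (U x - w x))) &
  \int[leb]_(x in `]c, d]) (k0 x * Num.max 0 (U x - w x)) <=
  \int[leb]_(x in `]c, d]) (kxi x * Num.max 0 (U x - w x))].
Proof.
move=> ac cx1 x12 x2d cd db hv vU hsel com ik0 hk0 K0 wK Uc Ud p1 p2 p3 cxip cxim ikxi hkxi.
pose C : set MR := carrier dom a b.
have mC : measurable C := measurable_carrier dom a b.
have mcd : measurable (`]c, d]%classic : set MR) by exact: measurable_itv.
have cdC : `]c, d]%classic `<=` C.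
  move=> z /=; rewrite in_itv/= => /andP[cz zd]; apply: itv_carrier.
  by rewrite (lt_trans ac)//= (le_lt_trans zd).
(* Cutting [(U - w)^+] off outside [[c, d]] creates no jump at the ends, because [U <= w] at [c] and
   at [d]. *)
pose h x := if (c <= x) && (x <= d) then Num.max 0 (U x - w x) else 0.
have hin x : c <= x <= d -> h x = Num.max 0 (U x - w x) by rewrite /h => ->.
have hc x : x <= c -> h x = 0.
  rewrite le_eqVlt => /predU1P[->|xc]; last by rewrite /h leNgt xc.
  by rewrite hin ?lexx ?(ltW cd)//; apply/max_idPl; rewrite subr_le0.
have hd x : d <= x -> h x = 0.
  rewrite le_eqVlt => /predU1P[<-|xd]; last by rewrite /h [x <= d]leNgt xd andbF.
  by rewrite hin ?lexx ?(ltW cd)//; apply/max_idPl; rewrite subr_le0.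
have cw := lipschitz_continuous K0 wK.
have Urc x : a < x < b -> U y @[y --> x^'+] --> U x by exact: (right_limit_rc vU).
have rch : right_continuous h.
  move=> x; have [xc|cx] := ltP x c.
    rewrite (hc _ (ltW xc)); apply: cvg_near_cst; near=> y.
    by apply: hc; near: y; apply: nbhs_right_le.
  have [dx|xd] := leP d x.
    rewrite (hd _ dx); apply: cvg_near_cst; near=> y.
    by apply: hd; rewrite (le_trans dx)//; near: y; exact: nbhs_right_ge.
  rewrite hin ?cx ?(ltW xd)//.
  have xab : a < x < b by rewrite (lt_le_trans ac)//= (lt_trans xd).
  have c1 : Num.max 0 (U y - w y) @[y --> x^'+] --> Num.max 0 (U x - w x).
    have c0 : U y - w y @[y --> x^'+] --> U x - w x.
      by apply: cvgB; [exact: Urc|apply: cvg_at_right_filter; exact: cw].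
    apply/cvgrPdist_lt => e e0; move/cvgrPdist_lt : c0 => /(_ _ e0).
    by apply: filterS => y; apply: le_lt_trans; exact: pos_part_lip.
  apply: cvg_trans c1; apply: near_eq_cvg; near=> y; rewrite hin//.
  apply/andP; split; last by near: y; exact: nbhs_right_le.
  by rewrite (le_trans cx)//; near: y; exact: nbhs_right_ge.
have muE x y : c <= x -> x < y -> y <= d -> rc mu `]x, y]%classic = U y - U x.
  move=> cx xy yd; have ax := lt_le_trans ac cx; have yb := le_lt_trans yd db.
  apply: (BV_deriv_increment hv ax xy yb); apply: vU; first by rewrite ax (lt_trans xy).
  by rewrite (lt_trans ax).
have Kmono : {homo (fun x : R => K * x) : x y / x <= y} by move=> x y; exact: ler_wpM2l.
have Krc : right_continuous (fun x : R => K * x).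
  by apply: right_continuousW => x; apply: cvgM; [exact: cvg_cst|exact: cvg_id].
have [L LE] := stieltjes Kmono Krc.
have fL : (L `]c, d]%classic < +oo)%E by rewrite LE ?ltry// ltW.
(* The measure dominating the increments of [h] is [|Dv| + K dx]: the positive part is 1-Lipschitz
   and [w] is [K]-Lipschitz. *)
have [m0 m0E _] := finite_measure_sum (jordan_pos (hahn mu)) (jordan_neg (hahn mu)).
have [m mE _] := finite_measure_sum m0 (mfrestr mcd fL).
have hm x y : c <= x -> x < y -> y <= d -> `|h y - h x| <= fine (m `]x, y]%classic).
  move=> cx xy yd; rewrite mE// m0E// -/(posp mu _) -/(negp mu _).
  have -> : fine (mfrestr mcd fL `]x, y]%classic) = K * (y - x).
    rewrite /mfrestr /mrestr (setIidl (_ : `]x, y]%classic `<=` `]c, d]%classic)).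
      by rewrite LE ?ltW//= mulrBr.
    by move=> z /=; rewrite !in_itv/= => /andP[xz zy]; rewrite (le_lt_trans cx)//= (le_trans zy).
  have := tv_rc mu (measurable_itv `]x, y]); rewrite muE// /tv => h1.
  have := wK x y; rewrite [`|y - x|]gtr0_norm ?subr_gt0// => h2.
  rewrite !hin ?cx ?yd ?(le_trans cx (ltW xy)) ?(le_trans (ltW xy) yd)//.
  move: h1 h2; rewrite !ler_norml => /andP[h1 h2] /andP[h3 h4].
  move: h1 h2 h3 h4; clear=> h1 h2 h3 h4.
  by case: (leP 0 (U y - w y)); case: (leP 0 (U x - w x)); lra.
have [mh [m1 [m2 [m12E m10 m20]]]] := stieltjes_charge cd rch hc hd hm.
pose sg : scharge := cadd (charge_of_finite_measure m1) (copp (charge_of_finite_measure m2)).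
have sgE A : measurable A -> rc sg A = fine (m1 A) - fine (m2 A).
  by move=> mA; rewrite rc_add// rc_opp.
have sgxy x y : c <= x -> x < y -> y <= d -> rc sg `]x, y]%classic = h y - h x.
  by move=> cx xy yd; rewrite sgE// m12E.
have hE x : c < x <= d -> h x = rc sg `]c, x]%classic.
  by move=> /andP[cx xd]; rewrite sgxy// (hc c)// subr0.
pose nu : scharge := cadd mu (copp sg).
have nuE A : measurable A -> rc nu A = rc mu A - rc sg A.
  by move=> mA; rewrite rc_add// rc_opp.
have hB : exists2 M, 0 <= M & forall x, `|h x| <= M.
  exists (fine (m setT)) => [|x]; first exact: fine_ge0.
  have [xc|cx] := leP x c; first by rewrite hc// normr0 fine_ge0.
  have [dx|xd] := leP d x; first by rewrite hd// normr0 fine_ge0.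
  rewrite -[h x]subr0 -(hc c (lexx c)).
  apply: (le_trans (hm c x (lexx c) cx (ltW xd))).
  by apply: fine_le; rewrite ?fin_num_measure//; apply: le_measure; rewrite ?inE.
have [M M0 hM] := hB.
have mab : measurable (`]a, b[%classic : set MR) by exact: measurable_itv.
have ih : leb.-integrable `]a, b[ (EFin \o h).
  apply: measurable_bounded_integrable => //.
  - exact: (carrier_lty OpenInterval a b).
  - exact: measurable_funTS.
  - by apply: (@boundedP _ _ _ _ M) => x _; exact: hM.
have cbound (phi : R -> R) : continuous phi -> exists N, forall x, C x -> `|phi x| <= N.
  move=> cphi; have [N hN] := continuous_itv_bound a b cphi.
  exists N => x /carrier_itv; rewrite in_itv/= => /andP[ax xb].
  by apply: hN; rewrite ax ltW.
have hd0 : h d = 0 by exact: hd.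
have int_h (g : R -> R) : \int[leb]_(x in `]c, d]) (g x * h x) =
    \int[leb]_(x in `]a, b[) (g x * h x).
  have sub : `]c, d]%classic `<=` `]a, b[%classic.
    move=> z /=; rewrite !in_itv/= => /andP[cz zd].
    by rewrite (lt_trans ac)//= (le_lt_trans zd).
  rewrite -{1}(setIidr sub) Rintegral_mkcondr; apply: eq_Rintegral => z _.
  rewrite patchE; case: ifPn => //; rewrite notin_setE/= in_itv/= => /negP.
  by rewrite negb_and -leNgt -ltNge => /orP[/hc ->|/ltW/hd ->]; rewrite mulr0.
(* Integration by parts identifies [sg] with [Dh]. As [sg] lives on []c, d]], this also holds for
   periodic test functions, which need not vanish at the ends of the interval. *)
have hv' : BV_deriv dom a b (fun x => v x - h x) nu.
  have [iv hvphi] := hv; split; first exact: integrableRB.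
  move=> phi tphi; have sphi : smooth phi by case: tphi.
  have cphi := smooth_continuous sphi.
  have cphi' := smooth_continuous (smooth_derive1 sphi).
  have [N hN] := cbound _ cphi.
  have mphi : measurable_fun C phi by exact: measurable_continuous.
  have -> : charge_integral nu C phi = charge_integral mu C phi - charge_integral sg C phi.
    rewrite (@charge_integralD _ nu mu (copp sg) _ _ N)//.
    - by congr (_ + _); apply: (@charge_integralN _ _ _ _ _ N) => // A mA; rewrite rc_opp.
    - by move=> A mA; rewrite rc_add.
  have hphi y : c < y <= d -> phi d - phi y = \int[leb]_(x in `[y, d]) (phi^`())%classic x.
    move=> /andP[cy]; rewrite le_eqVlt => /predU1P[->|yd].
      by rewrite set_itv1 Rintegral_set1 subrr.
    rewrite -smooth_FTC// Rintegral_itv_bndo_bndc; last exact: continuous_integrable_oo.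
    by rewrite Rintegral_itv_obnd_cbnd//; exact: continuous_integrable_oc.
  have [-> _] := charge_by_parts cd mC cdC sgE m10 m20 hE hd0 mphi hN
    (continuous_integrable_oc _ _ cphi') hphi.
  rewrite int_h opprD opprK.
  under eq_Rintegral do rewrite mulrBl.
  rewrite RintegralB//; try exact: integrable_mul_continuous.
  rewrite hvphi// -/C; congr (_ - _).
  by apply: eq_Rintegral => x _; rewrite mulrC.
have := hsel _ _ hv'; rewrite !W_energyE -EFinD lee_fin -/C.
set lam := lebesgue_charge dom a b.
have mom : measurable_fun C om.
  apply: (@measurable_funS _ _ _ _ (`[a, b]%classic : set MR)) => //.
    by move=> z /carrier_itv; exact: subset_itv_co_cc.
  exact: subspace_continuous_measurable_fun.
have [N hN] : exists N, forall x, C x -> `|om x| <= N.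
  have cn : {within `[a, b], continuous (fun x => `|om x|)}.
    by move=> x; apply: continuous_comp; [exact: com|exact: norm_continuous].
  have ab : a <= b by rewrite ltW// (lt_trans ac)// (lt_trans cd).
  have [z _ hz] := EVT_max ab cn.
  by exists `|om z| => x /carrier_itv xab; apply: hz; exact: subset_itv_co_cc.
have omr y : c < y <= d -> om z @[z --> y^'+] --> om y.
  move=> /andP[cy yd]; apply: cvg_at_right_filter.
  have [H1 _ _] := (continuous_within_itvP om (lt_trans ac (lt_trans cd db))).1 com.
  apply: H1.
  by rewrite in_itv/= (lt_trans ac cy) (le_lt_trans yd db).
have iom : leb.-integrable `]a, b[ (EFin \o om).
  have h1 : leb.-integrable `[a, b] (EFin \o om).
    by apply: continuous_compact_integrable => //; exact: segment_compact.
  by apply: (integrableS _ _ _ h1) => //; exact: subset_itv_oo_cc.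
have ik0cd : leb.-integrable `]c, d] (EFin \o k0).
  apply: (integrableS _ _ _ ik0) => // z /=; rewrite !in_itv/= => /andP[cz zd].
  by rewrite (lt_trans ac)//= (le_lt_trans zd).
have hom y : c < y <= d -> om d - om y = \int[leb]_(x in `[y, d]) k0 x.
  move=> /andP[cy]; rewrite le_eqVlt => /predU1P[->|yd].
    by rewrite set_itv1 Rintegral_set1 subrr.
  have iyd : leb.-integrable `]y, d] (EFin \o k0).
    apply: (integrableS _ _ _ ik0cd) => // z /=; rewrite !in_itv/= => /andP[yz ->].
    by rewrite (lt_trans cy yz).
  rewrite -Rintegral_itv_obnd_cbnd//.
  apply/esym; apply: (weak_deriv_increment iom ik0 hk0 (lt_trans ac cy) yd db).
    by apply: omr; rewrite cy ltW.
  by apply: omr; rewrite cd lexx.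
have [eom iom'] := charge_by_parts cd mC cdC sgE m10 m20 hE hd0 mom hN ik0cd hom.
(* Here [nu - mu = - sg] and [om] is a primitive of [k0] on []c, d]], so the subdifferential term
   becomes the pairing of [k0] with the truncation. *)
have -> : charge_integral (cadd nu (copp mu)) C om = \int[leb]_(x in `]c, d]) (k0 x * h x).
  rewrite (@charge_integralN _ _ sg _ _ N)//; first by rewrite eom opprK.
  by move=> A mA; rewrite rc_add// rc_opp// nuE//; ring.
have mxi : measurable_fun (`]c, d]%classic : set MR) (fun x => xip x + xim x).
  by apply: measurable_funD; exact: measurable_continuous.
have [N1 hN1] := continuous_itv_bound c d cxip.
have [N2 hN2] := continuous_itv_bound c d cxim.
pose N3 := `|N1| + `|N2|.
have b1 x : c <= x <= d -> `|xip x| <= N3.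
  by move=> /hN1 h1; rewrite (le_trans h1)// (le_trans (ler_norm _))// lerDl.
have b2 x : c <= x <= d -> `|xim x| <= N3.
  by move=> /hN2 h1; rewrite (le_trans h1)// (le_trans (ler_norm _))// lerDr.
have b12 x : `]c, d]%classic x -> `|xip x + xim x| <= N3 + N3.
  rewrite /= in_itv/= => /andP[/ltW cx xd].
  by apply: le_trans (ler_normD _ _) (lerD (b1 x _) (b2 x _)); rewrite cx xd.
have [exi ixi] := charge_by_parts cd mcd (@subset_refl _ _) sgE m10 m20 hE hd0 mxi
  b12 ikxi hkxi.
have cdU : `]c, d]%classic = `]c, x1]%classic `|` (`]x1, x2]%classic `|` `]x2, d]%classic) :> set MR.
  rewrite -!itv_bndbnd_setU ?bnd_simp//.
  by rewrite (le_trans x12).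
have dis1 : `]x1, x2]%classic `&` `]x2, d]%classic = set0 :> set MR.
  by apply/seteqP; split => // z [/=]; rewrite !in_itv/= => /andP[_ h1] /andP[]; rewrite ltNge h1.
have dis2 : `]c, x1]%classic `&` (`]x1, x2]%classic `|` `]x2, d]%classic) = set0 :> set MR.
  apply/seteqP; split => // z [/=]; rewrite !in_itv/= => /andP[_ h1] [|] /andP[]; first by rewrite ltNge h1.
  by rewrite ltNge (le_trans h1 x12).
have mI x y : measurable (`]x, y]%classic : set MR) by exact: measurable_itv.
have mI2 : measurable (`]x1, x2]%classic `|` `]x2, d]%classic : set MR) by exact: measurableU.
have CU : C = (C `\` `]c, d]%classic) `|` `]c, d]%classic.
  by rewrite setUC setDUK.
have disC : (C `\` `]c, d]%classic) `&` `]c, d]%classic = set0.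
  by rewrite setDE -setIA setICl setI0.
have mCD : measurable (C `\` `]c, d]%classic) by exact: measurableD.
have split_ci (xi : R -> R) N0 : continuous xi -> (forall x, c <= x <= d -> `|xi x| <= N0) ->
    charge_integral sg `]c, d]%classic xi = charge_integral sg `]c, x1]%classic xi +
      (charge_integral sg `]x1, x2]%classic xi + charge_integral sg `]x2, d]%classic xi).
  move=> cxi xiN.
  have bd z : `]c, d]%classic z -> `|xi z| <= N0.
    by rewrite /= in_itv/= => /andP[/ltW cz zd]; apply: xiN; rewrite cz zd.
  rewrite cdU in bd *.
  rewrite (@charge_integralU _ _ _ _ _ N0)//; last exact: measurable_continuous.
  rewrite (@charge_integralU _ _ _ _ _ N0)//; first exact: measurable_continuous.
  by move=> z hz; apply: bd; right.
have split_tv (n : scharge) : tv n C = tv n (C `\` `]c, d]%classic) +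
    (tv n `]c, x1]%classic + (tv n `]x1, x2]%classic + tv n `]x2, d]%classic)).
  by rewrite {1}CU tvU// {2}cdU tvU// tvU.
(* Outside []c, d]] the competitor has the derivative of [v], so these parts of the energies cancel
   and the global inequality becomes local. *)
have rest (l : scharge) : tv (cadd nu l) (C `\` `]c, d]%classic) = tv (cadd mu l) (C `\` `]c, d]%classic).
  apply: tv_ext => // A mA AC; rewrite !rc_add// rc_opp// sgE//.
  have A0 : A `&` `]c, d]%classic = set0.
    by apply/seteqP; split => // z [/AC[]].
  by rewrite m10// m20//= subrr subr0.
(* Here [q] is 1 or -1, the density of the charge [l]. The function and the barrier are both tilted
   by [q x], so their difference, and hence [h], is the same for the two variations. *)
have piece (l : scharge) (q : R) (xi : R -> R) (s t : R) : c <= s -> s <= t -> t <= d ->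
    continuous xi ->
    (forall x y, c <= x -> x < y -> y <= d -> rc l `]x, y]%classic = q * (y - x)) ->
    half_slope (fun x => w x + q * x) xi s t ->
    charge_integral sg `]s, t]%classic xi <=
      tv (cadd mu l) `]s, t]%classic - tv (cadd nu l) `]s, t]%classic.
  move=> cs st td cxi lE hs.
  have := @half_slope_ineq _ (cadd mu l) sg (fun x => U x + q * x) (fun x => w x + q * x) h xi s t.
  rewrite (@tv_ext _ (cadd (cadd mu l) (copp sg)) (cadd nu l))//; last first.
    by move=> A mA _; rewrite !rc_add//; ring.
  apply => //.
  - move=> x y sx xy yt; rewrite rc_add// lE ?muE//; [ring|exact: le_trans sx|exact: le_trans td|exact: le_trans sx|exact: le_trans td].
  - by move=> x y sx xy yt; apply: sgxy => //; [exact: le_trans sx|exact: le_trans td].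
  - move=> x /andP[sx xt]; rewrite hin; last by rewrite (le_trans cs sx) (le_trans xt td).
    by congr (Num.max _ _); ring.
have lamE x y : c <= x -> x < y -> y <= d -> rc lam `]x, y]%classic = 1 * (y - x).
  by move=> cx xy yd; rewrite mul1r; apply: rc_lebesgue_charge; [exact: lt_le_trans cx|exact: ltW|exact: le_lt_trans db].
have lamNE x y : c <= x -> x < y -> y <= d -> rc (copp lam) `]x, y]%classic = -1 * (y - x).
  by move=> cx xy yd; rewrite rc_opp// (lamE x y)// mul1r mulN1r.
have hsp s t : half_slope (fun x => w x + x) xip s t -> half_slope (fun x => w x + 1 * x) xip s t.
  by move=> H; rewrite (_ : (fun x => _) = fun x => w x + x)//; apply/funext => x; rewrite mul1r.
have hsm s t : half_slope (fun x => w x - x) xim s t -> half_slope (fun x => w x + -1 * x) xim s t.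
  by move=> H; rewrite (_ : (fun x => _) = fun x => w x - x)//; apply/funext => x; rewrite mulN1r.
have x1d := le_trans x12 x2d; have cx2 := le_trans cx1 x12.
have q1 := piece _ _ _ _ _ (lexx c) cx1 x1d cxip lamE (hsp _ _ p1.1).
have q2 := piece _ _ _ _ _ cx1 x12 x2d cxip lamE (hsp _ _ p2.1).
have q3 := piece _ _ _ _ _ cx2 x2d (lexx d) cxip lamE (hsp _ _ p3.1).
have q4 := piece _ _ _ _ _ (lexx c) cx1 x1d cxim lamNE (hsm _ _ p1.2).
have q5 := piece _ _ _ _ _ cx1 x12 x2d cxim lamNE (hsm _ _ p2.2).
have q6 := piece _ _ _ _ _ cx2 x2d (lexx d) cxim lamNE (hsm _ _ p3.2).
have s1 := split_ci _ _ cxip b1; have s2 := split_ci _ _ cxim b2.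
have s3 : charge_integral sg `]c, d]%classic (fun x => xip x + xim x) =
    charge_integral sg `]c, d]%classic xip + charge_integral sg `]c, d]%classic xim.
  apply: (@charge_integralDf _ _ _ _ _ N3) => //; try exact: measurable_continuous.
  - by move=> x; rewrite /= in_itv/= => /andP[/ltW cx xd]; apply: b1; rewrite cx xd.
  - by move=> x; rewrite /= in_itv/= => /andP[/ltW cx xd]; apply: b2; rewrite cx xd.
rewrite !split_tv !rest => main.
have eqh (g : R -> R) x : x \in (`]c, d]%classic : set MR) -> g x * Num.max 0 (U x - w x) = g x * h x.
  by rewrite inE/= in_itv/= => /andP[/ltW cx xd]; rewrite hin// cx xd.
split.
- have : leb.-integrable `]c, d] (EFin \o h).
    apply: (integrableS _ _ _ ih) => // z /=; rewrite !in_itv/= => /andP[cz zd].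
    by rewrite (lt_trans ac)//= (le_lt_trans zd).
  apply: eq_integrable => // x; rewrite inE/= in_itv/= => /andP[/ltW cx xd].
  by rewrite /= hin// cx xd.
- by apply: eq_integrable iom' => // x xcd; rewrite /= eqh.
- by apply: eq_integrable ixi => // x xcd; rewrite /= eqh.
rewrite (eq_Rintegral _ (eqh k0)) (eq_Rintegral _ (eqh kxi)).
rewrite s3 s1 s2 in exi.
move: main q1 q2 q3 q4 q5 q6 exi.
move: (tv _ _) (tv _ _) (tv _ _) (tv _ _) (tv _ _) (tv _ _) (tv _ _); clear; move=> *; lra.
Unshelve. all: by end_near. Qed.

End StaticInequality.

(** * Comparison in time *)

Section SquareIntegrable.
Context {R : realType}.
Local Notation MR := (measurableTypeR R).

Lemma L2P d (T : measurableType d) (mu : {measure set T -> \bar R}) (D : set T) (f : T -> R) :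
  measurable D -> L2 mu D f <->
  measurable_fun D f /\ mu.-integrable D (EFin \o (fun x => f x ^+ 2)).
Proof.
move=> mD; split=> -[mf h]; split=> //.
  apply/integrableP; split; first by apply/measurable_EFinP; exact: measurable_funX.
  by under eq_integral do rewrite /= ger0_norm ?sqr_ge0//.
case/integrableP : h => _; by under eq_integral do rewrite /= ger0_norm ?sqr_ge0//.
Qed.

Lemma sqr_mul_le (th x y : R) : 0 < th ->
  x * y <= th / 2 * x ^+ 2 + (2 * th)^-1 * y ^+ 2.
Proof.
move=> th0; rewrite -subr_ge0.
have -> : th / 2 * x ^+ 2 + (2 * th)^-1 * y ^+ 2 - x * y =
    (2 * th)^-1 * (th * x - y) ^+ 2 by field; rewrite gt_eqF.
by rewrite mulr_ge0 ?sqr_ge0// invr_ge0 mulr_ge0// ltW.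
Qed.

Lemma sqr_mul_norm_le (th x y : R) : 0 < th ->
  `|x * y| <= th / 2 * x ^+ 2 + (2 * th)^-1 * y ^+ 2.
Proof.
move=> th0; rewrite ler_norml sqr_mul_le// andbT lerNl -mulNr.
by rewrite -[x ^+ 2]sqrrN sqr_mul_le.
Qed.

(** Young's inequality with a free weight [th] replaces Cauchy-Schwarz: the weight is chosen at each
    use and no square roots of integrals appear. *)
Lemma L2_mul d (T : measurableType d) (mu : {measure set T -> \bar R}) (D : set T)
    (f g : T -> R) : measurable D -> L2 mu D f -> L2 mu D g ->
  mu.-integrable D (EFin \o (fun x => f x * g x)) /\
  forall th, 0 < th -> `|\int[mu]_(x in D) (f x * g x)| <=
    th / 2 * \int[mu]_(x in D) (f x ^+ 2) + (2 * th)^-1 * \int[mu]_(x in D) (g x ^+ 2).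
Proof.
move=> mD /(L2P _ _ mD)[mf if2] /(L2P _ _ mD)[mg ig2].
have ib th : 0 < th -> mu.-integrable D
    (EFin \o (fun x => th / 2 * f x ^+ 2 + (2 * th)^-1 * g x ^+ 2)).
  by move=> th0; apply: integrableRD => //; exact: integrableRZl.
have ifg : mu.-integrable D (EFin \o (fun x => f x * g x)).
  apply: le_integrable (ib 1 ltr01) => //.
    by apply/measurable_EFinP; exact: measurable_funM.
  move=> x _ /=; rewrite lee_fin (le_trans (sqr_mul_norm_le _ _ ltr01))//.
  exact: ler_norm.
split=> // th th0.
apply: le_trans (le_normr_Rintegral mD ifg) _.
rewrite -RintegralZl// -RintegralZl// -RintegralD//; [|exact: integrableRZl..].
apply: le_Rintegral => //; [exact: (integrable_norm ifg)|exact: ib|].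
by move=> x _; exact: sqr_mul_norm_le.
Qed.

Lemma L2_sub d (T : measurableType d) (mu : {measure set T -> \bar R}) (D : set T)
    (f g : T -> R) : measurable D -> L2 mu D f -> L2 mu D g ->
  L2 mu D (fun x => f x - g x) /\ \int[mu]_(x in D) ((f x - g x) ^+ 2) <=
    2 * \int[mu]_(x in D) (f x ^+ 2) + 2 * \int[mu]_(x in D) (g x ^+ 2).
Proof.
move=> mD /(L2P _ _ mD)[mf if2] /(L2P _ _ mD)[mg ig2].
have ib : mu.-integrable D (EFin \o (fun x => 2 * f x ^+ 2 + 2 * g x ^+ 2)).
  by apply: integrableRD => //; exact: integrableRZl.
have le x : (f x - g x) ^+ 2 <= 2 * f x ^+ 2 + 2 * g x ^+ 2.
  rewrite -subr_ge0 (_ : _ - _ = (f x + g x) ^+ 2) ?sqr_ge0//; ring.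
have ifg : mu.-integrable D (EFin \o (fun x => (f x - g x) ^+ 2)).
  apply: le_integrable ib => //.
    by apply/measurable_EFinP; apply: measurable_funX; exact: measurable_funB.
  by move=> x _ /=; rewrite lee_fin ger0_norm ?sqr_ge0// (le_trans (le x))// ler_norm.
split; first by apply/L2P => //; split=> //; exact: measurable_funB.
rewrite -RintegralZl// -RintegralZl// -RintegralD//; [|exact: integrableRZl..].
by apply: le_Rintegral => // x _; exact: le.
Qed.

Lemma L2_pos_part d (T : measurableType d) (mu : {measure set T -> \bar R}) (D : set T)
    (f : T -> R) : measurable D -> L2 mu D f -> L2 mu D (fun x => Num.max 0 (f x)).
Proof.
move=> mD /(L2P _ _ mD)[mf if2]; apply/L2P => //.
have mm : measurable_fun D (fun x => Num.max 0 (f x)).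
  by apply: measurable_maxr => //; exact: measurable_cst.
split=> //; apply: le_integrable if2 => //.
  by apply/measurable_EFinP; exact: measurable_funX.
move=> x _ /=; rewrite lee_fin !ger0_norm ?sqr_ge0//.
by case: (leP 0 (f x)) => //= h; rewrite expr0n/= sqr_ge0.
Qed.

Lemma L2_subset d (T : measurableType d) (mu : {measure set T -> \bar R}) (D E : set T)
    (f : T -> R) : measurable D -> measurable E -> E `<=` D -> L2 mu D f -> L2 mu E f.
Proof.
move=> mD mE ED /(L2P _ _ mD)[mf if2]; apply/L2P => //; split.
  exact: measurable_funS mf.
exact: integrableS if2.
Qed.

Lemma L2_bounded (D : set MR) (f : R -> R) (M : R) : measurable D ->
  (leb D < +oo)%E -> measurable_fun D f -> (forall x, D x -> `|f x| <= M) -> L2 leb D f.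
Proof.
move=> mD fD mf fM; apply/L2P => //; split=> //.
apply: measurable_bounded_integrable => //; first exact: measurable_funX.
apply: (@boundedP _ _ _ _ (M ^+ 2)) => x /fM h.
by rewrite normrX lerXn2r// ?nnegrE// (le_trans _ h).
Qed.

Lemma L2_integrable (D : set MR) (f : R -> R) : measurable D ->
  (leb D < +oo)%E -> L2 leb D f -> leb.-integrable D (EFin \o f).
Proof.
move=> mD fD Lf; have L1 : L2 leb D (cst 1 : R -> R).
  by apply: (@L2_bounded _ _ 1) => // x _; rewrite normr1.
have [+ _] := L2_mul mD Lf L1; apply: eq_integrable => // x _.
by rewrite /= mulr1.
Qed.

Lemma Rintegral_ae d (T : measurableType d) (mu : {measure set T -> \bar R}) (D : set T)
    (f g : T -> R) : measurable D -> measurable_fun D f -> measurable_fun D g ->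
  {ae mu, forall x, D x -> f x = g x} ->
  \int[mu]_(x in D) f x = \int[mu]_(x in D) g x.
Proof.
move=> mD mf mg fg; rewrite /Rintegral; congr fine; apply: ae_eq_integral => //.
- exact/measurable_EFinP.
- exact/measurable_EFinP.
- apply: (@filterS _ _ (ae_filter_ringOfSetsType _)) fg => x fg Dx.
  by rewrite /= fg.
Qed.

(** The majorant [g] is replaced by [max(f, g)], which equals it almost everywhere and dominates [f]
    everywhere. *)
Lemma le_Rintegral_ae d (T : measurableType d) (mu : {measure set T -> \bar R}) (D : set T)
    (f g : T -> R) : measurable D -> mu.-integrable D (EFin \o f) ->
  mu.-integrable D (EFin \o g) -> {ae mu, forall x, D x -> f x <= g x} ->
  \int[mu]_(x in D) f x <= \int[mu]_(x in D) g x.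
Proof.
move=> mD if1 ig fg.
have mf : measurable_fun D f by case/integrableP : if1 => /measurable_EFinP.
have mg : measurable_fun D g by case/integrableP : ig => /measurable_EFinP.
pose k x := Num.max (f x) (g x).
have mk : measurable_fun D k by exact: measurable_maxr.
have ik : mu.-integrable D (EFin \o k).
  apply: le_integrable (integrableRD mD (integrable_norm if1) (integrable_norm ig)) => //.
    exact/measurable_EFinP.
  move=> x _ /=; rewrite lee_fin /k [X in _ <= X]ger0_norm ?addr_ge0//.
  by case: (leP (f x) (g x)) => _; rewrite ?lerDl ?lerDr.
have -> : \int[mu]_(x in D) g x = \int[mu]_(x in D) k x.
  apply: Rintegral_ae => //.
  apply: (@filterS _ _ (ae_filter_ringOfSetsType _)) fg => x fg Dx.
  by rewrite /k max_r// fg.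
by apply: le_Rintegral => // x _; rewrite /k le_max lexx.
Qed.

Lemma integrable_slices (f : MR * MR -> R) :
  (leb \x leb)%E.-integrable setT (EFin \o f) ->
  leb.-integrable setT (EFin \o (fun t => fine (\int[leb]_x (f (x, t))%:E)%E)).
Proof.
move=> intf; have mG := measurable_fubini_G intf.
apply/integrableP; split.
  apply/measurable_EFinP; apply: (measurableT_comp _ mG).
  exact: fine_measurable.
have mf : measurable_fun setT (EFin \o f) by case/integrableP : intf.
have mt t : measurable_fun setT (fun x : MR => (f (x, t))%:E).
  by apply: measurableT_comp mf _; exact: pair2_measurable.
apply: (@le_lt_trans _ _ (\int[leb]_t \int[leb]_x `|(f (x, t))%:E|)%E); last first.
  by have := (integrable21ltyP leb leb mf).1 intf.
apply: ge0_le_integral => //.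
- by apply/measurable_EFinP; apply: measurableT_comp => //; apply: (measurableT_comp _ mG);
    exact: fine_measurable.
- apply: (@measurable_fun_fubini_tonelli_G _ _ _ _ _ leb (fun z => `|(f z)%:E|%E)) => //.
  exact: measurableT_comp.
- move=> t _ /=; apply: le_trans (le_abse_integral leb measurableT (mt t)).
  have [h|] := boolP ((\int[leb]_x (f (x, t))%:E)%E \is a fin_num).
    by rewrite -[in leRHS](fineK h).
  by rewrite fin_numE negb_and !negbK => /orP[] /eqP ->; rewrite /= normr0 leey.
Qed.

Lemma measurable_cylinder (a b T : R) : measurable (cylinder a b T).
Proof. by apply: measurableX; exact: measurable_itv. Qed.

Lemma cylinder_slice (a b T t : R) (f : R -> R -> R) : t \in `]0, T[ ->
  fine (\int[leb]_x (((fun z : MR * MR => f z.1 z.2) \_ (cylinder a b T)) (x, t))%:E)%E =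
  \int[leb]_(x in `]a, b[) f x t.
Proof.
move=> tT; rewrite /Rintegral [in RHS]integral_mkcond; congr fine.
apply: eq_integral => x _; rewrite !patchE.
have -> : ((x, t) \in cylinder a b T) = (x \in `]a, b[%classic).
  apply/idP/idP => /set_mem; first by case=> /= h _; exact/mem_set.
  by move=> h; apply/mem_set.
by case: ifP.
Qed.

Lemma Rintegrable_slices (a b T : R) (f : R -> R -> R) :
  (leb \x leb)%E.-integrable (cylinder a b T) (EFin \o (fun z => f z.1 z.2)) ->
  leb.-integrable `]0, T[ (EFin \o (fun t => \int[leb]_(x in `]a, b[) f x t)).
Proof.
move=> intf.
have : (leb \x leb)%E.-integrable setT (EFin \o ((fun z : MR * MR => f z.1 z.2) \_ (cylinder a b T))).
  rewrite -restrict_EFin; apply/integrable_restrict => //; first exact: measurable_cylinder.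
  by rewrite setTI.
move=> /integrable_slices h.
apply: (@eq_integrable _ _ _ _ _ _ _ _ _ (integrableS _ _ (@subsetT _ _) h)) => //.
by move=> t tT; rewrite /= cylinder_slice// -[_ \in _]/(_ \in _); move/set_mem : tT.
Qed.

Lemma L2L2_slices (a b T : R) (w : R -> R -> R) : L2L2 a b T w ->
  {ae leb, forall t, t \in `]0, T[ -> L2 leb `]a, b[ (w ^~ t)} /\
  leb.-integrable `]0, T[ (EFin \o (fun t => \int[leb]_(x in `]a, b[) (w x t ^+ 2))).
Proof.
have mC := measurable_cylinder a b T.
move=> Lw; have [mw iw] := (L2P _ _ mC).1 Lw.
split; last exact: (@Rintegrable_slices a b T (fun x t => w x t ^+ 2)).
pose f := (fun z : MR * MR => w z.1 z.2 ^+ 2) \_ (cylinder a b T).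
have intf : (leb \x leb)%E.-integrable setT (EFin \o f).
  by rewrite /f -restrict_EFin; apply/integrable_restrict => //; rewrite setTI.
have mw0 : measurable_fun setT ((fun z : MR * MR => w z.1 z.2) \_ (cylinder a b T)).
  by apply/(measurable_restrictT _ _).1.
apply: ae_imp (ae_integrable2 intf) _ => t ht tT.
have mab : measurable (`]a, b[%classic : set MR) by exact: measurable_itv.
have inC x : x \in (`]a, b[%classic : set MR) -> (x, t) \in cylinder a b T.
  by move=> /set_mem h; apply/mem_set.
apply/L2P => //; split.
  have : measurable_fun (`]a, b[%classic : set MR)
      (fun x => ((fun z : MR * MR => w z.1 z.2) \_ (cylinder a b T)) (x, t)).
    by apply: measurable_funTS; apply: measurableT_comp mw0 _; exact: pair2_measurable.
  by apply: eq_measurable_fun => x xab; rewrite patchE inC.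
have := integrableS measurableT mab (@subsetT _ _) ht.
by apply: eq_integrable => // x xab; rewrite /= /f patchE inC.
Qed.

(** On the cylinder, of finite height, [g] is square integrable as a function of both variables; the
    product with [w] is then integrable and Fubini gives the slices. *)
Lemma L2L2_pairing (a b T : R) (w : R -> R -> R) (g : R -> R) : a < b -> 0 < T ->
  L2L2 a b T w -> L2 leb `]a, b[ g ->
  leb.-integrable `]0, T[ (EFin \o (fun t => \int[leb]_(x in `]a, b[) (w x t * g x))).
Proof.
move=> ab T0 Lw Lg; apply: (@Rintegrable_slices a b T (fun x t => w x t * g x)).
have mC := measurable_cylinder a b T.
have mab : measurable (`]a, b[%classic : set MR) by exact: measurable_itv.
have mT : measurable (`]0, T[%classic : set MR) by exact: measurable_itv.
suff LG : L2 (leb \x leb)%E (cylinder a b T) (fun z => g z.1).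
  by case: (L2_mul mC Lw LG).
have [mg ig] := (L2P _ _ mab).1 Lg.
pose g0 := g \_ `]a, b[%classic.
have mg0 : measurable_fun setT g0 by apply/(measurable_restrictT _ _).1.
have mg1 : measurable_fun (cylinder a b T) (fun z => g z.1).
  have : measurable_fun (cylinder a b T) (fun z => g0 z.1).
    by apply: measurable_funTS; apply: measurableT_comp mg0 _; exact: measurable_fst.
  by apply: eq_measurable_fun => z /set_mem[h _]; rewrite /g0 patchE mem_set.
split=> //.
rewrite integral_mkcond.
pose F (z : MR * MR) := ((g0 z.1 ^+ 2) * \1_(`]0, T[%classic) z.2)%:E.
have -> : (\int[leb \x leb]_z ((fun z => (g z.1 ^+ 2)%:E) \_ (cylinder a b T)) z =
    \int[leb \x leb]_z F z)%E.
  apply: eq_integral => z _; rewrite /F /g0 !patchE indicE.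
  have -> : (z \in cylinder a b T) = (z.1 \in `]a, b[%classic) && (z.2 \in `]0, T[%classic).
    apply/idP/andP => [/set_mem[h1 h2]|[/set_mem h1 /set_mem h2]].
      by split; apply/mem_set.
    exact/mem_set.
  by case: (z.1 \in _); case: (z.2 \in _); rewrite /= ?mulr1 ?mulr0// ?mul0r ?expr0n/= ?mul0r.
have mF : measurable_fun setT F.
  apply/measurable_EFinP; apply: measurable_funM.
    by apply: measurable_funX; apply: measurableT_comp mg0 _; exact: measurable_fst.
  by apply: measurableT_comp; [exact: measurable_indic|exact: measurable_snd].
have F0 z : (0 <= F z)%E.
  by rewrite /F lee_fin mulr_ge0 ?sqr_ge0.
rewrite (@fubini_tonelli1 _ _ _ _ _ leb leb F mF F0).
have fT : (leb (`]0%R, T[%classic : set MR) < +oo)%E.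
  exact: (@carrier_lty R OpenInterval 0 T).
have inner x : (\int[leb]_y F (x, y) = (g0 x ^+ 2)%:E * leb (`]0%R, T[%classic : set MR))%E.
  rewrite /F /=; under eq_integral do rewrite EFinM.
  rewrite ge0_integralZl//.
  - by rewrite integral_indic// setIT.
  - by apply/measurable_EFinP; exact: measurable_indic.
  - by rewrite lee_fin sqr_ge0.
rewrite /fubini_F; under eq_integral do rewrite inner.
rewrite ge0_integralZr//; last 2 first.
- by apply/measurable_EFinP; exact: measurable_funX.
- by move=> x _; rewrite lee_fin sqr_ge0.
apply: lte_mul_pinfty => //.
- by apply: integral_ge0 => x _; rewrite lee_fin sqr_ge0.
- rewrite ge0_fin_numE; last by apply: integral_ge0 => x _; rewrite lee_fin sqr_ge0.
  case: Lg => _; rewrite integral_mkcond; apply: le_lt_trans.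
  apply: ge0_le_integral => //.
  + by move=> x _; rewrite lee_fin sqr_ge0.
  + by apply/measurable_EFinP; exact: measurable_funX.
  + by apply/(measurable_restrictT _ _).1 => //; apply/measurable_EFinP; exact: measurable_funX.
  + by move=> x _; rewrite /g0 !patchE; case: ifP => _ //; rewrite expr0n.
Qed.

(* Summing over a fine partition kills the error, which is quadratic in each step. *)
Lemma partition_nonincreasing (Phi G : R -> R) (r t : R) : r <= t ->
  (forall x y, r <= x -> x < y -> y <= t ->
     Phi y - Phi x <= 2 * (y - x) * (G y - G x)) -> Phi t <= Phi r.
Proof.
rewrite le_eqVlt => /predU1P[->//|rt] h.
rewrite leNgt; apply/negP => lt.
(* With this [n] the telescoped error [2 (t - r) / n * (G t - G r)] is smaller than the assumed
   increase [Phi t - Phi r]. *)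
pose n := (Num.truncn (2 * (t - r) * (G t - G r) / (Phi t - Phi r))).+1.
have n0 : 0 < n%:R :> R by rewrite ltr0n.
pose dl := (t - r) / n%:R.
have dl0 : 0 < dl by rewrite divr_gt0// subr_gt0.
have ndl : dl * n%:R = t - r by rewrite /dl mulfVK// gt_eqF.
have key k : (k <= n)%N -> Phi (r + dl * k%:R) - Phi r <= 2 * dl * (G (r + dl * k%:R) - G r).
  elim: k => [|k IH] kn; first by rewrite mulr0 addr0 !subrr mulr0.
  have kk : r + dl * k%:R < r + dl * k.+1%:R by rewrite ltrD2l ltr_pM2l// ltr_nat.
  have kt : r + dl * k.+1%:R <= t.
    have : dl * k.+1%:R <= dl * n%:R by rewrite ler_pM2l// ler_nat.
    by rewrite ndl; lra.
  have := h (r + dl * k%:R) (r + dl * k.+1%:R) _ kk kt.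
  rewrite lerDl mulr_ge0 ?(ltW dl0)// => /(_ isT).
  have -> : r + dl * k.+1%:R - (r + dl * k%:R) = dl by rewrite -[k.+1]addn1 natrD; ring.
  have := IH (ltnW kn); lra.
have := key n (leqnn n); rewrite ndl (_ : r + (t - r) = t) => [kn|]; last by ring.
have lt0 : 0 < Phi t - Phi r by rewrite subr_gt0.
have := truncnS_gt (2 * (t - r) * (G t - G r) / (Phi t - Phi r)).
rewrite -/n ltr_pdivrMr// => h2.
have : (Phi t - Phi r) * n%:R <= 2 * (dl * n%:R) * (G t - G r).
  have := ler_wpM2r (ltW n0) kn; lra.
by rewrite ndl mulrC; lra.
Qed.

End SquareIntegrable.

(** * Monotonicity in time of the positive part *)

Section TimeComparison.
Context {R : realType}.
Local Notation MR := (measurableTypeR R).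

Lemma integrable_itvS (i j : interval R) (f : R -> R) :
  [set` j] `<=` [set` i] -> leb.-integrable [set` i] (EFin \o f) ->
  leb.-integrable [set` j] (EFin \o f).
Proof.
by move=> ji h; apply: (integrableS _ _ _ h) => //; exact: measurable_itv.
Qed.

Lemma cylinder_lty (a b T : R) : ((leb \x leb)%E (cylinder a b T) < +oo)%E.
Proof.
rewrite /cylinder product_measure1E; [|exact: measurable_itv..].
have h1 : (leb (`]a, b[%classic : set MR) < +oo)%E by exact: (@carrier_lty R OpenInterval a b).
have h2 : (leb (`]0%R, T[%classic : set MR) < +oo)%E.
  exact: (@carrier_lty R OpenInterval 0 T).
by apply: lte_mul_pinfty => //; rewrite ge0_fin_numE.
Qed.

Lemma L2L2_sub_cst (a b T : R) (w : R -> R -> R) (s : R) : L2L2 a b T w ->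
  L2L2 a b T (fun x t => w x t - s).
Proof.
have mC := measurable_cylinder a b T.
move=> Lw; apply: (L2_sub mC Lw _).1; apply/L2P => //; split; first exact: measurable_cst.
apply/integrableP; split; first exact: measurable_cst.
by rewrite integral_cst// lte_mul_pinfty ?cylinder_lty.
Qed.

Lemma L2L2_subset (a b c d T : R) (w : R -> R -> R) : a <= c -> d <= b ->
  L2L2 a b T w -> L2L2 c d T w.
Proof.
move=> ac db; apply: L2_subset; [exact: measurable_cylinder..|].
move=> z [] /=; rewrite !in_itv/= => /andP[cz zd] h; split => //=.
by rewrite in_itv/= (le_lt_trans ac cz) (lt_le_trans zd db).
Qed.

(** An element of [L^2(c, d)] is extended by zero to [(a, b)], which changes neither pairing. *)
Lemma weak_dt_subset (a b c d T : R) (u ut : R -> R -> R) : a <= c -> d <= b ->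
  weak_dt a b T u ut -> weak_dt c d T u ut.
Proof.
move=> ac db hu phi h tphi [mh ih].
have mab : measurable (`]a, b[%classic : set MR) by exact: measurable_itv.
have mcd : measurable (`]c, d[%classic : set MR) by exact: measurable_itv.
have sub : `]c, d[%classic `<=` (`]a, b[%classic : set MR).
  move=> z /=; rewrite !in_itv/= => /andP[cz zd].
  by rewrite (le_lt_trans ac cz) (lt_le_trans zd db).
pose h0 := h \_ `]c, d[%classic.
have restr (v : R -> R) : \int[leb]_(x in `]c, d[) (v x * h x) =
    \int[leb]_(x in `]a, b[) (v x * h0 x).
  rewrite /Rintegral; congr fine; rewrite [LHS]integral_mkcond [RHS]integral_mkcond.
  apply: eq_integral => x _; rewrite /h0 !patchE.
  case: ifPn => [/set_mem/sub h1|h1]; first by rewrite mem_set.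
  by case: ifP => _; rewrite ?mulr0.
have Lh0 : L2 leb `]a, b[ h0.
  split.
    by apply/measurable_funTS; apply/(measurable_restrictT _ _).1.
  rewrite integral_mkcond; move: ih; rewrite integral_mkcond; apply: le_lt_trans.
  rewrite le_eqVlt; apply/orP; left; apply/eqP; apply: eq_integral => x _.
  rewrite /h0 !patchE; case: ifPn => [|]; case: ifPn => [/set_mem/sub h1|h1 h2] //.
  - by rewrite expr0n.
  - by rewrite mem_set.
have := hu phi h0 tphi Lh0.
have e1 (v : R -> R -> R) : (fun t => \int[leb]_(x in `]a, b[) (v x t * h0 x)) =
    (fun t => \int[leb]_(x in `]c, d[) (v x t * h x)).
  by apply/funext => t; rewrite restr.
by move: (e1 u) (e1 ut) => /funeqP eu /funeqP eut; under eq_Rintegral do rewrite eu;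
  under [in X in _ = X -> _]eq_Rintegral do rewrite eut.
Qed.

Lemma continuous_L2_subset (a b c d T : R) (u : R -> R -> R) : a <= c -> d <= b ->
  continuous_L2 a b T u -> continuous_L2 c d T u.
Proof.
move=> ac db hu t tT; have [Lu cu] := hu t tT.
have mab : measurable (`]a, b[%classic : set MR) by exact: measurable_itv.
have mcd : measurable (`]c, d[%classic : set MR) by exact: measurable_itv.
have sub : `]c, d[%classic `<=` (`]a, b[%classic : set MR).
  move=> z /=; rewrite !in_itv/= => /andP[cz zd].
  by rewrite (le_lt_trans ac cz) (lt_le_trans zd db).
split; first exact: L2_subset Lu.
apply: (@squeeze_cvge _ _ _ _ (cst 0%E) _
  (fun s => \int[leb]_(x in `]a, b[) ((u x s - u x t) ^+ 2)%:E)%E) => //.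
  near=> s; apply/andP; split; first by apply: integral_ge0 => x _; rewrite lee_fin sqr_ge0.
  have sT : s \in `[0, T].
    by near: s; rewrite near_withinE; apply: nearW.
  have [[ms _] [mt _]] := ((hu s sT).1, Lu).
  apply: ge0_subset_integral => //; last by move=> x _; rewrite lee_fin sqr_ge0.
  by apply/measurable_EFinP; apply: measurable_funX; exact: measurable_funB.
exact: cvg_cst.
Unshelve. all: by end_near. Qed.

Lemma pairing_continuous (a b T : R) (u : R -> R -> R) (g : R -> R) :
  continuous_L2 a b T u -> L2 leb `]a, b[ g ->
  {within `[0, T], continuous (fun t => \int[leb]_(x in `]a, b[) (u x t * g x))}.
Proof.
move=> cu Lg; apply/subspace_continuousP => t tT.
have mab : measurable (`]a, b[%classic : set MR) by exact: measurable_itv.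
have [Lt ct] := cu t tT.
pose G := \int[leb]_(x in `]a, b[) (g x ^+ 2).
have G0 : 0 <= G by apply: Rintegral_ge0 => x _; exact: sqr_ge0.
apply/cvgrPdist_lt => e e0.
(* This weight makes the second Young term [e / 2 * (G / (G + 1)) < e / 2]; adding 1 keeps it
   positive when [G = 0]. The first term is made small by continuity in [L^2]. *)
pose th := (G + 1) / e.
have th0 : 0 < th by rewrite divr_gt0// ltr_wpDl.
have cd : (\int[leb]_(x in `]a, b[) ((u x s - u x t) ^+ 2))
    @[s --> within `[0, T] (nbhs t)] --> (0 : R) by apply: fine_cvg.
move/cvgrPdist_lt : cd => /(_ (e / th)); rewrite divr_gt0// => /(_ isT) cd.
near=> s.
have sT : s \in `[0, T] by near: s; rewrite near_withinE; apply: nearW.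
have Ls := (cu s sT).1.
have dlt : `|0 - \int[leb]_(x in `]a, b[) ((u x s - u x t) ^+ 2)| < e / th by near: s.
have [Ld _] := L2_sub mab Ls Lt.
have [ig1 _] := L2_mul mab Ls Lg; have [ig2 _] := L2_mul mab Lt Lg.
have [_ /(_ th th0) h] := L2_mul mab Ld Lg.
rewrite -normrN opprB -RintegralB//.
have -> : \int[leb]_(x in `]a, b[) (u x s * g x - u x t * g x) =
    \int[leb]_(x in `]a, b[) ((u x s - u x t) * g x).
  by apply: eq_Rintegral => x _; ring.
apply: (le_lt_trans h); rewrite -/G.
move: dlt; rewrite sub0r normrN ger0_norm; last by apply: Rintegral_ge0 => x _; exact: sqr_ge0.
set D := Rintegral _ _ _ => dlt.
have e2 : (2 * th)^-1 * G < e / 2.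
  rewrite /th; have -> : (2 * ((G + 1) / e))^-1 * G = e / 2 * (G / (G + 1)).
    by field; rewrite !gt_eqF// ltr_wpDl.
  by rewrite gtr_pMr ?divr_gt0// ltr_pdivrMr ?mul1r ?ltrDl// ltr_wpDl.
have e1 : th / 2 * D <= e / 2.
  have -> : e / 2 = th / 2 * (e / th) by field; rewrite gt_eqF.
  by rewrite ler_wpM2l// ?(ltW dlt)// divr_ge0// ltW.
by move: e1 e2; lra.
Unshelve. all: by end_near. Qed.

(** For fixed [g] the weak equation says that the scalar function [(u(t), g)] has weak derivative
    [(ut, g)]; being continuous, its right limits are its values. *)
Lemma pairing_increment (a b T : R) (u ut : R -> R -> R) (g : R -> R) (r t : R) :
  a < b -> 0 < r -> r < t -> t < T -> continuous_L2 a b T u -> weak_dt a b T u ut ->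
  L2L2 a b T ut -> L2 leb `]a, b[ g ->
  \int[leb]_(z in `]r, t]) (\int[leb]_(x in `]a, b[) (ut x z * g x)) =
  \int[leb]_(x in `]a, b[) (u x t * g x) - \int[leb]_(x in `]a, b[) (u x r * g x).
Proof.
move=> ab r0 rt tT cu du Lut Lg.
have T0 : 0 < T by rewrite (lt_trans r0)// (lt_trans rt).
pose F t := \int[leb]_(x in `]a, b[) (u x t * g x).
have cF : {within `[0, T], continuous F} by exact: pairing_continuous.
have iF : leb.-integrable `]0, T[ (EFin \o F).
  apply: (@integrable_itvS `[0, T] `]0, T[); first exact: subset_itv_oo_cc.
  by apply: continuous_compact_integrable => //; exact: segment_compact.
have rlim z : 0 < z -> z < T -> F y @[y --> z^'+] --> F z.
  move=> z0 zT; apply: cvg_at_right_filter.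
  have /continuous_within_itvP : {within `[0, T], continuous F} by [].
  by move=> /(_ T0)[h _ _]; apply: h; rewrite in_itv/= z0 zT.
apply: (@weak_deriv_increment R OpenInterval 0 T F) => //.
- exact: L2L2_pairing.
- by move=> phi tphi; rewrite (du phi g tphi Lg) opprK.
- by apply: rlim => //; rewrite (lt_trans rt).
- by apply: rlim => //; rewrite (lt_trans r0).
Qed.

Lemma shifted_increment (a b T s : R) (u ut : R -> R -> R) (g w0 : R -> R) (r t : R) :
  a < b -> 0 < r -> r < t -> t < T -> continuous_L2 a b T u -> weak_dt a b T u ut ->
  L2L2 a b T ut -> L2 leb `]a, b[ g ->
  \int[leb]_(z in `]r, t]) (\int[leb]_(x in `]a, b[) ((ut x z - s) * g x)) =
  \int[leb]_(x in `]a, b[) (((u x t - (w0 x + s * t)) - (u x r - (w0 x + s * r))) * g x).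
Proof.
move=> ab r0 rt tT cu du Lut Lg.
have T0 : 0 < T by rewrite (lt_trans r0)// (lt_trans rt).
have mab : measurable (`]a, b[%classic : set MR) by exact: measurable_itv.
have mrt : measurable (`]r, t]%classic : set MR) by exact: measurable_itv.
have abf : (leb (`]a, b[%classic : set MR) < +oo)%E by exact: (@carrier_lty R OpenInterval a b).
have ig := L2_integrable mab abf Lg.
have Lt : L2 leb `]a, b[ (u ^~ t).
  by apply: (cu t _).1; rewrite in_itv/= (ltW tT) (ltW (lt_trans r0 rt)).
have Lr : L2 leb `]a, b[ (u ^~ r).
  by apply: (cu r _).1; rewrite in_itv/= (ltW r0) (ltW (lt_trans rt tT)).
have [it _] := L2_mul mab Lt Lg; have [ir _] := L2_mul mab Lr Lg.
have sub : `]r, t]%classic `<=` (`]0, T[%classic : set MR).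
  move=> z /=; rewrite !in_itv/= => /andP[rz zt].
  by rewrite (lt_trans r0 rz) (le_lt_trans zt tT).
have ik := integrable_itvS sub (L2L2_pairing ab T0 Lut Lg).
have iks := integrable_itvS sub (L2L2_pairing ab T0 (L2L2_sub_cst s Lut) Lg).
pose J := \int[leb]_(x in `]a, b[) g x.
have ic : leb.-integrable (`]r, t]%classic : set MR) (EFin \o cst (s * J)).
  by apply: continuous_integrable_oc => z; exact: cvg_cst.
transitivity (\int[leb]_(z in `]r, t]) ((\int[leb]_(x in `]a, b[) (ut x z * g x)) - s * J)).
  apply: Rintegral_ae => //.
  - by case/integrableP : iks => /measurable_EFinP.
  - by apply: measurable_funB; [case/integrableP : ik => /measurable_EFinP|exact: measurable_cst].
  apply: ae_imp (L2L2_slices Lut).1 _ => z Lz /sub zT.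
  have [iz _] := L2_mul mab (Lz zT) Lg.
  rewrite /J -RintegralZl// -RintegralB//; last exact: integrableRZl.
  by apply: eq_Rintegral => x _; ring.
rewrite RintegralB// (pairing_increment ab r0 rt tT cu du Lut Lg).
rewrite Rintegral_cst//.
have -> : fine (leb (`]r, t]%classic : set MR)) = t - r.
  by rewrite lebesgue_measure_itv/= lte_fin rt -EFinD.
rewrite -RintegralB//.
have -> : s * J * (t - r) = \int[leb]_(x in `]a, b[) (s * (t - r) * g x).
  by rewrite RintegralZl// /J; ring.
rewrite -RintegralB//; [|exact: integrableRB|exact: integrableRZl].
by apply: eq_Rintegral => x _; ring.
Qed.

Lemma half_absorb (D c S : R) : D <= c / 2 * S + D / 2 -> D <= c * S.
Proof. lra. Qed.

(** Convexity of the square of the positive part: its graph lies above the tangent at [p]. *)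
Lemma max0_sqr_le (p q : R) : Num.max 0 p ^+ 2 - Num.max 0 q ^+ 2 <=
  2 * ((p - q) * Num.max 0 p).
Proof.
case: (leP 0 p) => p0 /=; case: (leP 0 q) => q0 /=; rewrite -subr_ge0.
- by have := sqr_ge0 (p - q); lra.
- by have : 0 <= p * p - 2 * (q * p); [rewrite subr_ge0; nra|nra].
- by have := sqr_ge0 q; lra.
- lra.
Qed.

(** The convexity bound tests the increment of [u] over [[r, t]] with the positive part at the fixed
    time [t], whereas the hypothesis has it at the running time [y]. Exchanging the two costs
    [(t - r) (G t - G r)], an error removed by [partition_nonincreasing]. *)
Lemma time_comparison (a b T t0 t1 s : R) (u ut : R -> R -> R) (w0 : R -> R) :
  a < b -> 0 < t0 -> t0 < t1 -> t1 < T ->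
  continuous_L2 a b T u -> weak_dt a b T u ut -> L2L2 a b T ut ->
  L2 leb `]a, b[ w0 ->
  {ae leb, forall t, t0 < t <= t1 ->
    \int[leb]_(x in `]a, b[) ((ut x t - s) * Num.max 0 (u x t - (w0 x + s * t))) <= 0} ->
  (forall x, a < x < b -> u x t0 <= w0 x + s * t0) ->
  forall t, t0 <= t <= t1 ->
    \int[leb]_(x in `]a, b[) (Num.max 0 (u x t - (w0 x + s * t)) ^+ 2) = 0.
Proof.
move=> ab t00 t01 t1T cu du Lut Lw0 hle hinit.
have T0 : 0 < T by rewrite (lt_trans t00)// (lt_trans t01).
have mab : measurable (`]a, b[%classic : set MR) by exact: measurable_itv.
have abf : (leb (`]a, b[%classic : set MR) < +oo)%E by exact: (@carrier_lty R OpenInterval a b).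
pose z t x := u x t - (w0 x + s * t).
pose H t x := Num.max 0 (z t x).
pose Phi t := \int[leb]_(x in `]a, b[) (H t x ^+ 2).
have inT t : t0 <= t <= t1 -> t \in `[0, T].
  by move=> /andP[h1 h2]; rewrite in_itv/= (le_trans (ltW t00) h1) (le_trans h2 (ltW t1T)).
have Lz t : t0 <= t <= t1 -> L2 leb `]a, b[ (z t).
  move=> /inT tT; apply: (L2_sub mab (cu t tT).1 _).1.
  rewrite (_ : (fun x => w0 x + s * t) = (fun x => w0 x - - (s * t))); last first.
    by apply/funext => x; rewrite opprK.
  apply: (L2_sub mab Lw0 _).1.
  by apply: (@L2_bounded _ _ _ `|- (s * t)|) => //; exact: measurable_cst.
have LH t : t0 <= t <= t1 -> L2 leb `]a, b[ (H t) by move=> /Lz; exact: L2_pos_part.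
have Lv := L2L2_sub_cst s Lut.
have [Lvs iB] := L2L2_slices Lv.
pose B t := \int[leb]_(x in `]a, b[) ((ut x t - s) ^+ 2).
(* The accumulated energy of [ut - s] measures every time increment below. *)
pose G y := \int[leb]_(t in `]t0, y]) B t.
have B0 t : 0 <= B t by apply: Rintegral_ge0 => x _; exact: sqr_ge0.
have sub r t : t0 <= r -> t <= t1 -> `]r, t]%classic `<=` (`]0, T[%classic : set MR).
  move=> r0 tt y /=; rewrite !in_itv/= => /andP[ry yt].
  by rewrite (lt_trans t00 (le_lt_trans r0 ry)) (le_lt_trans (le_trans yt tt) t1T).
have iBs r t : t0 <= r -> t <= t1 -> leb.-integrable (`]r, t]%classic : set MR) (EFin \o B).
  move=> h1 h2; exact: integrable_itvS (sub _ _ h1 h2) iB.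
have GB r t : t0 <= r -> r <= t -> t <= t1 -> G t - G r = \int[leb]_(y in `]r, t]) B y.
  move=> h1 h2 h3; rewrite /G.
  have -> : (`]t0, t]%classic : set MR) = `]t0, r]%classic `|` `]r, t]%classic.
    by rewrite -itv_bndbnd_setU// bnd_simp.
  rewrite Rintegral_setU; first by rewrite addrAC subrr add0r.
  - exact: measurable_itv.
  - exact: measurable_itv.
  - rewrite -itv_bndbnd_setU ?bnd_simp//; exact: iBs.
  - apply/disj_setPS => y []/=; rewrite !in_itv/= => /andP[_ h] /andP[h' _].
    by move: (lt_le_trans h' h); rewrite ltxx.
have pairing r t g : t0 <= r -> r < t -> t <= t1 -> L2 leb `]a, b[ g ->
    \int[leb]_(y in `]r, t]) (\int[leb]_(x in `]a, b[) ((ut x y - s) * g x)) =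
      \int[leb]_(x in `]a, b[) ((z t x - z r x) * g x) /\
    leb.-integrable (`]r, t]%classic : set MR)
      (EFin \o (fun y => \int[leb]_(x in `]a, b[) ((ut x y - s) * g x))).
  move=> h1 h2 h3 Lg; split.
    apply: (@shifted_increment a b T s u ut g w0 r t) => //.
      exact: (lt_le_trans t00).
    exact: (le_lt_trans h3).
  apply: integrable_itvS (sub _ _ h1 h3) _.
  exact: L2L2_pairing.
(* The increment is tested with itself. Young with weight [t - r] leaves half of its squared norm on
   the right, which is absorbed, and gives the factor [t - r]. *)
have zdist r t : t0 <= r -> r < t -> t <= t1 ->
    \int[leb]_(x in `]a, b[) ((z t x - z r x) ^+ 2) <= (t - r) * (G t - G r).
  move=> h1 h2 h3; rewrite GB// ?(ltW h2)//.
  have rt0 : 0 < t - r by rewrite subr_gt0.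
  have Ld : L2 leb `]a, b[ (fun x => z t x - z r x).
    by apply: (L2_sub mab (Lz t _) (Lz r _)).1; rewrite ?h1 ?h3 ?(ltW (lt_le_trans h2 h3))
      ?(ltW (le_lt_trans h1 h2)).
  have [e ig] := pairing r t _ h1 h2 h3 Ld.
  set D := \int[leb]_(x in _) _ ^+ 2.
  have eD : \int[leb]_(x in `]a, b[) ((z t x - z r x) * (z t x - z r x)) = D.
    by apply: eq_Rintegral => x _; rewrite expr2.
  have : \int[leb]_(y in `]r, t]) (\int[leb]_(x in `]a, b[) ((ut x y - s) * (z t x - z r x)))
      <= \int[leb]_(y in `]r, t]) ((t - r) / 2 * B y + (2 * (t - r))^-1 * D).
    apply: le_Rintegral_ae => //.
      apply: integrableRD => //; first by apply: integrableRZl => //; exact: iBs.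
      by apply: continuous_integrable_oc => y; exact: cvg_cst.
    apply: ae_imp Lvs _ => y Ly /(sub _ _ h1 h3) yT.
    have [_ /(_ (t - r) rt0) h] := L2_mul mab (Ly yT) Ld.
    exact: (le_trans (ler_norm _)).
  rewrite e eD RintegralD//; first last.
  - by apply: continuous_integrable_oc => y; exact: cvg_cst.
  - by apply: integrableRZl => //; exact: iBs.
  rewrite RintegralZl//; last exact: iBs.
  rewrite Rintegral_cst//.
  have -> : fine (leb (`]r, t]%classic : set MR)) = t - r.
    by rewrite lebesgue_measure_itv/= lte_fin h2 -EFinD.
  have -> : (2 * (t - r))^-1 * D * (t - r) = D / 2 by field; rewrite gt_eqF.
  exact: half_absorb.
have HL r t x : (H t x - H r x) ^+ 2 <= (z t x - z r x) ^+ 2.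
  by rewrite -[leLHS]real_normK ?num_real// -[leRHS]real_normK ?num_real// lerXn2r ?nnegrE// pos_part_lip.
have main r t : t0 <= r -> r < t -> t <= t1 ->
    Phi t - Phi r <= 2 * (t - r) * (G t - G r).
  move=> h1 h2 h3.
  have rt0 : 0 < t - r by rewrite subr_gt0.
  have rI : t0 <= r <= t1 by rewrite h1 (ltW (lt_le_trans h2 h3)).
  have tI : t0 <= t <= t1 by rewrite h3 (ltW (le_lt_trans h1 h2)).
  have [e ig] := pairing r t _ h1 h2 h3 (LH t tI).
  have [_ it2] := (L2P _ _ mab).1 (LH t tI); have [_ ir2] := (L2P _ _ mab).1 (LH r rI).
  have Ldz := (L2_sub mab (Lz t tI) (Lz r rI)).1.
  have [idz _] := L2_mul mab Ldz (LH t tI).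
  have G0 : 0 <= G t - G r by rewrite GB// ?(ltW h2)//; apply: Rintegral_ge0.
  apply: (@le_trans _ _ (2 * \int[leb]_(x in `]a, b[) ((z t x - z r x) * H t x))).
    rewrite /Phi -RintegralB// -RintegralZl//; apply: le_Rintegral => //.
    - exact: integrableRB.
    - exact: integrableRZl.
    - by move=> x _; exact: max0_sqr_le.
  rewrite -e -mulrA ler_pM2l//.
  (* At time [y] write [H t = H y + (H t - H y)]. The first part contributes at most zero by [hle];
     Young with weight [t - r] and [zdist] bound the second by this integrand, whose integral is
     [(t - r) (G t - G r)]. *)
  apply: (@le_trans _ _ (\int[leb]_(y in `]r, t]) ((t - r) / 2 * B y + (G t - G r) / 2))).
    apply: le_Rintegral_ae => //.
      apply: integrableRD => //; first by apply: integrableRZl => //; exact: iBs.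
      by apply: continuous_integrable_oc => y; exact: cvg_cst.
    apply: ae_imp (ae_and Lvs hle) _ => y [Ly hy] yrt.
    have yT := sub _ _ h1 h3 _ yrt.
    move: yrt; rewrite /= in_itv/= => /andP[ry yt].
    have yI : t0 <= y <= t1 by rewrite (le_trans h1 (ltW ry)) (le_trans yt h3).
    have ty : t0 < y <= t1 by rewrite (le_lt_trans h1 ry) (le_trans yt h3).
    move: (hy ty) => {}hy.
    have [i1 _] := L2_mul mab (Ly yT) (LH t tI).
    have [i2 _] := L2_mul mab (Ly yT) (LH y yI).
    have LdH := (L2_sub mab (LH t tI) (LH y yI)).1.
    have [i3 /(_ (t - r) rt0) hh] := L2_mul mab (Ly yT) LdH.
    have : \int[leb]_(x in `]a, b[) ((ut x y - s) * H t x) =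
        \int[leb]_(x in `]a, b[) ((ut x y - s) * H y x) +
        \int[leb]_(x in `]a, b[) ((ut x y - s) * (H t x - H y x)).
      by rewrite -RintegralD//; apply: eq_Rintegral => x _; ring.
    have : \int[leb]_(x in `]a, b[) ((H t x - H y x) ^+ 2) <= (t - r) * (G t - G r).
      move: yt; rewrite le_eqVlt => /predU1P[->|yt].
        rewrite (_ : (fun _ => _) = (fun=> 0)); last first.
          by apply/funext => x; rewrite subrr expr0n.
        by rewrite Rintegral_cst// mul0r; apply: mulr_ge0 => //; exact: ltW.
      apply: (@le_trans _ _ (\int[leb]_(x in `]a, b[) ((z t x - z y x) ^+ 2))).
        have [_ ia] := (L2P _ _ mab).1 LdH.
        have [_ ib] := (L2P _ _ mab).1 (L2_sub mab (Lz t tI) (Lz y yI)).1.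
        by apply: le_Rintegral => // x _; exact: HL.
      apply: (le_trans (zdist y t (le_trans h1 (ltW ry)) yt h3)).
      rewrite ler_pM ?subr_ge0 ?(ltW yt)//.
      - by rewrite -subr_ge0 GB ?(ltW yt) ?(le_trans h1 (ltW ry))//; apply: Rintegral_ge0.
      - by rewrite lerD2l lerN2 ltW.
      - rewrite lerD2l lerN2 -subr_ge0 GB ?(ltW ry)//; last exact: (le_trans (ltW yt)).
        exact: Rintegral_ge0.
    set D := \int[leb]_(x in _) _ ^+ 2 => hD ->.
    have := le_trans (ler_norm _) hh; rewrite -/D -/(B y) => hh2.
    apply: (le_trans (lerD hy hh2)); rewrite add0r lerD2l.
    have -> : (G t - G r) / 2 = (2 * (t - r))^-1 * ((t - r) * (G t - G r)).
      by field; rewrite gt_eqF.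
    by rewrite ler_wpM2l// invr_ge0 mulr_ge0// ltW.
  rewrite RintegralD//; first last.
  - by apply: continuous_integrable_oc => y; exact: cvg_cst.
  - by apply: integrableRZl => //; exact: iBs.
  rewrite RintegralZl//; last exact: iBs.
  rewrite -GB ?(ltW h2)// Rintegral_cst//.
  have -> : fine (leb (`]r, t]%classic : set MR)) = t - r.
    by rewrite lebesgue_measure_itv/= lte_fin h2 -EFinD.
  by rewrite le_eqVlt; apply/orP; left; apply/eqP; field.
move=> t /andP[t0t tt1]; apply/eqP; rewrite eq_le; apply/andP; split; last first.
  by apply: Rintegral_ge0 => x _; exact: sqr_ge0.
apply: (@le_trans _ _ (Phi t0)).
  apply: (@partition_nonincreasing _ Phi G t0 t) => // x y h1 h2 h3.
  by apply: main => //; exact: (le_trans h3).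
rewrite /Phi le_eqVlt; apply/orP; left; apply/eqP.
transitivity (\int[leb]_(x in `]a, b[) (0 : R)); last by rewrite Rintegral_cst// mul0r.
apply: eq_Rintegral => x /set_mem; rewrite /= in_itv/= => /hinit h.
by rewrite /H /z (max_idPl _) ?expr0n// subr_le0.
Qed.

Lemma pos_part_L2_eq0 (a b : R) (z : R -> R) : L2 leb `]a, b[ z ->
  \int[leb]_(x in `]a, b[) (Num.max 0 (z x) ^+ 2) = 0 ->
  {ae leb, forall x, x \in `]a, b[ -> z x <= 0}.
Proof.
have mab : measurable (`]a, b[%classic : set MR) by exact: measurable_itv.
move=> Lz; have [mp ip] := (L2P _ _ mab).1 (L2_pos_part mab Lz).
move=> h.
have : (\int[leb]_(x in `]a, b[) `|(Num.max 0 (z x) ^+ 2)%:E| = 0)%E.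
  rewrite -[LHS]fineK; last first.
    rewrite ge0_fin_numE; last by apply: integral_ge0.
    by case/integrableP : ip.
  rewrite -[RHS]/((0 : R)%:E) -[in RHS]h; congr (_%:E); rewrite /Rintegral; congr fine.
  by apply: eq_integral => x _; rewrite gee0_abs//= lee_fin sqr_ge0.
have mf : measurable_fun (`]a, b[%classic : set MR) (fun x => (Num.max 0 (z x) ^+ 2)%:E).
  by case/integrableP : ip.
move=> /(ae_eq_integral_abs leb mab mf) h0.
apply: ae_imp h0 _ => x /= hx xab; have := hx xab => -[] /eqP.
by rewrite sqrf_eq0 eq_sym => /eqP/esym/max_idPl.
Qed.

Lemma ae_exists_itv (P : R -> Prop) (y1 y2 : R) : {ae leb, forall x, P x} -> y1 < y2 ->
  exists2 y, y1 < y < y2 & P y.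
Proof.
move=> [N [mN N0 NP]] y12; apply: contrapT => hno.
suff : (leb (`]y1, y2[%classic : set MR) <= leb N)%E.
  rewrite N0 lebesgue_measure_itv/= lte_fin y12 -EFinD lee_fin subr_le0 => h1.
  by move: (le_lt_trans h1 y12); rewrite ltxx.
apply: le_measure; rewrite ?inE//.
by move=> y /= yy; apply: NP => /= hy; apply: hno; exists y; rewrite // in_itv in yy.
Qed.

(* The value at a point lies between two limits of nearby values, hence is bounded
   by whatever bounds the function almost everywhere. *)
Lemma between_limits_le_ae (a b c d : R) (v w : R -> R) : a <= c -> d <= b ->
  between_limits a b v -> continuous w ->
  {ae leb, forall x, x \in `]c, d[ -> v x <= w x} ->
  forall x, x \in `]c, d[ -> v x <= w x.
Proof.
move=> ac db bl cw hae x xcd.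
have xab : x \in `]a, b[.
  by move: xcd; rewrite !in_itv/= => /andP[cx xd]; rewrite (le_lt_trans ac cx) (lt_le_trans xd db).
have [cl cr /andP[_ h]] := bl x xab.
apply: (le_trans h); rewrite ge_max.
have nearby (F : set_system R) : ProperFilter F -> F --> nbhs x ->
    (forall P : set R, F P -> exists2 y, P y & v y <= w y) ->
    cvg (v @ F) -> lim (v @ F) <= w x.
  move=> PF Fx hF cvF; rewrite leNgt; apply/negP => lt.
  pose e := (lim (v @ F) - w x) / 2.
  have e0 : 0 < e by rewrite divr_gt0// subr_gt0.
  have /cvgrPdist_lt/(_ e e0) h1 := cvF.
  have /cvgrPdist_lt/(_ e e0) h2 : w y @[y --> F] --> w x.
    exact: (cvg_trans (cvg_app _ Fx) (cw x)).
  have [y [hy1 hy2] hy3] := hF _ (filterI h1 h2).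
  move: hy1 hy2; rewrite /= !ltr_norml /e; lra.
move: xcd; rewrite in_itv/= => /andP[cx xd].
apply/andP; split; apply: nearby => //.
- by apply: cvg_within.
- move=> P; rewrite /at_left /= => -[e /= e0 he].
  have cex : Num.max c (x - e) < x by rewrite gt_max cx ltrBlDr ltrDl.
  have [y /andP[y1 y2] hy0] := ae_exists_itv hae cex.
  have hy : v y <= w y.
    by apply: hy0; move: y1; rewrite gt_max in_itv/= => /andP[-> _]; exact: lt_trans xd.
  exists y => //; apply: he => //=.
  by move: y1; rewrite gt_max => /andP[_ y1]; rewrite gtr0_norm ?subr_gt0//; lra.
- by apply: cvg_within.
- move=> P; rewrite /at_right /= => -[e /= e0 he].
  have xde : x < Num.min d (x + e) by rewrite lt_min xd ltrDl.
  have [y /andP[y1 y2] hy0] := ae_exists_itv hae xde.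
  have hy : v y <= w y.
    by apply: hy0; move: y2; rewrite lt_min in_itv/= => /andP[-> _]; rewrite (lt_trans cx).
  exists y => //; apply: he => //=.
  by move: y2; rewrite lt_min => /andP[_ y2]; rewrite ltr0_norm ?subr_lt0//; lra.
Qed.

End TimeComparison.

(** * Comparison of solutions with barriers on rectangles *)

Section SpaceTimeComparison.
Context {R : realType}.
Local Notation MR := (measurableTypeR R).

Lemma half_slope_shift (B xi : R -> R) (k s t : R) :
  half_slope B xi s t -> half_slope (fun x => B x + k) xi s t.
Proof.
by case=> -[h1 h2]; [apply: Or31|apply: Or32|apply: Or33]; split => // x y sx xy yt;
  rewrite ?lerD2r ?(h1 x y).
Qed.

Lemma subgradient_piece_shift (w xip xim : R -> R) (k s t : R) :
  subgradient_piece w xip xim s t -> subgradient_piece (fun x => w x + k) xip xim s t.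
Proof.
move=> [/(half_slope_shift k) h1 /(half_slope_shift k) h2]; split.
  by rewrite (_ : (fun x => w x + k + x) = (fun x => w x + x + k))//; apply/funext => x; ring.
by rewrite (_ : (fun x => w x + k - x) = (fun x => w x - x + k))//; apply/funext => x; ring.
Qed.

Lemma right_limitP (a b : R) (v : R -> R) : between_limits a b v ->
  forall y, a < y < b -> v z @[z --> y^'+] --> lim (v z @[z --> y^'+]).
Proof. by move=> bl y yab; have [] := bl y; rewrite ?in_itv. Qed.

Lemma continuous_L2_itv (w : R -> R) (c d : R) : continuous w -> L2 leb `]c, d[ w.
Proof.
move=> cw; have [M hM] := continuous_itv_bound c d cw.
apply: (@L2_bounded _ _ _ M); [exact: measurable_itv| | |].
- exact: (@carrier_lty R OpenInterval c d).
- exact: measurable_continuous.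
- by move=> x /=; rewrite in_itv/= => /andP[/ltW h1 /ltW h2]; apply: hM; rewrite h1 h2.
Qed.

(** At a single time [kxi <= s] bounds the right side of [selection_comparison], and on the left [U]
    is exchanged for [v], which agrees with it almost everywhere. *)
Lemma selection_time_sign dom (a b c x1 x2 d K s : R)
    (v om k0 w xip xim kxi : R -> R) :
  a < c -> c <= x1 -> x1 <= x2 -> x2 <= d -> c < d -> d < b ->
  between_limits a b v -> selection dom a b v om ->
  {within `[a, b], continuous om} -> L2 leb `]a, b[ v -> L2 leb `]a, b[ k0 ->
  (forall phi, test_function dom a b phi ->
    \int[leb]_(x in `]a, b[) (k0 x * phi x) =
    - \int[leb]_(x in `]a, b[) (om x * (phi^`())%classic x)) ->
  0 <= K -> (forall x y, `|w y - w x| <= K * `|y - x|) ->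
  lim (v z @[z --> c^'+]) <= w c -> lim (v z @[z --> d^'+]) <= w d ->
  subgradient_piece w xip xim c x1 -> subgradient_piece w xip xim x1 x2 ->
  subgradient_piece w xip xim x2 d ->
  continuous xip -> continuous xim -> leb.-integrable `]c, d] (EFin \o kxi) ->
  (forall x, c < x <= d -> kxi x <= s) ->
  (forall y, c < y <= d -> (xip d + xim d) - (xip y + xim y) =
     \int[leb]_(x in `[y, d]) kxi x) ->
  \int[leb]_(x in `]c, d[) ((k0 x - s) * Num.max 0 (v x - w x)) <= 0.
Proof.
move=> ac cx1 x12 x2d cd db bl [mu hv hsel] com Lv Lk0 hk0 K0 wK Uc Ud p1 p2 p3 cxip cxim ikxi ks hkxi.
have mab : measurable (`]a, b[%classic : set MR) by exact: measurable_itv.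
have mcd : measurable (`]c, d]%classic : set MR) by exact: measurable_itv.
have mcdo : measurable (`]c, d[%classic : set MR) by exact: measurable_itv.
have sub : `]c, d]%classic `<=` (`]a, b[%classic : set MR).
  move=> z /=; rewrite !in_itv/= => /andP[cz zd].
  by rewrite (lt_trans ac cz) (le_lt_trans zd db).
have abf : (leb (`]a, b[%classic : set MR) < +oo)%E by exact: (@carrier_lty R OpenInterval a b).
have ik0 := L2_integrable mab abf Lk0.
pose U y := lim (v z @[z --> y^'+]).
have vU := right_limitP bl.
have [iH ik iks le] := selection_comparison ac cx1 x12 x2d cd db hv vU hsel com ik0 hk0 K0 wK
  Uc Ud p1 p2 p3 cxip cxim ikxi hkxi.
have cw := lipschitz_continuous K0 wK.
have isH : leb.-integrable `]c, d] (EFin \o (fun x => s * Num.max 0 (U x - w x))).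
  exact: integrableRZl.
have LH : L2 leb `]c, d[ (fun x => Num.max 0 (v x - w x)).
  have Lvc : L2 leb `]c, d[ v.
    apply: L2_subset Lv => //; apply: subset_trans sub; exact: subset_itv_oo_oc.
  by apply: L2_pos_part => //; apply: (L2_sub mcdo Lvc _).1; exact: continuous_L2_itv.
have Lk : L2 leb `]c, d[ (fun x => k0 x - s).
  apply: (L2_sub mcdo _ _).1.
    apply: L2_subset Lk0 => //; apply: subset_trans sub; exact: subset_itv_oo_oc.
  by apply: continuous_L2_itv => x; exact: cvg_cst.
have [ikH _] := L2_mul mcdo Lk LH.
have i0 := integrableRB mcd ik isH.
have -> : \int[leb]_(x in `]c, d[) ((k0 x - s) * Num.max 0 (v x - w x)) =
    \int[leb]_(x in `]c, d[) (k0 x * Num.max 0 (U x - w x) - s * Num.max 0 (U x - w x)).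
  apply: Rintegral_ae => //.
  - by case/integrableP : ikH => /measurable_EFinP.
  - have : leb.-integrable `]c, d[ (EFin \o
        (fun x => k0 x * Num.max 0 (U x - w x) - s * Num.max 0 (U x - w x))).
      by apply: integrable_itvS i0; exact: subset_itv_oo_oc.
    by case/integrableP => /measurable_EFinP.
  - apply: ae_imp (right_limit_ae (L2_integrable mab abf Lv) vU) _ => x vx xcd.
    by rewrite vx ?mulrBl//; apply: sub; exact: (@subset_itv_oo_oc _ _ c d).
rewrite Rintegral_itv_bndo_bndc//; last first.
  by apply: integrable_itvS i0; exact: subset_itv_oo_oc.
rewrite RintegralB// subr_le0; apply: (le_trans le).
apply: le_Rintegral => // x; rewrite /= in_itv/= => xcd; apply: ler_wpM2r; last exact: ks.
by rewrite le_max lexx.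
Qed.

(* [xip + xim] is a selection of [L o w'] with derivative [kxi <= s]; the slope of [w]
   may cross [-1] or [1] only at [x1] and [x2]. *)
Definition static_supersolution (c d s : R) (w : R -> R) : Prop :=
  exists x1 x2 K : R, exists xip xim kxi : R -> R,
  [/\ [/\ c <= x1, x1 <= x2 & x2 <= d],
      0 <= K /\ (forall x y, `|w y - w x| <= K * `|y - x|),
      [/\ subgradient_piece w xip xim c x1, subgradient_piece w xip xim x1 x2 &
          subgradient_piece w xip xim x2 d],
      [/\ continuous xip, continuous xim & leb.-integrable `]c, d] (EFin \o kxi)] &
      (forall x, c < x <= d -> kxi x <= s) /\
      (forall y, c < y <= d -> (xip d + xim d) - (xip y + xim y) =
        \int[leb]_(x in `[y, d]) kxi x)].

Lemma static_supersolution_continuous (c d s : R) (w : R -> R) :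
  static_supersolution c d s w -> continuous w.
Proof.
move=> [x1 [x2 [K [xip [xim [kxi [_ [K0 wK] _ _ _]]]]]]].
exact: lipschitz_continuous wK.
Qed.

Lemma static_supersolution_shift (c d s k : R) (w : R -> R) :
  static_supersolution c d s w -> static_supersolution c d s (fun x => w x + k).
Proof.
move=> [x1 [x2 [K [xip [xim [kxi [h1 [K0 wK] [p1 p2 p3] h4 h5]]]]]]].
exists x1, x2, K, xip, xim, kxi; split => //.
  by split => // x y; rewrite opprD addrACA subrr addr0.
by split; exact: subgradient_piece_shift.
Qed.

(* The part of [solution] that does not mention the boundary condition; it is stable
   under [u |-> - u]. *)
Definition interior_solution dom (a b T : R) (u : R -> R -> R) : Prop :=
  [/\ continuous_L2 a b T u,
      Linfty_BV dom a b T u,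
      (forall t, t \in `[0, T] -> between_limits a b (u ^~ t)) &
      exists ut Om : R -> R -> R,
        [/\ weak_dt a b T u ut, L2L2 a b T ut, L2W12 dom a b T Om &
          {ae leb, forall t, t \in `]0, T[ ->
            (forall phi, test_function dom a b phi ->
               \int[leb]_(x in `]a, b[) (ut x t * phi x) =
               - \int[leb]_(x in `]a, b[) (Om x t * (phi^`())%classic x)) /\
            selection dom a b (u ^~ t) (Om ^~ t)}]].

Lemma solution_interior (bc : boundary_condition R) (a b T : R) (u : R -> R -> R) :
  solution bc a b T u -> interior_solution (domain_of bc) a b T u.
Proof.
move=> [cu bu hbv [ut [Om [h1 h2 h3 h4]]]]; split => //.
  by move=> t /hbv[].
exists ut, Om; split => //; apply: ae_imp h4 _ => t h /h[e1 e2 _]; split => //.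
Qed.

(** On the lateral sides the data are right limits, the values of the representative used by the
    static inequality. The integral estimate gives the order almost everywhere at each time, and the
    values of [u] lying between one-sided limits give it at every point. *)
Lemma solution_comparison dom (a b T c d s t0 t1 : R)
    (u : R -> R -> R) (w0 : R -> R) :
  interior_solution dom a b T u -> a < c -> c < d -> d < b -> 0 < t0 -> t0 < t1 -> t1 < T ->
  static_supersolution c d s w0 ->
  (forall x, c < x < d -> u x t0 <= w0 x + s * t0) ->
  (forall t, t0 <= t <= t1 -> lim (u z t @[z --> c^'+]) <= w0 c + s * t) ->
  (forall t, t0 <= t <= t1 -> lim (u z t @[z --> d^'+]) <= w0 d + s * t) ->
  forall x t, c < x < d -> t0 <= t <= t1 -> u x t <= w0 x + s * t.
Proof.
move=> [cu _ hbv [ut [Om [dut Lut [Omx [_ _ hOm]] hae]]]] ac cd db t00 t01 t1T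
  [x1 [x2 [K [xip [xim [kxi [[cx1 x12 x2d] [K0 wK] [p1 p2 p3] [cxip cxim ikxi] [ks hkxi]]]]]]]]
  hinit hc hd x t xcd tI.
have cw := lipschitz_continuous K0 wK.
have T0 : 0 < T by rewrite (lt_trans t00)// (lt_trans t01).
have inT r : t0 <= r <= t1 -> r \in `[0, T].
  by move=> /andP[h1 h2]; rewrite in_itv/= (le_trans (ltW t00) h1) (le_trans h2 (ltW t1T)).
have inTo r : t0 <= r <= t1 -> r \in `]0, T[.
  by move=> /andP[h1 h2]; rewrite in_itv/= (lt_le_trans t00 h1) (le_lt_trans h2 t1T).
have cw1 r : continuous (fun x => w0 x + s * r).
  by move=> y; apply: cvgD; [exact: cw|exact: cvg_cst].
have cuc := continuous_L2_subset (ltW ac) (ltW db) cu.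
have hle : {ae leb, forall r, t0 < r <= t1 ->
    \int[leb]_(x in `]c, d[) ((ut x r - s) * Num.max 0 (u x r - (w0 x + s * r))) <= 0}.
  apply: ae_imp (ae_and (L2L2_slices Lut).1 (ae_and hOm hae)) _ => r [Lr [hOmr haer]].
  move=> /andP[t0r rt1]; have rI : t0 <= r <= t1 by rewrite (ltW t0r).
  have [h1 hsel] := haer (inTo _ rI); have [com _ _ _] := hOmr (inTo _ rI).
  have bl := hbv r (inT _ rI).
  apply: (@selection_time_sign dom a b c x1 x2 d K s (u ^~ r) (Om ^~ r) (ut ^~ r)
    (fun x => w0 x + s * r) xip xim kxi) => //.
  - exact: (cu r (inT _ rI)).1.
  - exact: Lr (inTo _ rI).
  - by move=> y z; rewrite opprD addrACA subrr addr0.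
  - exact: hc.
  - exact: hd.
  - exact: subgradient_piece_shift.
  - exact: subgradient_piece_shift.
  - exact: subgradient_piece_shift.
have Lw0 : L2 leb `]c, d[ w0 by exact: continuous_L2_itv.
have tc := time_comparison cd t00 t01 t1T cuc (weak_dt_subset (ltW ac) (ltW db) dut)
  (L2L2_subset (ltW ac) (ltW db) Lut) Lw0 hle hinit tI.
have bl := hbv t (inT _ tI).
have Lz : L2 leb `]c, d[ (fun x => u x t - (w0 x + s * t)).
  apply: (L2_sub _ (cuc t (inT _ tI)).1 _).1; first exact: measurable_itv.
  exact: continuous_L2_itv.
apply: (between_limits_le_ae (ltW ac) (ltW db) bl (cw1 t)); last by rewrite in_itv.
by apply: ae_imp (pos_part_L2_eq0 Lz tc) _ => y hy ycd; rewrite -subr_le0 hy.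
Qed.

End SpaceTimeComparison.

(** * The value of the nonlocal operator *)

Section FacetOperator.
Context {R : realType}.
Local Notation MR := (measurableTypeR R).

(** The base point may be an end of the facet, where only a one-sided limit is left. Properness of
    this filter is what makes limits along the facet unique. *)
Lemma facet_filter (al be x0 : R) : al < be -> x0 \in `[al, be] ->
  ProperFilter (within (`[al, be]%classic : set R) (x0^')).
Proof.
move=> ab; rewrite in_itv/= => /andP[ax xb]; split; last exact: within_filter.
rewrite /within /= -nbhs_nearE /dnbhs /within /= => /nbhs_ballP[e /= e0 he].
suff [y [y1 y2 y3]] : exists y, [/\ `|x0 - y| < e, y != x0 & al <= y <= be].
  by apply: (he y) => //=; rewrite in_itv.
case: (ltP x0 be) => xbe.
  exists (x0 + Num.min (e / 2) (be - x0)).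
  have m0 : 0 < Num.min (e / 2) (be - x0) by rewrite lt_min divr_gt0// subr_gt0.
  have m1 : Num.min (e / 2) (be - x0) <= e / 2 by rewrite ge_min lexx.
  have m2 : Num.min (e / 2) (be - x0) <= be - x0 by rewrite ge_min lexx orbT.
  split.
  - by rewrite opprD addNKr normrN gtr0_norm//; lra.
  - by rewrite gt_eqF// ltrDl.
  - by apply/andP; split; lra.
exists (x0 - Num.min (e / 2) (x0 - al)).
have m0 : 0 < Num.min (e / 2) (x0 - al) by rewrite lt_min divr_gt0// subr_gt0 (lt_le_trans ab).
have m1 : Num.min (e / 2) (x0 - al) <= e / 2 by rewrite ge_min lexx.
have m2 : Num.min (e / 2) (x0 - al) <= x0 - al by rewrite ge_min lexx orbT.
split.
- by rewrite opprB addrC subrK gtr0_norm//; lra.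
- by rewrite lt_eqF// ltrBlDr ltrDl.
- by apply/andP; split; lra.
Qed.

Lemma derivable_slope (f : R -> R) (x0 : R) : derivable f x0 1 ->
  (f y - f x0) / (y - x0) @[y --> x0^'] --> (f^`())%classic x0.
Proof.
move=> df; rewrite derive1E.
have sh : (y - x0) @[y --> x0^'] --> (0 : R)^'.
  move=> P; rewrite /= /dnbhs /within /= => /nbhs_ballP[e /= e0 he].
  apply/nbhs_ballP; exists e => //= y xy yx; apply: he; last by rewrite subr_eq0.
  by rewrite /ball/= sub0r normrN distrC.
have dq : (fun t : R => t^-1 *: ((f \o shift x0) (t *: 1) - f x0)) @ (0 : R)^' --> 'D_1 f x0.
  exact: df.
have := cvg_comp _ _ sh dq.
apply: cvg_trans; apply: near_eq_cvg; near=> y.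
by rewrite /= [_%:A]mulr1 subrK mulrC.
Unshelve. all: by end_near. Qed.

(** Along the facet the difference quotient is the constant [p], and a limit along a nondegenerate
    facet determines the full derivative. *)
Lemma facet_derive1 (f : R -> R) (p x0 al be : R) : al < be -> x0 \in `[al, be] ->
  (forall x, x \in `[al, be] -> f x = ell f p x0 x) -> derivable f x0 1 ->
  (f^`())%classic x0 = p.
Proof.
move=> ab x0ab fE df; have PF := facet_filter ab x0ab.
have c1 : (f y - f x0) / (y - x0) @[y --> within (`[al, be]%classic : set R) (x0^')]
    --> (f^`())%classic x0.
  by apply: cvg_trans (derivable_slope df); apply: cvg_app; exact: cvg_within.
apply: (cvg_unique (@Rhausdorff R) c1).
apply: cvg_near_cst; rewrite near_withinE.
rewrite /dnbhs near_withinE; apply: nearW => y /= yx yab.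
by rewrite fE// /ell addrK mulfK// subr_eq0.
Qed.

(** If one facet reached further, points just beyond the end of the other would lie on the line
    [ell] and also in the neighbourhood where [f] avoids it. *)
Lemma facet_unique (a b : R) (f : R -> R) (p x0 al be al' be' : R) :
  facet a b f p x0 al be -> facet a b f p x0 al' be' -> al = al' /\ be = be'.
Proof.
have main al1 be1 al2 be2 : facet a b f p x0 al1 be1 -> facet a b f p x0 al2 be2 ->
    al1 <= al2 /\ be2 <= be1.
  move=> [_ ab1 x1 _ [c [d [/andP[_ ca] /andP[bd _] h1]]]] [_ ab2 x2 h2 _].
  move: x1 x2; rewrite !in_itv/= => /andP[ax1 xb1] /andP[ax2 xb2].
  split; rewrite leNgt; apply/negP => lt.
    (* A point left of the first facet, still in its neighbourhood and already in the second
       facet. *)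
    pose y := (Num.max c al2 + al1) / 2.
    have m1 : c <= Num.max c al2 by rewrite le_max lexx.
    have m2 : al2 <= Num.max c al2 by rewrite le_max lexx orbT.
    have m3 : Num.max c al2 < al1 by rewrite gt_max ca.
    have [y1 y2] : Num.max c al2 < y /\ y < al1 by rewrite /y; split; lra.
    apply: (h1 y); first by rewrite in_itv/=; apply/andP; split; lra.
      by rewrite in_itv/= leNgt y2.
    by apply: h2; rewrite in_itv/=; apply/andP; split; lra.
  pose y := (Num.min d be2 + be1) / 2.
  have m1 : Num.min d be2 <= d by rewrite ge_min lexx.
  have m2 : Num.min d be2 <= be2 by rewrite ge_min lexx orbT.
  have m3 : be1 < Num.min d be2 by rewrite lt_min bd.
  have [y1 y2] : y < Num.min d be2 /\ be1 < y by rewrite /y; split; lra.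
  apply: (h1 y); first by rewrite in_itv/=; apply/andP; split; lra.
    by rewrite in_itv/= [y <= _]leNgt y2 andbF.
  by apply: h2; rewrite in_itv/=; apply/andP; split; lra.
move=> f1 f2; have [h1 h2] := main _ _ _ _ f1 f2; have [h3 h4] := main _ _ _ _ f2 f1.
by split; apply/eqP; rewrite eq_le ?h1 ?h3 ?h2 ?h4.
Qed.

(** Opposite signs at a point just left of the facet, common to the three neighbourhoods, would put
    [f] on the line there. *)
Lemma transition_left_unique (a b : R) (f : R -> R) (p x0 al be chi chi' : R) :
  facet a b f p x0 al be -> transition_left a b f p x0 al be chi ->
  transition_left a b f p x0 al be chi' -> chi = chi'.
Proof.
move=> [_ ab x0ab _ [c [d [/andP[_ ca] /andP[bd _] h]]]].
move=> [c1 [d1 [/andP[_ ca1] /andP[bd1 _] h1]]] [c2 [d2 [/andP[_ ca2] /andP[bd2 _] h2]]].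
move: x0ab; rewrite in_itv/= => /andP[ax xb].
pose m := Num.max c (Num.max c1 c2); pose y := (m + al) / 2.
have ma : m < al by rewrite !gt_max ca ca1 ca2.
have mc : c <= m by rewrite /m le_max lexx.
have mc1 : c1 <= m by rewrite /m !le_max lexx orbT.
have mc2 : c2 <= m by rewrite /m !le_max lexx !orbT.
have [y1 y2] : m < y /\ y < al by rewrite /y; split; lra.
have yne : f y <> ell f p x0 y.
  by apply: h; rewrite ?in_itv/= ?leNgt ?y2//; apply/andP; split; lra.
have i1 : y \in `]c1, d1[ by rewrite in_itv/=; apply/andP; split; lra.
have i2 : y \in `]c2, d2[ by rewrite in_itv/=; apply/andP; split; lra.
have yx : y <= x0 by lra.
case: h1 h2 => -[-> /(_ y i1 yx) k1] [] [-> /(_ y i2 yx) k2] //;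
  by exfalso; apply: yne; apply/eqP; rewrite eq_le k1 k2.
Qed.

Lemma transition_right_unique (a b : R) (f : R -> R) (p x0 al be chi chi' : R) :
  facet a b f p x0 al be -> transition_right a b f p x0 al be chi ->
  transition_right a b f p x0 al be chi' -> chi = chi'.
Proof.
move=> [_ ab x0ab _ [c [d [/andP[_ ca] /andP[bd _] h]]]].
move=> [c1 [d1 [/andP[_ ca1] /andP[bd1 _] h1]]] [c2 [d2 [/andP[_ ca2] /andP[bd2 _] h2]]].
move: x0ab; rewrite in_itv/= => /andP[ax xb].
pose m := Num.min d (Num.min d1 d2); pose y := (m + be) / 2.
have ma : be < m by rewrite !lt_min bd bd1 bd2.
have mc : m <= d by rewrite /m ge_min lexx.
have mc1 : m <= d1 by rewrite /m !ge_min lexx orbT.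
have mc2 : m <= d2 by rewrite /m !ge_min lexx !orbT.
have [y1 y2] : y < m /\ be < y by rewrite /y; split; lra.
have yne : f y <> ell f p x0 y.
  by apply: h; rewrite ?in_itv/= ?[y <= be]leNgt ?y2 ?andbF//; apply/andP; split; lra.
have i1 : y \in `]c1, d1[ by rewrite in_itv/=; apply/andP; split; lra.
have i2 : y \in `]c2, d2[ by rewrite in_itv/=; apply/andP; split; lra.
have yx : x0 <= y by lra.
case: h1 h2 => -[-> /(_ y i1 yx) k1] [] [-> /(_ y i2 yx) k2] //;
  by exfalso; apply: yne; apply/eqP; rewrite eq_le k1 k2.
Qed.

Lemma sign_constant (g : R -> R) (x y : R) :
  (forall z, x < z < y -> {for z, continuous g}) -> (forall z, x < z < y -> g z != 0) ->
  (forall z, x < z < y -> 0 <= g z) \/ (forall z, x < z < y -> g z <= 0).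
Proof.
move=> cg g0; case: (pselect (forall z, x < z < y -> 0 <= g z)); first by left.
move=> /existsNP[z1 /not_implyP[z1xy /negP]]; rewrite -ltNge => gz1.
right => z2 z2xy; rewrite leNgt; apply/negP => gz2.
have sgn s t : x < s < y -> x < t < y -> s <= t -> (g s < 0 < g t) || (g t < 0 < g s) -> False.
  move=> /andP[xs sy] /andP[xt ty] st h.
  have : {within `[s, t], continuous g}.
    apply: continuous_in_subspaceT => z; rewrite inE/= in_itv/= => /andP[sz zt].
    by apply: cg; rewrite (lt_le_trans xs sz) (le_lt_trans zt ty).
  move=> cgst; have [|z] := @IVT R g s t 0 st cgst.
    by case/orP : h => /andP[h1 h2]; rewrite ge_min le_max !(ltW h1) !(ltW h2) ?orbT.
  rewrite in_itv/= => /andP[sz zt] gz; have := g0 z; rewrite gz eqxx.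
  by rewrite (lt_le_trans xs sz) (le_lt_trans zt ty) => /(_ isT).
case: (leP z1 z2) => z12.
  by apply: (sgn z1 z2) => //; rewrite gz1 gz2.
by apply: (sgn z2 z1) => //; [exact: ltW|rewrite gz1 gz2 orbT].
Qed.

(** Next to the facet the continuous function [f - ell] has no zero, hence a constant sign; on the
    facet it is zero and satisfies either inequality. *)
Lemma transition_exists (a b : R) (f : R -> R) (p x0 al be : R) :
  (forall x, a < x < b -> {for x, continuous f}) -> facet a b f p x0 al be ->
  (exists chi, transition_left a b f p x0 al be chi) /\
  (exists chi, transition_right a b f p x0 al be chi).
Proof.
move=> cf [_ ab x0ab fE [c [d [/andP[ac ca] /andP[bd db] h]]]].
pose g y := f y - ell f p x0 y.
have cg y : a < y < b -> {for y, continuous g}.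
  move=> yab; apply: cvgB; first exact: cf.
  apply: cvgD; last exact: cvg_cst.
  by apply: cvgM; [exact: cvg_cst|apply: cvgB; [exact: cvg_id|exact: cvg_cst]].
move: (x0ab); rewrite in_itv/= => /andP[ax xb].
have gF y : al <= y <= be -> g y = 0 by move=> yab; rewrite /g -fE ?in_itv// subrr.
split.
  have := @sign_constant g c al.
  move=> /(_ _ _)[||hh|hh].
  - by move=> y /andP[cy ya]; apply: cg; apply/andP; split; lra.
  - move=> y /andP[cy ya]; rewrite /g subr_eq0; apply/eqP; apply: h.
      by rewrite in_itv/=; apply/andP; split; lra.
    by rewrite in_itv/= leNgt ya.
  - exists 1, c, d; split; rewrite ?ac ?bd//; left; split => // y; rewrite in_itv/= => /andP[cy _] yx.
    rewrite -subr_ge0 -/(g y); case: (ltP y al) => ya; first by apply: hh; rewrite cy.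
    by rewrite gF// ya (le_trans yx xb).
  - exists (-1), c, d; split; rewrite ?ac ?bd//; right; split => // y; rewrite in_itv/= => /andP[cy _] yx.
    rewrite -subr_le0 -/(g y); case: (ltP y al) => ya; first by apply: hh; rewrite cy.
    by rewrite gF// ya (le_trans yx xb).
have := @sign_constant g be d.
move=> /(_ _ _)[||hh|hh].
- by move=> y /andP[cy ya]; apply: cg; apply/andP; split; lra.
- move=> y /andP[cy ya]; rewrite /g subr_eq0; apply/eqP; apply: h.
    by rewrite in_itv/=; apply/andP; split; lra.
  by rewrite in_itv/= [y <= be]leNgt cy andbF.
- exists 1, c, d; split; rewrite ?ac ?bd//; left; split => // y; rewrite in_itv/= => /andP[_ yd] yx.
  rewrite -subr_ge0 -/(g y); case: (ltP be y) => ya; first by apply: hh; rewrite ya.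
  by rewrite gF// ya (le_trans ax yx).
- exists (-1), c, d; split; rewrite ?ac ?bd//; right; split => // y; rewrite in_itv/= => /andP[_ yd] yx.
  rewrite -subr_le0 -/(g y); case: (ltP be y) => ya; first by apply: hh; rewrite ya.
  by rewrite gF// ya (le_trans ax yx).
Qed.

(** The increment formula is known for points strictly inside; both the integral and [z] are
    continuous up to the ends, so their difference is constant on the closed interval. *)
Lemma W12_increment (al be : R) (z k : R -> R) : al < be ->
  W12 OpenInterval al be z k -> forall y, al <= y <= be ->
  \int[leb]_(x in `[al, y]) (k \_ `]al, be[%classic) x = z y - z al.
Proof.
move=> ab [cz Lz Lk hk].
have mab : measurable (`]al, be[%classic : set MR) by exact: measurable_itv.
have abf : (leb (`]al, be[%classic : set MR) < +oo)%E by exact: (@carrier_lty R OpenInterval al be).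
have iz := L2_integrable mab abf Lz; have ik := L2_integrable mab abf Lk.
pose k0 := k \_ `]al, be[%classic.
have ik0 (i : interval R) : leb.-integrable [set` i] (EFin \o k0).
  rewrite /k0 -restrict_EFin; apply/integrable_restrict => //.
  by apply: (integrableS _ _ _ ik) => //; apply: measurableI => //; exact: measurable_itv.
pose F y := parameterized_integral leb al y k0.
have cF : {within `[al, be], continuous F}.
  by apply: parameterized_integral_continuous; [exact: ltW|exact: ik0].
have cz' x : x \in `]al, be[ -> z @ x --> z x.
  by have [h _ _] := (continuous_within_itvP z ab).1 cz; exact: h.
have rz x : al < x < be -> z y @[y --> x^'+] --> z x.
  by move=> xab; apply: cvg_at_right_filter; apply: cz'; rewrite in_itv.
have inc x y : al < x -> x < y -> y < be -> F y - F x = z y - z x.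
  move=> ax xy yb; rewrite -(@weak_deriv_increment R OpenInterval al be z k x y (z x) (z y))//.
  - rewrite /F /parameterized_integral.
    have -> : (`[al, y]%classic : set MR) = `[al, x]%classic `|` `]x, y]%classic.
      by rewrite -itv_bndbnd_setU// bnd_simp ltW.
    rewrite Rintegral_setU; first last.
    + apply/disj_setPS => t []/=; rewrite !in_itv/= => /andP[_ h] /andP[h' _].
      by move: (lt_le_trans h' h); rewrite ltxx.
    + by rewrite -itv_bndbnd_setU ?bnd_simp ?(ltW ax) ?(ltW xy)//; exact: ik0.
    + exact: measurable_itv.
    + exact: measurable_itv.
    rewrite addrAC subrr add0r; apply: eq_Rintegral => t /set_mem; rewrite /= in_itv/= => /andP[xt ty].
    by rewrite /k0 patchE mem_set//= in_itv/= (lt_trans ax xt) (le_lt_trans ty yb).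
  - by move=> phi tphi; rewrite hk// opprK.
  - by apply: rz; rewrite ax (lt_trans xy).
  - by apply: rz; rewrite yb (lt_trans ax).
pose G y := F y - z y.
have cG : {within `[al, be], continuous G}.
  by move=> x; apply: cvgB; [exact: cF|exact: cz].
pose m := (al + be) / 2.
have [am mb] : al < m /\ m < be by rewrite /m; split; lra.
have Gm y : al < y < be -> G y = G m.
  move=> /andP[ay yb]; rewrite /G; case: (ltgtP y m) => [ym|my|->//].
    by have := inc _ _ ay ym mb; lra.
  by have := inc _ _ am my yb; lra.
have [_ Gal Gbe] := (continuous_within_itvP G ab).1 cG.
have Ga : G al = G m.
  apply: (cvg_unique (@Rhausdorff R) Gal); apply: cvg_near_cst; near=> y; apply: Gm.
  by apply/andP; split; near: y; [exact: nbhs_right_gt|exact: nbhs_right_lt].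
have Gb : G be = G m.
  apply: (cvg_unique (@Rhausdorff R) Gbe); apply: cvg_near_cst; near=> y; apply: Gm.
  by apply/andP; split; near: y; [exact: nbhs_left_gt|exact: nbhs_left_lt].
have Fal : F al = 0 by rewrite /F /parameterized_integral set_itv1 Rintegral_set1.
move=> y /andP[ay yb]; rewrite -/k0 -[LHS]/(F y).
have Gy : G y = G al.
  move: ay; rewrite le_eqVlt => /predU1P[->//|ay].
  move: yb; rewrite le_eqVlt => /predU1P[->|yb]; first by rewrite Ga Gb.
  by rewrite Gm ?ay// Ga.
by move: Gy; rewrite /G Fal; lra.
Unshelve. all: by end_near. Qed.

(** The mean of [k] is [m], so [k - m] is orthogonal to constants and the identity is Pythagoras. *)
Lemma W12_energy (al be : R) (z k : R -> R) (m : R) : al < be ->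
  m = (z be - z al) / (be - al) ->
  W12 OpenInterval al be z k ->
  \int[leb]_(x in `]al, be[) (k x ^+ 2) =
    m ^+ 2 * (be - al) + \int[leb]_(x in `]al, be[) ((k x - m) ^+ 2).
Proof.
move=> ab mE W; have [_ _ Lk _] := W.
have mab : measurable (`]al, be[%classic : set MR) by exact: measurable_itv.
have abf : (leb (`]al, be[%classic : set MR) < +oo)%E by exact: (@carrier_lty R OpenInterval al be).
have ik := L2_integrable mab abf Lk.
have fab : fine (leb (`]al, be[%classic : set MR)) = be - al.
  by rewrite lebesgue_measure_itv/= lte_fin ab -EFinD.
have S : \int[leb]_(x in `]al, be[) k x = m * (be - al).
  rewrite mE mulfVK; last by rewrite gt_eqF// subr_gt0.
  rewrite -(W12_increment ab W); last by rewrite lexx ltW.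
  rewrite Rintegral_mkcond /=; rewrite [RHS]Rintegral_mkcond/= -patch_setI setIidr//.
  exact: subset_itv_oo_cc.
have [mk ik2] := (L2P _ _ mab).1 Lk.
have Lm : L2 leb `]al, be[ (fun x => k x - m).
  apply: (L2_sub mab Lk _).1; apply: continuous_L2_itv => x; exact: cvg_cst.
have [_ ikm] := (L2P _ _ mab).1 Lm.
have ic (r : R) : leb.-integrable `]al, be[ (EFin \o cst r).
  by apply: continuous_integrable_oo => x; exact: cvg_cst.
have -> : m ^+ 2 * (be - al) = \int[leb]_(x in `]al, be[) (2 * m * k x - m ^+ 2).
  rewrite RintegralB; [|exact: mab|exact: integrableRZl|exact: (ic (m ^+ 2))].
  by rewrite RintegralZl// S Rintegral_cst// fab; ring.
rewrite -RintegralD//; last first.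
  by apply: integrableRB => //; [exact: integrableRZl|exact: (ic (m ^+ 2))].
by apply: eq_Rintegral => x _; ring.
Qed.

Lemma W12_affine (al be r m : R) : al < be ->
  W12 OpenInterval al be (fun x => r + m * (x - al)) (cst m).
Proof.
move=> ab; pose z := fun x : R => r + m * (x - al).
have dz x : is_derive x (1 : R) z m.
  have -> : z = (m \*: (id - cst al)) + cst r by apply/funext => t; rewrite /z/= addrC.
  by apply: is_derive_eq; rewrite subr0 addr0 -[RHS]mulr1.
have sz : smooth z by apply: (smooth_derivedP (g := cst m)) => //; exact: smooth_cst.
have cz := smooth_continuous sz.
split.
- exact: continuous_subspaceT.
- exact: continuous_L2_itv.
- by apply: continuous_L2_itv => x; exact: cvg_cst.
move=> phi [sphi [c [d [ac db phi0]]]].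
have cphi := smooth_continuous sphi; have cphi' := smooth_continuous (smooth_derive1 sphi).
have := smooth_FTC ab (smoothM sz sphi).
have e0 : phi al = 0 by apply: phi0; rewrite in_itv/= leNgt ac.
have e1 : phi be = 0 by apply: phi0; rewrite in_itv/= [be <= d]leNgt db andbF.
rewrite /= e0 e1 !mulr0 subrr.
have dE x : ((z \* phi)^`())%classic x = z x * (phi^`())%classic x + m * phi x.
  rewrite derive1E; have dp := @smooth_derivable R phi x sphi.
  have h2 : is_derive x (1 : R) phi ((phi^`())%classic x).
    by rewrite derive1E; apply: derivableP.
  have h1 := dz x.
  have h3 : is_derive x (1 : R) (z \* phi) (z x *: (phi^`())%classic x + phi x *: m).
    exact: is_deriveM.
  by rewrite derive_val /GRing.scale/= [phi x * m]mulrC.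
under eq_Rintegral do rewrite dE.
rewrite RintegralD//; first last.
- by apply: continuous_integrable_oo => x; apply: cvgM; [exact: cvg_cst|exact: cphi].
- by apply: continuous_integrable_oo => x; apply: cvgM; [exact: cz|exact: cphi'].
by move=> /eqP; rewrite addr_eq0 => /eqP.
Qed.

Lemma W12_minimal_affine (al be : R) (z k : R -> R) (m : R) : al < be ->
  m = (z be - z al) / (be - al) -> W12 OpenInterval al be z k ->
  \int[leb]_(x in `]al, be[) (k x ^+ 2) <= m ^+ 2 * (be - al) ->
  forall y, al <= y <= be -> z y = z al + m * (y - al).
Proof.
move=> ab mE W; rewrite (W12_energy ab mE W) gerDl => le0 y /andP[ay yb].
have [_ _ Lk _] := W.
have mab : measurable (`]al, be[%classic : set MR) by exact: measurable_itv.
have abf : (leb (`]al, be[%classic : set MR) < +oo)%E by exact: (@carrier_lty R OpenInterval al be).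
have may : measurable (`]al, y[%classic : set MR) by exact: measurable_itv.
have sub : `]al, y[%classic `<=` (`]al, be[%classic : set MR).
  by move=> t /=; rewrite !in_itv/= => /andP[-> ty]; rewrite (lt_le_trans ty).
have yf : (leb (`]al, y[%classic : set MR) < +oo)%E by exact: (@carrier_lty R OpenInterval al y).
have c1 (r : R) (i : R) (j : R) : L2 leb `]i, j[ (cst r).
  by apply: continuous_L2_itv => x; exact: cvg_cst.
have Lkm : L2 leb `]al, be[ (fun x => k x - m) by exact: (L2_sub mab Lk (c1 m al be)).1.
have Lkmy := L2_subset mab may sub Lkm.
have iky : leb.-integrable `]al, y[ (EFin \o k).
  by apply: L2_integrable => //; exact: L2_subset Lk.
have fab : fine (leb (`]al, y[%classic : set MR)) = y - al.
  rewrite lebesgue_measure_itv/= lte_fin; case: ltP => //= ya.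
  by apply/esym/eqP; rewrite subr_eq0 eq_le ya ay.
have e : \int[leb]_(x in `]al, y[) ((k x - m) * 1) = z y - z al - m * (y - al).
  transitivity (\int[leb]_(x in `]al, y[) (k x - m)).
    by apply: eq_Rintegral => x _; rewrite mulr1.
  rewrite RintegralB//; last exact: (L2_integrable may yf (c1 m al y)).
  rewrite Rintegral_cst// fab -(W12_increment ab W) ?ay//.
  pose k0 := k \_ `]al, be[%classic.
  have ik0 (i : interval R) : leb.-integrable [set` i] (EFin \o k0).
    rewrite /k0 -restrict_EFin; apply/integrable_restrict => //.
    apply: (integrableS _ _ _ (L2_integrable mab abf Lk)) => //.
    by apply: measurableI => //; exact: measurable_itv.
  rewrite -/k0 -Rintegral_itv_obnd_cbnd//.
  rewrite -Rintegral_itv_bndo_bndc//.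
  congr (_ - _); apply: eq_Rintegral => x /set_mem xy.
  by rewrite /k0 patchE mem_set//; exact: sub.
have [_ h] := L2_mul may Lkmy (c1 1 al y).
have s0 : \int[leb]_(x in `]al, y[) ((k x - m) ^+ 2) <= 0.
  apply: le_trans le0; apply: fine_le.
  - by apply: integrable_fin_num => //; exact: ((L2P _ _ may).1 Lkmy).2.
  - by apply: integrable_fin_num => //; exact: ((L2P _ _ mab).1 Lkm).2.
  - apply: ge0_subset_integral => //; last by move=> x _; rewrite lee_fin sqr_ge0.
    by case/integrableP : ((L2P _ _ mab).1 Lkm).2.
suff : `|z y - z al - m * (y - al)| <= 0 by rewrite normr_le0 => /eqP; lra.
pose A := `|z y - z al - m * (y - al)|; rewrite -/A leNgt; apply/negP => A0.
(* With this weight the Young bound of [A] is strictly below [A], because the integral of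
   [(k - m)^2] is at most zero. *)
have th0 : 0 < (y - al + 1) / A by rewrite divr_gt0// ltr_wpDl ?subr_ge0.
have := h _ th0; rewrite e -/A.
have -> : \int[leb]_(x in `]al, y[) (cst (1 : R) x ^+ 2) = y - al.
  by under eq_Rintegral do rewrite /= expr1n; rewrite Rintegral_cst// fab mul1r.
have h1 : (y - al + 1) / A / 2 * \int[leb]_(x in `]al, y[) ((k x - m) ^+ 2) <= 0.
  by rewrite mulr_ge0_le0// divr_ge0// ltW.
have h2 : (2 * ((y - al + 1) / A))^-1 * (y - al) < A.
  have -> : (2 * ((y - al + 1) / A))^-1 * (y - al) = A * ((y - al) / (2 * (y - al + 1))).
    by field; rewrite !gt_eqF// ltr_wpDl// subr_ge0.
  have y0 : 0 <= y - al by rewrite subr_ge0.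
  by rewrite gtr_pMr// ltr_pdivrMr; lra.
move=> h3; have := le_lt_trans h3 (ler_ltD h1 h2).
by rewrite add0r ltxx.
Qed.

End FacetOperator.

(** * Explicit values of the operator *)

Section LambdaValue.
Context {R : realType}.
Local Notation MR := (measurableTypeR R).

(** The end values lie on the obstacles, so the affine interpolation stays in the band; it already
    minimizes among all functions with these end values, obstacles or not. *)
Lemma obstacle_minimizer_affine (al be p chil chir : R) : al < be ->
  chil = 1 \/ chil = - 1 -> chir = 1 \/ chir = - 1 ->
  obstacle_minimizer p 2 al be chil chir
    (fun x => p - chil + (chil + chir) / (be - al) * (x - al)).
Proof.
move=> ab hl hr; pose m := (chil + chir) / (be - al).
have ba0 : 0 < be - al by rewrite subr_gt0.
have mba : m * (be - al) = chil + chir by rewrite mulfVK// gt_eqF.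
exists (cst m).
  split; first exact: W12_affine.
  - move=> x; rewrite in_itv/= => /andP[ax xb]; rewrite -/m divff//.
    have x0 : 0 <= x - al by rewrite subr_ge0.
    have x1 : x - al <= be - al by rewrite lerB.
    have : m * (x - al) * (be - al) = (chil + chir) * (x - al) by rewrite -mba; ring.
    move: ba0 x0 x1; set r := m * (x - al); set s := x - al; set t := be - al => t0 s0 st rt.
    by case: hl rt => ->; case: hr => -> rt; apply/andP; split; nra.
  - by rewrite subrr mulr0 addr0 divff// mulr1.
  - by rewrite -/m mba divff// mulr1; ring.
move=> z k [W _ z1 z2].
have mE : m = (z be - z al) / (be - al).
  by rewrite z1 z2 /m; congr (_ / _); rewrite divff//; ring.
rewrite (W12_energy ab mE W) /=.
have mab : measurable (`]al, be[%classic : set MR) by exact: measurable_itv.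
have fab : fine (leb (`]al, be[%classic : set MR)) = be - al.
  by rewrite lebesgue_measure_itv/= lte_fin ab -EFinD.
rewrite Rintegral_cst// fab lerDl.
by apply: Rintegral_ge0 => x _; exact: sqr_ge0.
Qed.

(** A minimizer has at most the energy of the affine competitor, and by [W12_minimal_affine] this
    forces it to be affine. *)
Lemma obstacle_minimizer_slope (al be p chil chir : R) (xi : R -> R) : al < be ->
  chil = 1 \/ chil = - 1 -> chir = 1 \/ chir = - 1 ->
  obstacle_minimizer p 2 al be chil chir xi -> forall y, al <= y <= be ->
  xi y = xi al + (chil + chir) / (be - al) * (y - al).
Proof.
move=> ab hl hr [h [W _ z1 z2] hmin].
have mE : (chil + chir) / (be - al) = (xi be - xi al) / (be - al).
  by rewrite z1 z2; congr (_ / _); rewrite divff//; ring.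
apply: (W12_minimal_affine ab mE W).
have [k adm _] := obstacle_minimizer_affine p ab hl hr.
have adm2 : admissible p 2 al be chil chir
    (fun x => p - chil + (chil + chir) / (be - al) * (x - al)) (cst ((chil + chir) / (be - al))).
  by have [_ b1 b2 b3] := adm; split => //; exact: W12_affine.
have mab : measurable (`]al, be[%classic : set MR) by exact: measurable_itv.
have fab : fine (leb (`]al, be[%classic : set MR)) = be - al.
  by rewrite lebesgue_measure_itv/= lte_fin ab -EFinD.
by apply: (le_trans (hmin _ _ adm2)); rewrite /= Rintegral_cst// fab.
Qed.

Lemma transition_left_sign (a b : R) (f : R -> R) p x0 al be chi :
  transition_left a b f p x0 al be chi -> chi = 1 \/ chi = - 1.
Proof. by move=> [c [d [_ _ [[-> _]|[-> _]]]]]; [left|right]. Qed.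

Lemma transition_right_sign (a b : R) (f : R -> R) p x0 al be chi :
  transition_right a b f p x0 al be chi -> chi = 1 \/ chi = - 1.
Proof. by move=> [c [d [_ _ [[-> _]|[-> _]]]]]; [left|right]. Qed.

Lemma Lambda_W_facet (a b : R) (f : R -> R) (p x0 al be chil chir : R) :
  derivable f x0 1 -> p = 1 \/ p = - 1 -> facet a b f p x0 al be ->
  transition_left a b f p x0 al be chil -> transition_right a b f p x0 al be chir ->
  Lambda_W a b f x0 = (chil + chir) / (be - al).
Proof.
move=> df hp hf hl hr.
have [_ ab x0ab fE _] := hf.
have hl1 := transition_left_sign hl; have hr1 := transition_right_sign hr.
have dfp := facet_derive1 ab x0ab fE df.
have lim_slope xi : (forall y, al <= y <= be ->
      xi y = xi al + (chil + chir) / (be - al) * (y - al)) ->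
    (xi y - xi x0) / (y - x0) @[y --> within `[al, be] (x0^')] --> (chil + chir) / (be - al).
  move=> xiE; apply: cvg_near_cst; rewrite near_withinE /dnbhs near_withinE.
  apply: nearW => y /= yx yab; move: x0ab yab; rewrite !in_itv/= => x0ab yab.
  rewrite (xiE y yab) (xiE x0 x0ab).
  set C := (chil + chir) / (be - al).
  have -> : xi al + C * (y - al) - (xi al + C * (x0 - al)) = C * (y - x0) by ring.
  by rewrite mulfK// subr_eq0.
have PF := facet_filter ab x0ab.
apply: xget_unique.
  right; exists p, al, be, chil, chir.
  exists (fun x => p - chil + (chil + chir) / (be - al) * (x - al)); split => //.
  - exact: obstacle_minimizer_affine.
  - by apply: lim_slope => y _; rewrite subrr mulr0 addr0.
(* The first alternative contradicts [f'(x0) = p]. In the second one [p], the facet, the transition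
   numbers and the minimizer are all determined, hence so is the limit [L]. *)
move=> L [[n1 n2 _]|[p' [al' [be' [chil' [chir' [xi [hp' hf' [hl' hr'] ho hL]]]]]]]].
  by case: hp dfp => -> // /n2.
have [_ ab' x0ab' fE' _] := hf'.
have pp : p = p' by rewrite -dfp (facet_derive1 ab' x0ab' fE' df).
subst p'; have [alE beE] := facet_unique hf hf'; subst al' be'.
have e1 := transition_left_unique hf hl hl'; subst chil'.
have e2 := transition_right_unique hf hr hr'; subst chir'.
have c2 := lim_slope xi (obstacle_minimizer_slope ab hl1 hr1 ho).
exact: (cvg_unique (@Rhausdorff R) hL c2).
Qed.

Lemma W_locally_affine (q : R) : q <> 1 -> q <> - 1 -> exists s,
  \forall y \near q, W y = W q + s * (y - q).
Proof.
move=> /eqP q1 /eqP q2.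
have aff (c : R) : q != - c -> exists s, \forall y \near q, `|y + c| = `|q + c| + s * (y - q).
  rewrite -addr_eq0; case: (ltgtP (q + c) 0) => // h _.
    exists (-1); near=> y.
    have yc : y + c < 0.
      near: y; apply/nbhs_ballP; exists (- (q + c)) => /=; first by rewrite oppr_gt0.
      by move=> y; rewrite /ball/= ltr_norml; lra.
    by rewrite !ltr0_norm//; ring.
  exists 1; near=> y.
  have yc : 0 < y + c.
    near: y; apply/nbhs_ballP; exists (q + c) => //= y.
    by rewrite /ball/= ltr_norml; lra.
  by rewrite !gtr0_norm//; ring.
have [s1 h1] := aff 1 q2; have [|s2 h2] := aff (-1); first by rewrite opprK.
exists (s1 + s2); near=> y; rewrite /W.
have -> : `|y + 1| = `|q + 1| + s1 * (y - q) by near: y.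
have -> : `|y - 1| = `|q - 1| + s2 * (y - q) by near: y.
ring.
Unshelve. all: by end_near. Qed.

(** [W'] is locally constant away from 1 and -1, and [f'] is continuous, so [W'(f')] is constant
    near [x0]. *)
Lemma Lambda_W_nonfacet (a b : R) (f : R -> R) (x0 : R) :
  derivable f x0 1 -> {for x0, continuous (f^`())%classic} ->
  (f^`())%classic x0 <> 1 -> (f^`())%classic x0 <> - 1 -> Lambda_W a b f x0 = 0.
Proof.
move=> df cf n1 n2; have [s hs] := W_locally_affine n1 n2.
set q := (f^`())%classic x0 in n1 n2 hs.
have W' : \forall y \near q, (W^`())%classic y = s.
  apply: filterS (near_join hs) => y hy; rewrite derive1E.
  rewrite (near_eq_derive _ (g := fun z => W q + s * (z - q)))//.
  have h : is_derive y (1 : R) (fun z => W q + s * (z - q)) s.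
    have -> : (fun z => W q + s * (z - q)) = (s \*: (id - cst q)) + cst (W q).
      by apply/funext => t; rewrite /= addrC.
    by apply: is_derive_eq; rewrite subr0 addr0 -[RHS]mulr1.
  by rewrite derive_val.
have Wf : {near x0, (fun x => (W^`())%classic ((f^`())%classic x)) =1 cst s}.
  exact: (cf _ W').
have dW : ((fun x => (W^`())%classic ((f^`())%classic x))^`())%classic x0 = 0.
  by rewrite derive1E (near_eq_derive _ Wf) derive_cst.
apply: xget_unique; first by left; split.
move=> L [[_ _ ->//]|[p [al [be [chil [chir [xi [hp [_ ab x0ab fE _] _ _ _]]]]]]]].
by have := facet_derive1 ab x0ab fE df; rewrite -/q => qp; case: hp qp => ->.
Qed.

End LambdaValue.

(** * Barriers *)

Section Barriers.
Context {R : realType}.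
Local Notation MR := (measurableTypeR R).

(** Empty pieces are allowed, so barriers with fewer than three pieces also fit the format of
    [static_supersolution]. *)
Lemma half_slope_point (B xi : R -> R) (s : R) : half_slope B xi s s.
Proof.
apply: Or33; split => [x y sx xy ys|z /andP[sz zs]].
  by have -> : x = y by apply/eqP; rewrite eq_le xy (le_trans ys sx).
by move: (lt_le_trans sz zs); rewrite ltxx.
Qed.

Lemma half_slope_affine (B xi : R -> R) (k s t : R) :
  (forall x y, s <= x -> x <= y -> y <= t -> B y - B x = k * (y - x)) ->
  (forall z, s < z <= t -> [\/ 0 <= k /\ xi z = 1, k <= 0 /\ xi z = - 1 |
                              k = 0 /\ `|xi z| <= 1]) ->
  half_slope B xi s t.
Proof.
move=> BE xiz; have [k0|k0|k0] := ltgtP 0 k.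
- apply: Or31; split=> [x y sx xy yt|z /xiz[[]|[]|[]]//]; last 2 first.
  + by rewrite leNgt k0.
  + by move=> k1; move: k0; rewrite k1 ltxx.
  by rewrite -subr_ge0 BE// mulr_ge0 ?subr_ge0// ltW.
- apply: Or32; split=> [x y sx xy yt|z /xiz[[]|[]|[]]//]; last 2 first.
  + by rewrite leNgt k0.
  + by move=> k1; move: k0; rewrite k1 ltxx.
  by rewrite -subr_le0 BE// mulr_le0_ge0 ?subr_ge0// ltW.
- apply: Or33; split=> [x y sx xy yt|z /xiz].
    by apply/esym/eqP; rewrite -subr_eq0 BE// -k0 mul0r.
  by case=> -[_] => [->|->|//]; rewrite ?normrN normr1.
Qed.

Lemma affine_piece (w xip xim : R -> R) (k s t : R) :
  (forall x y, s <= x -> x <= y -> y <= t -> w y - w x = k * (y - x)) ->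
  (forall z, s < z <= t -> [\/ 0 <= k + 1 /\ xip z = 1, k + 1 <= 0 /\ xip z = - 1 |
                              k + 1 = 0 /\ `|xip z| <= 1]) ->
  (forall z, s < z <= t -> [\/ 0 <= k - 1 /\ xim z = 1, k - 1 <= 0 /\ xim z = - 1 |
                              k - 1 = 0 /\ `|xim z| <= 1]) ->
  subgradient_piece w xip xim s t.
Proof.
move=> wE h1 h2; split.
  apply: (@half_slope_affine _ _ (k + 1)) => // x y sx xy yt.
  by rewrite opprD addrACA wE//; ring.
apply: (@half_slope_affine _ _ (k - 1)) => // x y sx xy yt.
have -> : w y - y - (w x - x) = w y - w x - (y - x) by ring.
by rewrite wE//; ring.
Qed.

(** For [x1 <= x2] this has slope [k] on [[x1, x2]], slope [k - sg] to the left and [k + sg] to the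
    right. *)
Definition tent (r k x0 x1 x2 sg x : R) : R :=
  r + k * (x - x0) + sg * Num.max 0 (x1 - x) + sg * Num.max 0 (x - x2).

Lemma tent_lipschitz (r k x0 x1 x2 sg : R) : 0 <= sg -> forall x y,
  `|tent r k x0 x1 x2 sg y - tent r k x0 x1 x2 sg x| <= (`|k| + sg + sg) * `|y - x|.
Proof.
move=> sg0 x y.
have -> : tent r k x0 x1 x2 sg y - tent r k x0 x1 x2 sg x =
    k * (y - x) + sg * (Num.max 0 (x1 - y) - Num.max 0 (x1 - x)) +
    sg * (Num.max 0 (y - x2) - Num.max 0 (x - x2)) by rewrite /tent; ring.
rewrite !mulrDl; apply: le_trans (ler_normD _ _) (lerD _ _).
  apply: le_trans (ler_normD _ _) (lerD _ _); first by rewrite normrM.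
  rewrite normrM ger0_norm// ler_wpM2l// (le_trans (pos_part_lip _ _))//.
  by rewrite (_ : x1 - y - (x1 - x) = x - y) 1?distrC//; ring.
rewrite normrM ger0_norm// ler_wpM2l// (le_trans (pos_part_lip _ _))//.
by rewrite (_ : y - x2 - (x - x2) = y - x)//; ring.
Qed.

Lemma derivable_upper_cone (f : R -> R) (x0 e : R) : derivable f x0 1 -> 0 < e ->
  \forall x \near x0, f x <= f x0 + (f^`())%classic x0 * (x - x0) + e * `|x - x0|.
Proof.
move=> df e0; have /cvgrPdist_lt/(_ e e0) := derivable_slope df.
rewrite /dnbhs near_withinE; apply: filterS => x hx.
have [->|xx0] := eqVneq x x0; first by rewrite subrr mulr0 normr0 mulr0 !addr0.
have {hx} hx := ltW (hx xx0).
rewrite -addrA -lerBlDl -lerBlDl (le_trans (ler_norm _))//.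
have -> : f x - f x0 - (f^`())%classic x0 * (x - x0) =
    - ((f^`())%classic x0 - (f x - f x0) / (x - x0)) * (x - x0).
  by rewrite mulNr mulrBl mulfVK ?subr_eq0//; ring.
by rewrite normrM normrN ler_wpM2r.
Qed.

Lemma near_interval (P : R -> Prop) (x0 : R) : (\forall x \near x0, P x) ->
  exists2 r, 0 < r & forall x, x0 - r <= x <= x0 + r -> P x.
Proof.
move=> /nbhs_ballP[e /= e0 he]; exists (e / 2); first by rewrite divr_gt0.
move=> x /andP[h1 h2]; apply: he; rewrite /ball/= ltr_norml; lra.
Qed.

(** The barrier is a convex corner whose two slopes stay on the same sides of -1 and 1 as [h'(xh)].
    Its selection of [L o w'] is therefore constant, with derivative 0 below [s]. *)
Lemma nonfacet_barrier (a b : R) (h : R -> R) (xh s : R) :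
  a < xh < b -> derivable h xh 1 -> (h^`())%classic xh <> 1 -> (h^`())%classic xh <> - 1 ->
  0 < s -> exists c d w, [/\ a < c < xh, xh < d < b, static_supersolution c d s w,
    h c < w c /\ h d < w d & w xh = h xh /\ forall x, c <= x <= d -> h x <= w x].
Proof.
move=> /andP[axh xhb] dh; set q := (h^`())%classic xh => /eqP q1 /eqP q2 s0.
(* Half the distance from [q] to the exceptional slopes. Below, [h] is controlled by a cone of
   opening [sg / 2], which makes the corner strictly larger away from [xh]. *)
pose sg := Num.min `|q - 1| `|q + 1| / 2.
have h1 : 0 < `|q - 1| by rewrite normr_gt0 subr_eq0.
have h2 : 0 < `|q + 1| by rewrite normr_gt0 addr_eq0.
have sg0 : 0 < sg by rewrite divr_gt0// lt_min h1 h2.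
have sg1 : sg < `|q - 1|.
  have : Num.min `|q - 1| `|q + 1| <= `|q - 1| by rewrite ge_min lexx.
  by rewrite /sg; lra.
have sg2 : sg < `|q + 1|.
  have : Num.min `|q - 1| `|q + 1| <= `|q + 1| by rewrite ge_min lexx orbT.
  by rewrite /sg; lra.
have sg20 : 0 < sg / 2 by rewrite divr_gt0.
have [r r0 hr] := near_interval (derivable_upper_cone dh sg20).
pose w := tent (h xh) q xh xh xh sg.
pose c := xh - Num.min r ((xh - a) / 2); pose d := xh + Num.min r ((b - xh) / 2).
have m1 : 0 < Num.min r ((xh - a) / 2) by rewrite lt_min r0 divr_gt0// subr_gt0.
have m2 : 0 < Num.min r ((b - xh) / 2) by rewrite lt_min r0 divr_gt0// subr_gt0.
have m3 : Num.min r ((xh - a) / 2) <= r by rewrite ge_min lexx.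
have m4 : Num.min r ((b - xh) / 2) <= r by rewrite ge_min lexx.
have m5 : Num.min r ((xh - a) / 2) <= (xh - a) / 2 by rewrite ge_min lexx orbT.
have m6 : Num.min r ((b - xh) / 2) <= (b - xh) / 2 by rewrite ge_min lexx orbT.
have wl x : x <= xh -> w x = h xh + q * (x - xh) + sg * (xh - x).
  by move=> xx; rewrite /w /tent (max_idPr _) ?subr_ge0// (max_idPl _) ?subr_le0// mulr0 addr0.
have wr x : xh <= x -> w x = h xh + q * (x - xh) + sg * (x - xh).
  by move=> xx; rewrite /w /tent (max_idPl _) ?subr_le0// (max_idPr _) ?subr_ge0// mulr0 addr0.
have hc0 : c <= xh by rewrite /c; lra.
have hd0 : xh <= d by rewrite /d; lra.
have hl x : xh - r <= x -> x < xh -> h x < w x.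
  move=> h3 h4; rewrite wl ?ltW//; have := hr x; rewrite h3 -/q ltr0_norm ?subr_lt0// opprB.
  have : x <= xh + r by lra.
  move=> -> /(_ isT) h5; apply: (le_lt_trans h5); rewrite ltrD2l ltr_pM2r ?subr_gt0//; lra.
have hg x : x <= xh + r -> xh < x -> h x < w x.
  move=> h3 h4; rewrite wr ?ltW//; have := hr x; rewrite h3 andbT -/q gtr0_norm ?subr_gt0//.
  have : xh - r <= x by lra.
  move=> -> /(_ isT) h5; apply: (le_lt_trans h5); rewrite ltrD2l ltr_pM2r ?subr_gt0//; lra.
have wxh : w xh = h xh by rewrite wl// !subrr !mulr0 !addr0.
exists c, d, w; split.
- by rewrite /c; apply/andP; split; lra.
- by rewrite /d; apply/andP; split; lra.
- pose xp := if 0 < q + 1 then (1 : R) else - 1.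
  pose xm := if 0 < q - 1 then (1 : R) else - 1.
  have cone k (r1 : R) : r1 != 0 -> sg < `|r1| -> `|k - r1| <= sg ->
      (0 < r1 /\ 0 <= k) \/ (r1 <= 0 /\ k <= 0).
    move=> _; rewrite ler_norml; case: (ltP 0 r1) => r10.
      by rewrite gtr0_norm// => ? /andP[? ?]; left; split => //; lra.
    by rewrite ler0_norm// => ? /andP[? ?]; right; split => //; lra.
  have xpP k : `|k - q| <= sg -> [\/ 0 <= k + 1 /\ xp = 1, k + 1 <= 0 /\ xp = - 1 |
      k + 1 = 0 /\ `|xp| <= 1].
    move=> kq; have qq : q + 1 != 0 by rewrite -normr_gt0.
    have [|[h3 h4]|[h3 h4]] := cone (k + 1) (q + 1) qq sg2.
    + by rewrite (_ : k + 1 - (q + 1) = k - q)//; ring.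
    + by apply: Or31; rewrite /xp h3.
    + by apply: Or32; rewrite /xp ltNge h3.
  have xmP k : `|k - q| <= sg -> [\/ 0 <= k - 1 /\ xm = 1, k - 1 <= 0 /\ xm = - 1 |
      k - 1 = 0 /\ `|xm| <= 1].
    move=> kq; have qq : q - 1 != 0 by rewrite -normr_gt0.
    have [|[h3 h4]|[h3 h4]] := cone (k - 1) (q - 1) qq sg1.
    + by rewrite (_ : k - 1 - (q - 1) = k - q)//; ring.
    + by apply: Or31; rewrite /xm h3.
    + by apply: Or32; rewrite /xm ltNge h3.
  exists xh, xh, (`|q| + sg + sg), (cst xp), (cst xm), (cst 0); split.
  + by [].
  + by split; [rewrite !addr_ge0// ltW|exact: (tent_lipschitz _ _ _ _ _ (ltW sg0))].
  + have e1 : `|q - sg - q| <= sg by rewrite addrAC subrr sub0r normrN gtr0_norm.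
    have e2 : `|q + sg - q| <= sg by rewrite addrAC subrr add0r gtr0_norm.
    split.
    * apply: (@affine_piece _ _ _ (q - sg)) => [x y cx xy yx|z _|z _]; [|exact: xpP|exact: xmP].
      by rewrite !wl ?(le_trans xy)//; ring.
    * by split; exact: half_slope_point.
    * apply: (@affine_piece _ _ _ (q + sg)) => [x y cx xy yx|z _|z _]; [|exact: xpP|exact: xmP].
      by rewrite !wr ?(le_trans cx)//; ring.
  + by split; [exact: cst_continuous|exact: cst_continuous|apply: continuous_integrable_oc => x; exact: cvg_cst].
  + split => [x _|y _]; first exact: ltW.
    by rewrite subrr Rintegral_cst ?mul0r//; exact: measurable_itv.
- by split; [apply: hl|apply: hg]; rewrite /c /d; lra.
- split => // x /andP[cx xd]; case: (ltgtP x xh) => [xx|xx|->]; last by rewrite wxh.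
    by apply/ltW/hl => //; move: cx; rewrite /c; lra.
  by apply/ltW/hg => //; move: xd; rewrite /d; lra.
Qed.

(** For [x1 <= x2] this is the projection onto [[x1, x2]], a Lipschitz primitive of the indicator of
    the interval. *)
Definition clamp (x1 x2 y : R) : R := x1 + Num.max 0 (y - x1) - Num.max 0 (y - x2).

Lemma clampl (x1 x2 y : R) : x1 <= x2 -> y <= x1 -> clamp x1 x2 y = x1.
Proof.
move=> x12 yx; rewrite /clamp !(max_idPl _) ?subr_le0 ?(le_trans yx)//.
by rewrite subr0 addr0.
Qed.

Lemma clampm (x1 x2 y : R) : x1 <= y <= x2 -> clamp x1 x2 y = y.
Proof.
move=> /andP[xy yx]; rewrite /clamp (max_idPr _) ?subr_ge0// (max_idPl _) ?subr_le0//.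
ring.
Qed.

Lemma clampr (x1 x2 y : R) : x1 <= x2 -> x2 <= y -> clamp x1 x2 y = x2.
Proof.
move=> x12 xy; rewrite /clamp !(max_idPr _) ?subr_ge0 ?(le_trans x12)//.
ring.
Qed.

Lemma clamp_lipschitz (x1 x2 x y : R) : `|clamp x1 x2 y - clamp x1 x2 x| <= 2 * `|y - x|.
Proof.
have -> : clamp x1 x2 y - clamp x1 x2 x = (Num.max 0 (y - x1) - Num.max 0 (x - x1)) -
    (Num.max 0 (y - x2) - Num.max 0 (x - x2)) by rewrite /clamp; ring.
have h z : `|Num.max 0 (y - z) - Num.max 0 (x - z)| <= `|y - x|.
  by rewrite (le_trans (pos_part_lip _ _))// opprB addrA subrK.
by rewrite (le_trans (ler_normB _ _))// mulr2n mulrDl !mul1r lerD.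
Qed.

Lemma clamp_integral (x1 x2 d y m : R) : x1 <= x2 -> x2 <= d -> y <= d ->
  leb.-integrable `[y, d] (EFin \o (fun x => m * \1_(`]x1, x2]%classic : set MR) x)) /\
  \int[leb]_(x in `[y, d]) (m * \1_(`]x1, x2]%classic : set MR) x) =
  m * (x2 - clamp x1 x2 y).
Proof.
move=> x12 x2d yd.
have mI : measurable (`]x1, x2]%classic : set MR) by exact: measurable_itv.
have mD : measurable (`[y, d]%classic : set MR) by exact: measurable_itv.
have fD : (leb (`[y, d]%classic : set MR) < +oo)%E.
  by rewrite lebesgue_measure_itv/= lte_fin; case: ifP; rewrite // -EFinD ltry.
have i1 : leb.-integrable `[y, d] (EFin \o (\1_(`]x1, x2]%classic : set MR) : MR -> R)).
  apply: measurable_bounded_integrable => //.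
  by apply: (@boundedP _ _ _ _ 1) => x _; rewrite indicE; case: (_ \in _); rewrite ?normr1 ?normr0.
split; first exact: integrableRZl.
rewrite RintegralZl//; congr (_ * _); rewrite /Rintegral integral_indic//.
have [yx|xy] := leP y x1.
  have -> : (`]x1, x2]%classic : set MR) `&` `[y, d]%classic = `]x1, x2]%classic.
    apply: setIidl => z /=; rewrite !in_itv/= => /andP[xz zx].
    by rewrite (le_trans yx (ltW xz)) (le_trans zx).
  rewrite clampl//; have e1 : fine (leb (`]x1, x2]%classic : set MR)) = x2 - x1.
    rewrite lebesgue_measure_itv/= lte_fin; case: ltP => //= h.
    by apply/esym/eqP; rewrite subr_eq0 eq_le h x12.
  exact: e1.
have -> : (`]x1, x2]%classic : set MR) `&` `[y, d]%classic = `[y, x2]%classic.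
  apply/seteqP; split=> z /=; rewrite !in_itv/=; first by case=> /andP[_ ->] /andP[->].
  by move=> /andP[yz zx]; rewrite yz zx (lt_le_trans xy yz) (le_trans zx x2d).
have e1 : fine (leb (`[y, x2]%classic : set MR)) = x2 - clamp x1 x2 y.
  rewrite lebesgue_measure_itv/= lte_fin; case: ltP => /= h.
    by rewrite clampm// (ltW xy) ltW.
  by rewrite clampr// subrr.
exact: e1.
Qed.

Lemma facet_supersolution (p chil chir c x1 x2 d r x0 s m : R) :
  p = 1 \/ p = - 1 -> chil = 1 \/ chil = - 1 -> chir = 1 \/ chir = - 1 ->
  c <= x1 -> x1 < x2 -> x2 <= d -> chil = 1 \/ x1 = c -> chir = 1 \/ x2 = d ->
  m = (chil + chir) / (x2 - x1) -> m <= s -> 0 <= s \/ x1 = c /\ x2 = d ->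
  static_supersolution c d s (tent r p x0 x1 x2 1).
Proof.
move=> hp hl hr cx1 x12 x2d hl1 hr1 mE ms hs.
have x12w := ltW x12; have cd : c <= d by lra.
(* The solution of the obstacle problem on [[x1, x2]], continued by constants. Of the two signs of
   slope minus or plus 1 only the one that degenerates at [p] varies, so the other summand of the
   selection is constant. *)
pose xi y := p - chil + m * (clamp x1 x2 y - x1).
have mx : m * (x2 - x1) = chil + chir by rewrite mE mulfVK// gt_eqF// subr_gt0.
have xil z : z <= x1 -> xi z = p - chil by move=> h; rewrite /xi clampl// subrr mulr0 addr0.
have xir z : x2 <= z -> xi z = p + chir by move=> h; rewrite /xi clampr// mx; ring.
have xim z : x1 <= z -> z <= x2 -> `|xi z - p| <= 1.
  move=> h1 h2; rewrite /xi clampm ?h1//.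
  have : m * (z - x1) * (x2 - x1) = (chil + chir) * (z - x1) by rewrite -mx; ring.
  have : 0 <= z - x1 by rewrite subr_ge0.
  have : z - x1 <= x2 - x1 by rewrite lerB.
  have : 0 < x2 - x1 by rewrite subr_gt0.
  have -> : p - chil + m * (z - x1) - p = m * (z - x1) - chil by ring.
  set q := m * (z - x1); set y := z - x1; set t := x2 - x1 => t0 st s0 rt.
  by rewrite ler_norml; case: hl rt => ->; case: hr => -> rt; apply/andP; split; nra.
have cxi k : continuous (fun y => xi y + k).
  apply: (@lipschitz_continuous _ _ (`|m| * 2)); first by rewrite mulr_ge0.
  move=> x y; rewrite (_ : _ - _ = m * (clamp x1 x2 y - clamp x1 x2 x)); last by rewrite /xi; ring.
  by rewrite normrM -mulrA ler_wpM2l// clamp_lipschitz.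
have xid y : xi d - xi y = m * (x2 - clamp x1 x2 y).
  by rewrite /xi (clampr x12w x2d); ring.
have tl x y : x <= x1 -> y <= x1 -> tent r p x0 x1 x2 1 y - tent r p x0 x1 x2 1 x = (p - 1) * (y - x).
  move=> h1 h2; rewrite /tent !(max_idPr (_ : 0 <= x1 - _)) ?subr_ge0//.
  rewrite !(max_idPl (_ : _ - x2 <= 0)) ?subr_le0 ?(le_trans h1) ?(le_trans h2)//.
  ring.
have tm x y : x1 <= x -> x <= x2 -> x1 <= y -> y <= x2 ->
    tent r p x0 x1 x2 1 y - tent r p x0 x1 x2 1 x = p * (y - x).
  move=> h1 h2 h3 h4; rewrite /tent !(max_idPl (_ : x1 - _ <= 0)) ?subr_le0//.
  rewrite !(max_idPl (_ : _ - x2 <= 0)) ?subr_le0//.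
  ring.
have tr x y : x2 <= x -> x2 <= y -> tent r p x0 x1 x2 1 y - tent r p x0 x1 x2 1 x = (p + 1) * (y - x).
  move=> h1 h2; rewrite /tent !(max_idPl (_ : x1 - _ <= 0)) ?subr_le0 ?(le_trans x12w)//.
  rewrite !(max_idPr (_ : 0 <= _ - x2)) ?subr_ge0//.
  ring.
pose kxi x := m * \1_(`]x1, x2]%classic : set MR) x.
have [ik _] := clamp_integral m x12w x2d cd.
have ikx : leb.-integrable `]c, d] (EFin \o kxi).
  by apply: integrable_itvS ik; exact: subset_itv_oc_cc.
have ks x : c < x <= d -> kxi x <= s.
  move=> /andP[cx xd]; rewrite /kxi indicE.
  have [xin|xout] := boolP (x \in (`]x1, x2]%classic : set MR)); first by rewrite mulr1.
  rewrite mulr0; case: hs => [//|[e1 e2]]; exfalso; move: xout.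
  by rewrite notin_setE/= in_itv/= e1 e2 cx xd.
have fin (xip xim' : R -> R) : (forall y, xip y + xim' y = xi y) ->
    forall y, c < y <= d -> (xip d + xim' d) - (xip y + xim' y) =
      \int[leb]_(x in `[y, d]) kxi x.
  move=> e y /andP[_ yd]; rewrite !e xid.
  by have [_ <-] := clamp_integral m x12w x2d yd.
exists x1, x2, (`|p| + 1 + 1).
case: hp => pE.
  exists (cst 1), (fun y => xi y + - 1), kxi; split => //.
  - by split; [rewrite !addr_ge0|exact: tent_lipschitz].
  - split.
    + case: hl1 => [hl1|->]; last by split; exact: half_slope_point.
      apply: (@affine_piece _ _ _ (p - 1)) => [x y cx xy yx|z /andP[_ zx]|z /andP[_ zx]].
      * by apply: tl => //; exact: le_trans yx.
      * by apply: Or31; split => //; rewrite pE; lra.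
      * by apply: Or32; rewrite xil// pE hl1; split; lra.
    + apply: (@affine_piece _ _ _ p) => [x y cx xy yx|z /andP[/ltW xz zx]|z /andP[/ltW xz zx]].
      * by apply: tm => //; [exact: le_trans yx|exact: le_trans xy].
      * by apply: Or31; split => //; rewrite pE; lra.
      * by apply: Or33; split; [rewrite pE subrr|rewrite -[X in _ + - X]pE; exact: xim].
    + case: hr1 => [hr1|->]; last by split; exact: half_slope_point.
      apply: (@affine_piece _ _ _ (p + 1)) => [x y cx xy yx|z /andP[/ltW xz _]|z /andP[/ltW xz _]].
      * by apply: tr => //; exact: le_trans xy.
      * by apply: Or31; split => //; rewrite pE; lra.
      * by apply: Or31; rewrite xir// pE hr1; split; lra.
  - by split => //; exact: cst_continuous.
  - by split => //; apply: fin => y; rewrite /=; ring.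
exists (fun y => xi y + 1), (cst (- 1)), kxi; split => //.
- by split; [rewrite !addr_ge0|exact: tent_lipschitz].
- split.
  + case: hl1 => [hl1|->]; last by split; exact: half_slope_point.
    apply: (@affine_piece _ _ _ (p - 1)) => [x y cx xy yx|z /andP[_ zx]|z /andP[_ zx]].
    * by apply: tl => //; exact: le_trans yx.
    * by apply: Or32; rewrite xil// pE hl1; split; lra.
    * by apply: Or32; split => //; rewrite pE; lra.
  + apply: (@affine_piece _ _ _ p) => [x y cx xy yx|z /andP[/ltW xz zx]|z /andP[/ltW xz zx]].
    * by apply: tm => //; [exact: le_trans yx|exact: le_trans xy].
    * by apply: Or33; split; [rewrite pE addNr|rewrite -[X in _ + X]opprK -pE; exact: xim].
    * by apply: Or32; split => //; rewrite pE; lra.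
  + case: hr1 => [hr1|->]; last by split; exact: half_slope_point.
    apply: (@affine_piece _ _ _ (p + 1)) => [x y cx xy yx|z /andP[/ltW xz _]|z /andP[/ltW xz _]].
    * by apply: tr => //; exact: le_trans xy.
    * by apply: Or31; rewrite xir// pE hr1; split; lra.
    * by apply: Or32; split => //; rewrite pE; lra.
- by split => //; exact: cst_continuous.
- by split => //; apply: fin => y; rewrite /=; ring.
Qed.

(** Widening a facet with both transition numbers -1 raises its value [-2 / L]; the strict
    inequality leaves room for a small widening. *)
Lemma small_widening (L s : R) : 0 < L -> - 2 / L < s ->
  exists2 r1, 0 < r1 & forall r, 0 < r -> r <= r1 -> - 2 / (L + r + r) <= s.
Proof.
move=> L0; rewrite ltr_pdivrMr// => h; have [s0|s0] := leP 0 s.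
  exists 1 => // r r0 _; rewrite (le_trans _ s0)// mulNr oppr_le0 divr_ge0//; lra.
have s1 : 0 < - s by rewrite oppr_gt0.
(* The solution of [-2 / (L + 2 r) = s]. *)
exists ((2 / (- s) - L) / 2) => [|r r0 rr].
  by rewrite divr_gt0// subr_gt0 ltr_pdivlMr//; lra.
rewrite ler_pdivrMr; last by lra.
have : L + r + r <= 2 / (- s) by lra.
by rewrite ler_pdivlMr//; lra.
Qed.

Lemma facet_margin (al be c0 c1 c2 d0 d1 d2 ra rb rs : R) :
  c0 < al -> c1 < al -> c2 < al -> be < d0 -> be < d1 -> be < d2 ->
  0 < ra -> 0 < rb -> 0 < rs -> exists2 r, 0 < r & [/\ r <= ra, r <= rb, r <= rs &
    forall x, al - r <= x -> x <= be + r ->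
      [/\ x \in `]c0, d0[, x \in `]c1, d1[ & x \in `]c2, d2[]].
Proof.
move=> c0a c1a c2a bd0 bd1 bd2 ra0 rb0 rs0.
pose r1 := Num.min (al - c0) (Num.min (al - c1) (al - c2)).
pose r2 := Num.min (d0 - be) (Num.min (d1 - be) (d2 - be)).
pose r := Num.min (r1 / 2) (Num.min (r2 / 2) (Num.min ra (Num.min rb rs))).
have r10 : 0 < r1 by rewrite !lt_min !subr_gt0 c0a c1a c2a.
have r20 : 0 < r2 by rewrite !lt_min !subr_gt0 bd0 bd1 bd2.
have hr1 : r < r1.
  by rewrite (le_lt_trans (_ : r <= r1 / 2)) ?ge_min ?lexx// ltr_pdivrMr// ltr_pMr// ltr1n.
have hr2 : r < r2.
  by rewrite (le_lt_trans (_ : r <= r2 / 2)) ?ge_min ?lexx ?orbT// ltr_pdivrMr// ltr_pMr// ltr1n.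
move: (hr1) (hr2); rewrite !lt_min !ltrBrDr => /and3P[a0 a1 a2] /and3P[b0 b1 b2].
exists r; first by rewrite !lt_min !divr_gt0// ra0 rb0.
split; [by rewrite !ge_min lexx ?orbT..|move=> x rx xr].
have lo c : r + c < al -> c < x by move=> h; rewrite (lt_le_trans _ rx)// ltrBrDl.
have up d : r + be < d -> x < d by move=> h; rewrite (le_lt_trans xr)// addrC.
by split; rewrite in_itv/= ?lo ?up.
Qed.

(** On a side with transition number 1 the tent leaves the line at the end of the facet with excess
    slope 1 and overtakes [h], which is tangent to the line there. On a side with number -1, [h] is
    strictly below the line just outside the facet, so the line itself is continued to the end of
    the interval. *)
Lemma facet_barrier (a b : R) (h : R -> R) (p xh al be chil chir s : R) :
  derivable h al 1 -> derivable h be 1 -> p = 1 \/ p = - 1 ->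
  facet a b h p xh al be -> transition_left a b h p xh al be chil ->
  transition_right a b h p xh al be chir -> (chil + chir) / (be - al) < s ->
  exists c d w, [/\ a < c < xh, xh < d < b, static_supersolution c d s w,
    h c < w c /\ h d < w d & w xh = h xh /\ forall x, c <= x <= d -> h x <= w x].
Proof.
move=> dal dbe hp [[aal beb] ab xab hE [c0 [d0 [/andP[ac0 c0al] /andP[bed0 d0b] hne]]]] hl hr Ls.
have sl := transition_left_sign hl; have sr := transition_right_sign hr.
move: hl hr => [c1 [d1 [/andP[_ c1al] /andP[bed1 _] hl]]] [c2 [d2 [/andP[_ c2al] /andP[bed2 _] hr]]].
move: (xab); rewrite in_itv/= => /andP[axh xhb].
have ba0 : 0 < be - al by rewrite subr_gt0.
pose L x := ell h p xh x.
have LE x y : L y = L x + p * (y - x) by rewrite /L /ell; ring.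
have hL x : al <= x <= be -> h x = L x by move=> xx; apply: hE; rewrite in_itv.
have dline x0 : al <= x0 <= be -> derivable h x0 1 -> (h^`())%classic x0 = p.
  move=> x0ab dx; apply: (@facet_derive1 _ h p x0 al be) => //.
  move=> x xx; rewrite hE// -/(L x) (LE x0) /ell -hL//; ring.
have hal := dline al _ dal; have hbe := dline be _ dbe.
have n11 : (-1 : R) == 1 = false by apply/eqP => e; lra.
(* An upper cone of opening [1/2] around the tangent lies strictly under the excess slope 1 of the
   tent. *)
have half0 : 0 < 2^-1 :> R by rewrite invr_gt0.
have [ra ra0 hra] : exists2 r, 0 < r & forall x, al - r <= x -> x < al -> h x < L x + (al - x).
  have [r r0 hr0] := near_interval (derivable_upper_cone dal half0); exists r => // x rx xa.
  have xr : x <= al + r by rewrite (le_trans (ltW xa))// lerDl ltW.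
  have := hr0 x; rewrite rx xr => /(_ isT).
  rewrite hal ?lexx ?(ltW ab)// (hL al) ?lexx ?(ltW ab)// -LE ltr0_norm ?subr_lt0// => h1.
  by apply: (le_lt_trans h1); rewrite ltrD2l opprB gtr_pMl ?subr_gt0// invf_lt1 ?ltr1n.
have [rb rb0 hrb] : exists2 r, 0 < r & forall x, x <= be + r -> be < x -> h x < L x + (x - be).
  have [r r0 hr0] := near_interval (derivable_upper_cone dbe half0); exists r => // x rx xa.
  have xr : be - r <= x by rewrite (le_trans _ (ltW xa))// gerBl ltW.
  have := hr0 x; rewrite rx xr => /(_ isT).
  rewrite hbe ?lexx ?(ltW ab)// (hL be) ?lexx ?(ltW ab)// -LE gtr0_norm ?subr_gt0// => h1.
  by apply: (le_lt_trans h1); rewrite ltrD2l gtr_pMl ?subr_gt0// invf_lt1 ?ltr1n.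
(* Only with both numbers -1 does widening alter the slope of the selection; with opposite numbers
   that slope is 0 for every length, and with both equal to 1 nothing is widened. *)
have [rs rs0 hrs] : exists2 r1, 0 < r1 & chil = - 1 -> chir = - 1 ->
    forall r, 0 < r -> r <= r1 -> - 2 / (be - al + r + r) <= s.
  have [/andP[/eqP e1 /eqP e2]|] := boolP ((chil == -1) && (chir == -1)).
    have [|r1 r10 hr1] := @small_widening (be - al) s ba0; last by exists r1.
    by move: Ls; rewrite e1 e2; congr (_ / _ < _); ring.
  by move=> hn; exists 1 => // e1 e2; move: hn; rewrite e1 e2 eqxx.
have [r r0 [ra' rb' rs' rin]] := facet_margin c0al c1al c2al bed0 bed1 bed2 ra0 rb0 rs0.
have ala : al - ra <= al - r by rewrite lerB.
have beb' : be + r <= be + rb by rewrite lerD2l.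
pose c := al - r; pose d := be + r.
have ca : c < al by rewrite /c ltrBlDr ltrDl.
have bd : be < d by rewrite /d ltrDl.
pose x1 := if chil == 1 then al else c; pose x2 := if chir == 1 then be else d.
pose w := tent (h xh) p xh x1 x2 1.
have x1b : c <= x1 /\ x1 <= al by rewrite /x1; case: ifP => _; rewrite lexx (ltW ca).
have x2b : be <= x2 /\ x2 <= d by rewrite /x2; case: ifP => _; rewrite lexx (ltW bd).
have wE x : w x = L x + Num.max 0 (x1 - x) + Num.max 0 (x - x2).
  by rewrite /w /tent /L /ell !mul1r [h xh + _]addrC.
have mge0 (x : R) : 0 <= Num.max 0 x by rewrite le_max lexx.
have outl x : c <= x -> x < al -> h x < w x.
  move=> cx xa; rewrite wE.
  suff h1 : h x < L x + Num.max 0 (x1 - x) by apply: (lt_le_trans h1); rewrite lerDl.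
  case: sl => e.
    rewrite /x1 e eqxx (max_idPr _) ?subr_ge0 ?ltW//.
    by apply: hra => //; exact: le_trans cx.
  apply: (@lt_le_trans _ _ (L x)); last by rewrite lerDl.
  rewrite lt_neqAle; apply/andP; split.
    apply/eqP; apply: hne; first by have [] := rin x cx (le_trans (ltW xa) (ltW (lt_trans ab bd))).
    by rewrite in_itv/= leNgt xa.
  case: hl => -[e2 hl]; first by move: e n11; rewrite e2 => <-; rewrite eqxx.
  apply: hl; last exact: le_trans (ltW xa) axh.
  by have [] := rin x cx (le_trans (ltW xa) (ltW (lt_trans ab bd))).
have outr x : x <= d -> be < x -> h x < w x.
  move=> xd bx; rewrite wE.
  suff h1 : h x < L x + Num.max 0 (x - x2).
    by apply: (lt_le_trans h1); rewrite lerD2r lerDl.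
  case: sr => e.
    rewrite /x2 e eqxx (max_idPr _) ?subr_ge0 ?ltW//.
    by apply: hrb => //; exact: le_trans beb'.
  apply: (@lt_le_trans _ _ (L x)); last by rewrite lerDl.
  rewrite lt_neqAle; apply/andP; split.
    apply/eqP; apply: hne; first by have [] := rin x (ltW (lt_trans (lt_trans ca ab) bx)) xd.
    by rewrite in_itv/= [x <= be]leNgt bx andbF.
  case: hr => -[e2 hr]; first by move: e n11; rewrite e2 => <-; rewrite eqxx.
  apply: hr; last exact: le_trans xhb (ltW bx).
  by have [] := rin x (ltW (lt_trans (lt_trans ca ab) bx)) xd.
have wL x : al <= x <= be -> w x = L x.
  move=> /andP[ax xb]; have [_ x1a] := x1b; have [bx2 _] := x2b.
  by rewrite wE !(max_idPl _) ?addr0// subr_le0; [exact: le_trans bx2|exact: le_trans ax].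
exists c, d, w; split.
- rewrite (lt_le_trans ca axh) andbT; have [] := rin c (lexx _) (ltW (lt_trans (lt_trans ca ab) bd)).
  by rewrite in_itv/= => /andP[h1 _] _ _; exact: le_lt_trans h1.
- rewrite (le_lt_trans xhb bd) /=; have [] := rin d (ltW (lt_trans (lt_trans ca ab) bd)) (lexx _).
  by rewrite in_itv/= => /andP[_ h1] _ _; exact: lt_le_trans d0b.
- have [x11 x12] := x1b; have [x21 x22] := x2b.
  apply: (@facet_supersolution p chil chir c x1 x2 d _ _ s ((chil + chir) / (x2 - x1))) => //.
  + by apply: (le_lt_trans x12); exact: (lt_le_trans ab).
  + by case: sl => e; [left|right; rewrite /x1 e n11].
  + by case: sr => e; [left|right; rewrite /x2 e n11].
  + rewrite /x1 /x2; case: sl Ls hrs => ->; case: sr => -> Ls hrs; rewrite ?eqxx ?n11.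
    * exact: ltW.
    * by move: Ls; rewrite subrr !mul0r => /ltW.
    * by move: Ls; rewrite addNr !mul0r => /ltW.
    * have := hrs erefl erefl r r0 rs'; congr (_ / _ <= _); rewrite /c /d; ring.
  + case: sl Ls => e1; case: sr => e2; rewrite e1 e2 => Ls.
    * by left; apply: ltW; apply: le_lt_trans Ls; rewrite divr_ge0// ltW.
    * by left; apply: ltW; move: Ls; rewrite subrr mul0r.
    * by left; apply: ltW; move: Ls; rewrite addNr mul0r.
    * by right; rewrite /x1 /x2 e1 e2 n11.
- by split; [apply: outl|apply: outr].
- have wx x : al <= x <= be -> h x = w x by move=> xx; rewrite wL// hL.
  split; first by rewrite wx// axh.
  move=> x /andP[cx xd]; have [xa|ax] := ltP x al; first exact/ltW/outl.
  by have [bx|xb] := ltP be x; [exact/ltW/outr|rewrite wx// ax].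
Qed.

End Barriers.

(** * Viscosity inequalities *)

Section TouchingFromAbove.
Context {R : realType}.
Local Notation MR := (measurableTypeR R).

Lemma upper_barrier (a b : R) (h : R -> R) (xh s : R) : a < xh < b ->
  (forall x, a < x < b -> derivable h x 1 /\ {for x, continuous (h^`())%classic}) ->
  (forall p, p = 1 \/ p = - 1 -> (h^`())%classic xh = p ->
     exists al be, facet a b h p xh al be) ->
  Lambda_W a b h xh < s ->
  exists c d w, [/\ a < c < xh, xh < d < b, static_supersolution c d s w,
    h c < w c /\ h d < w d & w xh = h xh /\ forall x, c <= x <= d -> h x <= w x].
Proof.
move=> xab dh hfac Ls; have [dxh cxh] := dh _ xab.
have [[p [hp hpx]]|nfac] := pselect (exists p, (p = 1 \/ p = - 1) /\ (h^`())%classic xh = p).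
  have [al [be hf]] := hfac p hp hpx.
  have [|[chil hl] [chir hr]] := transition_exists _ hf.
    by move=> x /dh[dx _]; apply: differentiable_continuous; apply/derivable1_diffP.
  have [[aal beb] ab _ _ _] := hf.
  apply: (facet_barrier _ _ hp hf hl hr).
  - by have [] := dh al; rewrite ?aal ?(lt_trans ab).
  - by have [] := dh be; rewrite ?beb ?(lt_trans aal).
  - by rewrite -(Lambda_W_facet dxh hp hf hl hr).
have n1 : (h^`())%classic xh <> 1 by move=> e; apply: nfac; exists 1; split => //; left.
have n2 : (h^`())%classic xh <> - 1 by move=> e; apply: nfac; exists (-1); split => //; right.
by apply: nonfacet_barrier => //; rewrite -(Lambda_W_nonfacet a b dxh cxh n1 n2).
Qed.

(** Just before [th] a function with [g'(th) > s] is strictly below the line of slope [s] through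
    its value at [th]: this gives the initial gap. Continuity bounds the excess on the whole
    window. *)
Lemma time_window (g : R -> R) (T th s eta : R) : 0 < th < T -> derivable g th 1 ->
  s < (g^`())%classic th -> 0 < eta -> exists t0 t1, [/\ 0 < t0 < th, th < t1 < T,
    g t0 - g th - s * (t0 - th) < 0 &
    forall t, t0 <= t <= t1 -> g t - g th - s * (t - th) <= eta].
Proof.
move=> /andP[th0 thT] dg sg eta0.
have cg : {for th, continuous (fun t => g t - g th - s * (t - th))}.
  apply: cvgB; first by apply: cvgB; [apply: differentiable_continuous; apply/derivable1_diffP|exact: cvg_cst].
  by apply: cvgM; [exact: cvg_cst|apply: cvgB; [exact: cvg_id|exact: cvg_cst]].
have near1 : \forall t \near th, g t - g th - s * (t - th) <= eta.
  move/cvgrPdist_lt : cg => /(_ _ eta0); apply: filterS => t.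
  by rewrite !subrr mulr0 subr0 sub0r normrN => /ltW; apply: le_trans; exact: ler_norm.
have near2 : \forall t \near th, t < th -> g t - g th - s * (t - th) < 0.
  have e0 : 0 < (g^`())%classic th - s by rewrite subr_gt0.
  have /cvgrPdist_lt/(_ _ e0) := derivable_slope dg.
  rewrite /dnbhs near_withinE; apply: filterS => t ht tth.
  have := ht (negbT (lt_eqF tth)); rewrite ltr_norml => /andP[_].
  rewrite ltrD2l ltrN2 ltr_ndivlMr ?subr_lt0//.
have [r r0 hr] := near_interval (filterI near1 near2).
have m1 : 0 < Num.min r (th / 2) by rewrite lt_min r0 divr_gt0.
have m2 : 0 < Num.min r ((T - th) / 2) by rewrite lt_min r0 divr_gt0// subr_gt0.
have m3 : Num.min r (th / 2) <= r by rewrite ge_min lexx.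
have m4 : Num.min r ((T - th) / 2) <= r by rewrite ge_min lexx.
have m5 : Num.min r (th / 2) <= th / 2 by rewrite ge_min lexx orbT.
have m6 : Num.min r ((T - th) / 2) <= (T - th) / 2 by rewrite ge_min lexx orbT.
exists (th - Num.min r (th / 2)), (th + Num.min r ((T - th) / 2)); split.
- by apply/andP; split; lra.
- by apply/andP; split; lra.
- have [|_] := hr (th - Num.min r (th / 2)); first by apply/andP; split; lra.
  by apply; rewrite ltrBlDr ltrDl.
- move=> t /andP[h1 h2]; have [|h3 _] // := hr t; apply/andP; split; lra.
Qed.

Lemma contact_arith (hx gt s m ep e t wy uy : R) : 0 < ep -> 0 < e -> e <= ep / 4 ->
  `|s| * e <= ep / 4 -> `|t| < e -> wy < hx + ep / 4 -> hx + gt + m - e < uy ->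
  uy <= wy + gt + s * t + m - ep -> False.
Proof.
move=> ep0 e0 e1 e2 te h1 h2 h3.
have : s * t <= ep / 4.
  apply: le_trans e2; apply: (le_trans (ler_norm _)); rewrite normrM.
  by apply: ler_wpM2l => //; exact: ltW.
lra.
Qed.

Lemma touching_inequality dom (a b T : R) (u : R -> R -> R) (h g : R -> R) (m xh th : R) :
  interior_solution dom a b T u -> a < xh < b -> 0 < th < T ->
  (forall x, a < x < b -> derivable h x 1 /\ {for x, continuous (h^`())%classic}) ->
  (forall p, p = 1 \/ p = - 1 -> (h^`())%classic xh = p ->
     exists al be, facet a b h p xh al be) ->
  derivable g th 1 ->
  (forall x t, a < x < b -> 0 < t < T -> u x t <= h x + g t + m) ->
  (forall e, 0 < e -> exists y t,
     [/\ `|y - xh| < e, `|t - th| < e & h xh + g th + m - e < u y t]) ->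
  (g^`())%classic th <= Lambda_W a b h xh.
Proof.
move=> hu xab tT dh hfac dg ub hsup; rewrite leNgt; apply/negP => lt.
pose s := (Lambda_W a b h xh + (g^`())%classic th) / 2.
have [s1 s2] : Lambda_W a b h xh < s /\ s < (g^`())%classic th by rewrite /s; split; lra.
have [c [d [w [/andP[ac cx] /andP[xd db] hw [hc hd] [wx hw2]]]]] := upper_barrier xab dh hfac s1.
(* Half of the smaller lateral gap: one half pays for the excess of [g] over the line of slope [s],
   the other for lowering the barrier by [ep]. *)
pose eta := Num.min (w c - h c) (w d - h d) / 2.
have mn0 : 0 < Num.min (w c - h c) (w d - h d) by rewrite lt_min !subr_gt0 hc hd.
have eta0 : 0 < eta by rewrite divr_gt0.
have [t0 [t1 [/andP[t00 t0h] /andP[ht1 t1T] g0 gle]]] := time_window tT dg s2 eta0.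
pose ep := Num.min (- (g t0 - g th - s * (t0 - th))) eta.
have ep0 : 0 < ep by rewrite lt_min oppr_gt0 g0 eta0.
have ep1 : ep <= - (g t0 - g th - s * (t0 - th)) by rewrite ge_min lexx.
have ep2 : ep <= eta by rewrite ge_min lexx orbT.
have etac : eta + eta <= w c - h c.
  by rewrite /eta -splitr ge_min lexx.
have etad : eta + eta <= w d - h d.
  by rewrite /eta -splitr ge_min lexx orbT.
pose k := g th - s * th + m - ep.
have hwk := static_supersolution_shift k hw.
have cd : c < d by rewrite (lt_trans cx).
have t01 : t0 < t1 by rewrite (lt_trans t0h).
have inT t : t0 <= t <= t1 -> 0 < t < T.
  by move=> /andP[h1 h2]; rewrite (lt_le_trans t00 h1) (le_lt_trans h2 t1T).
have [_ _ bl _] := hu.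
have lateral y t : a < y < b -> h y + eta + eta <= w y -> t0 <= t <= t1 ->
    lim (u z t @[z --> y^'+]) <= w y + k + s * t.
  move=> yab yw tI; have tT' := inT t tI.
  have tcc : t \in `[0, T] by rewrite in_itv/=; case/andP: tT' => /ltW -> /ltW ->.
  have cvu := right_limitP (bl t tcc) yab.
  have chy : h z @[z --> y^'+] --> h y.
    apply: cvg_at_right_filter; have [dy _] := dh y yab.
    by apply: differentiable_continuous; apply/derivable1_diffP.
  have cvr : h z + g t + m @[z --> y^'+] --> h y + g t + m.
    by apply: cvgD; [apply: cvgD => //; exact: cvg_cst|exact: cvg_cst].
  apply: (@le_trans _ _ (h y + g t + m)).
    rewrite -(cvg_lim (@Rhausdorff R) cvr); apply: ler_lim.
    - by apply/cvg_ex; eexists; exact: cvu.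
    - by apply/cvg_ex; eexists; exact: cvr.
    - case/andP : (yab) => ay yb; near=> z; apply: ub => //; apply/andP; split.
        by rewrite (lt_trans ay)//; near: z; exact: nbhs_right_gt.
      by near: z; exact: nbhs_right_lt.
  have := gle t tI; rewrite /k; move: yw ep2; clear; lra.
have init x : c < x < d -> u x t0 <= w x + k + s * t0.
  move=> /andP[cx0 xd0].
  have h1 : u x t0 <= h x + g t0 + m.
    by apply: ub; rewrite ?(lt_trans ac)// ?(lt_trans xd0)// (lt_trans t01) ?t00.
  have h2 : h x <= w x by apply: hw2; rewrite !ltW.
  by move: h1 h2 ep1; rewrite /k; clear; lra.
have lc : h c + eta + eta <= w c by move: etac; clear; lra.
have ld : h d + eta + eta <= w d by move: etad; clear; lra.
have cab : a < c < b by rewrite ac (lt_trans cd).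
have dab : a < d < b by rewrite db (lt_trans ac).
have comp := solution_comparison hu ac cd db t00 t01 t1T hwk init
  (fun t tI => lateral c t cab lc tI) (fun t tI => lateral d t dab ld tI).
have ep40 : 0 < ep / 4 by rewrite divr_gt0.
have [r r0 hr] : exists2 r, 0 < r & forall y, xh - r <= y <= xh + r -> w y < h xh + ep / 4.
  apply: near_interval; have := @static_supersolution_continuous _ _ _ _ _ hw xh.
  move/cvgrPdist_lt => /(_ _ ep40); apply: filterS => y.
  by rewrite wx distrC ltr_norml ltrBlDl => /andP[_].
have s10 : 0 < `|s| + 1 by rewrite ltr_wpDl.
(* The variation of [w], the time term [s (t - th)] and the defect of contact each cost at most
   [ep / 4], less than the [ep] by which the barrier was lowered. The remaining bounds keep the
   point in the rectangle. *)
pose e := Num.min (Num.min r (Num.min (ep / 4) (ep / 4 / (`|s| + 1))))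
  (Num.min (Num.min (xh - c) (d - xh)) (Num.min (th - t0) (t1 - th))).
have e0 : 0 < e by rewrite !lt_min r0 ep40 divr_gt0// !subr_gt0 cx xd t0h ht1.
have [er e4 es] : [/\ e <= r, e <= ep / 4 & e <= ep / 4 / (`|s| + 1)].
  by rewrite /e; split; rewrite !ge_min lexx ?orbT.
have [ec ed et0 et1] : [/\ e <= xh - c, e <= d - xh, e <= th - t0 & e <= t1 - th].
  by rewrite /e; split; rewrite !ge_min lexx ?orbT.
have [y [t [ye te hut]]] := hsup e e0.
move: (ye) (te); rewrite !ltr_norml => /andP[y1 y2] /andP[t2 t3].
have ycd : c < y < d by move: y1 y2 ec ed; clear; move=> *; apply/andP; split; lra.
have tI : t0 <= t <= t1 by move: t2 t3 et0 et1; clear; move=> *; apply/andP; split; lra.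
have wy : w y < h xh + ep / 4.
  by apply: hr; move: y1 y2 er; clear; move=> *; apply/andP; split; lra.
apply: (@contact_arith (h xh) (g th) s m ep e (t - th) (w y) (u y t)) => //.
- move: es; rewrite ler_pdivlMr// => es; apply: le_trans es.
  by rewrite mulrC ler_pM2l// lerDl.
- apply: (le_trans (comp y t ycd tI)); rewrite le_eqVlt; apply/orP; left; apply/eqP.
  by rewrite /k; ring.
Unshelve. all: by end_near. Qed.

End TouchingFromAbove.

(** * Boundedness of solutions *)

Section SupBound.
Context {R : realType}.
Local Notation MR := (measurableTypeR R).

(** The oscillation of the right-limit representative is at most the total variation, and the mean
    of [|v|] is at most [M0 / (b - a)]. *)
Lemma BV_ae_bound dom (a b M0 : R) (v : R -> R) nu : a < b ->
  BV_deriv dom a b v nu -> between_limits a b v -> (BV_norm dom a b v nu <= M0%:E)%E ->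
  {ae leb, forall x, x \in `]a, b[ -> `|v x| <= M0 / (b - a) + M0}.
Proof.
move=> ab hv bl hM; have [iv _] := hv.
have ba0 : 0 < b - a by rewrite subr_gt0.
have mab : measurable (`]a, b[%classic : set MR) by exact: measurable_itv.
have mC := measurable_carrier dom a b.
pose U y := lim (v z @[z --> y^'+]).
have vU := right_limitP bl.
pose I := \int[leb]_(x in `]a, b[) `|v x|.
have [I0 tv0 IM] : [/\ 0 <= I, 0 <= tv nu (carrier dom a b) & I + tv nu (carrier dom a b) <= M0].
  split; [exact: Rintegral_ge0|exact: tv_ge0|].
  move: hM; rewrite /BV_norm abs_chargeE//.
  have -> : (\int[leb]_(x in `]a, b[) `|v x|%:E = I%:E)%E.
    rewrite /I /Rintegral fineK//; apply: integrable_fin_num => //.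
    exact: (integrable_norm iv).
  by rewrite -EFinD lee_fin.
have osc x y : a < x -> x < y -> y < b -> `|U y - U x| <= tv nu (carrier dom a b).
  move=> ax xy yb.
  rewrite -(BV_deriv_increment hv ax xy yb (vU x _) (vU y _)); last 2 first.
  - by rewrite ax (lt_trans xy).
  - by rewrite yb (lt_trans ax).
  have mxy : measurable (`]x, y]%classic : set MR) by exact: measurable_itv.
  apply: (le_trans (tv_rc _ mxy)).
  have sub : `]x, y]%classic `<=` carrier dom a b.
    move=> z /=; rewrite in_itv/= => /andP[xz zy]; apply: itv_carrier.
    by rewrite (lt_trans ax)//= (le_lt_trans zy).
  have -> : carrier dom a b = (carrier dom a b `\` `]x, y]%classic) `|` `]x, y]%classic.
    by rewrite setUC setDUK.
  rewrite tvU//; [|exact: measurableD|by rewrite setDE -setIA setICl setI0].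
  by rewrite lerDr tv_ge0.
have aeU := right_limit_ae iv vU.
apply: (ae_imp (aeU)) => x vx xab; rewrite vx//.
move: (xab); rewrite in_itv/= => /andP[ax xb].
have i1 (r : R) : leb.-integrable (`]a, b[%classic : set MR) (EFin \o cst r).
  by apply: continuous_integrable_oo => z; exact: cvg_cst.
have : \int[leb]_(y in `]a, b[) (cst (`|U x| - tv nu (carrier dom a b)) y) <= I.
  apply: le_Rintegral_ae => //; first exact: (integrable_norm iv).
  apply: (ae_imp (aeU)) => y vy yab; rewrite /= vy//.
  move: yab; rewrite /= in_itv/= => /andP[ay yb].
  have h : `|U y - U x| <= tv nu (carrier dom a b).
    have [xy|yx|->] := ltgtP x y; [exact: osc|by rewrite distrC osc|by rewrite subrr normr0].
  rewrite lerBlDr (le_trans _ (lerD (lexx _) h))//.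
  by rewrite distrC (le_trans _ (ler_normD _ _))// addrC subrK.
rewrite Rintegral_cst//.
have -> : fine (leb (`]a, b[%classic : set MR)) = b - a.
  by rewrite lebesgue_measure_itv/= lte_fin ab -EFinD.
rewrite -ler_pdivlMr// => h1.
have h2 : I / (b - a) <= M0 / (b - a).
  by rewrite ler_pM2r ?invr_gt0// (le_trans _ IM)// lerDl.
by move: h1 h2 IM I0; clear; rewrite /U; lra.
Qed.

(** The [BV] bound holds only for almost every time. At other times the squared excess over [M] is
    at most the squared [L^2] distance to a nearby good time, so it vanishes by continuity. *)
Lemma interior_solution_bounded dom (a b T : R) (u : R -> R -> R) : a < b ->
  interior_solution dom a b T u -> exists M, forall x t, a < x < b -> 0 < t < T -> u x t <= M.
Proof.
move=> ab [cu [M0 hM] bl _]; pose M := M0 / (b - a) + M0.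
have mab : measurable (`]a, b[%classic : set MR) by exact: measurable_itv.
have abf : (leb (`]a, b[%classic : set MR) < +oo)%E by exact: (@carrier_lty R OpenInterval a b).
exists M => x t xab /andP[t0 tT].
have tcc : t \in `[0, T] by rewrite in_itv/= !ltW.
have [Lt ct] := cu t tcc.
have cM : continuous (cst M : R -> R) by move=> y; exact: cvg_cst.
have LM : L2 leb `]a, b[ (cst M : R -> R) by exact: continuous_L2_itv.
have Lz := (L2_sub mab Lt LM).1; have [_ iz] := (L2P _ _ mab).1 (L2_pos_part mab Lz).
apply: (between_limits_le_ae (lexx a) (lexx b) (bl t tcc) cM); last by rewrite in_itv.
suff z0 : \int[leb]_(y in `]a, b[) (Num.max 0 (u y t - cst M y) ^+ 2) = 0.
  by apply: ae_imp (pos_part_L2_eq0 Lz z0) _ => y hy yab; rewrite -subr_le0 hy.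
apply/eqP; rewrite eq_le; apply/andP; split; last by apply: Rintegral_ge0 => y _; exact: sqr_ge0.
apply/ler_addgt0Pl => e e0; rewrite addr0.
have cd : (\int[leb]_(y in `]a, b[) ((u y s - u y t) ^+ 2))
    @[s --> within `[0, T] (nbhs t)] --> (0 : R) by apply: fine_cvg.
move/cvgrPdist_le : cd => /(_ e e0); rewrite near_withinE => /nbhs_ballP[r /= r0 hr].
have rT : t < Num.min (t + r) T by rewrite lt_min ltrDl r0 tT.
have [s /andP[ts sr] hs] := ae_exists_itv hM rT.
move: sr; rewrite lt_min => /andP[sr sT].
have soo : s \in `]0, T[ by rewrite in_itv/= sT (lt_trans t0).
have scc : s \in `[0, T] by rewrite in_itv/= !ltW// (lt_trans t0).
have [nu hnu hbn] := hs soo; have aeb := BV_ae_bound ab hnu (bl s scc) hbn.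
have Ls := (cu s scc).1; have [_ ids] := (L2P _ _ mab).1 (L2_sub mab Ls Lt).1.
apply: (@le_trans _ _ (\int[leb]_(y in `]a, b[) ((u y s - u y t) ^+ 2))).
  apply: le_Rintegral_ae => //; apply: ae_imp aeb _ => y hy yab.
  have uM : u y s <= M by apply: (le_trans (ler_norm _)); exact: hy.
  case: (leP 0 (u y t - cst M y)) => [h1|_]; last by rewrite expr0n sqr_ge0.
  rewrite -[leRHS]sqrrN opprB lerXn2r ?nnegrE//; rewrite /= in h1 *; move: h1 uM; clear; lra.
have := hr s; rewrite /ball/= sub0r normrN => /(_ _ scc).
rewrite ler0_norm ?subr_le0 ?(ltW ts)// opprB => /(_ _) h.
by apply: (le_trans (ler_norm _)); apply: h; move: sr; clear; lra.
Qed.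

End SupBound.

(** * Invariance of the problem under change of sign *)

Section Negation.
Context {R : realType}.
Local Notation MR := (measurableTypeR R).

(* Junk values agree as well, since [fine] sends both infinities to [0]. *)
Lemma RintegralN d (X : measurableType d) (mu : {measure set X -> \bar R}) (D : set X)
    (f : X -> R) : \int[mu]_(x in D) (- f x) = - \int[mu]_(x in D) f x.
Proof.
rewrite /Rintegral [in LHS]integralE [in RHS]integralE.
have -> : (fun x => (- f x)%:E)^\+%E = (fun x => (f x)%:E)^\-%E.
  by rewrite -funeposN; congr (_^\+)%E; apply/funext => x; rewrite EFinN.
have -> : (fun x => (- f x)%:E)^\-%E = (fun x => (f x)%:E)^\+%E.
  by rewrite -funenegN; congr (_^\-)%E; apply/funext => x; rewrite EFinN.
by case: integral => [x||]; case: integral => [y||] //=; rewrite ?oppr0// opprB.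
Qed.

Lemma BV_deriv_opp dom (a b : R) (v : R -> R) nu :
  BV_deriv dom a b v nu -> BV_deriv dom a b (fun x => - v x) (copp nu).
Proof.
move=> [iv hv]; split.
  have h : leb.-integrable `]a, b[ (EFin \o (fun x => -1 * v x)) by exact: integrableRZl.
  by apply: eq_integrable h => // x _; rewrite /= mulN1r.
move=> phi tphi; have [sphi _] := tphi.
have cphi := smooth_continuous sphi; have [M hM] := continuous_itv_bound a b cphi.
have mC := measurable_carrier dom a b.
rewrite (@charge_integralN _ _ nu _ _ M)//.
- rewrite -hv// -RintegralN; apply: eq_Rintegral => x _; ring.
- by move=> A mA; rewrite rc_opp.
- exact: measurable_continuous.
- by move=> x /carrier_itv; rewrite in_itv/= => /andP[ax xb]; apply: hM; rewrite ax ltW.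
Qed.

Lemma BV_norm_opp dom (a b : R) (v : R -> R) nu :
  BV_norm dom a b (fun x => - v x) (copp nu) = BV_norm dom a b v nu.
Proof.
have mC := measurable_carrier dom a b.
rewrite /BV_norm !abs_chargeE//; congr (_ + _%:E)%E.
  by apply: eq_integral => x _; rewrite normrN.
by apply: tv_opp => // A mA _; rewrite rc_opp.
Qed.

(** Negation exchanges the two total variations, since [- nu + dx = - (nu - dx)]. *)
Lemma W_energy_opp dom (a b : R) (nu mu : {charge set MR -> \bar R}) :
  (forall A, measurable A -> rc mu A = - rc nu A) ->
  W_energy dom a b mu = W_energy dom a b nu.
Proof.
move=> munu; have mC := measurable_carrier dom a b.
rewrite !W_energyE [in RHS]addrC; congr (_ + _)%:E; apply: tv_opp => // A mA _;
  rewrite !rc_add// ?rc_opp// munu//; ring.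
Qed.

Lemma carrier_closed_itv dom (a b : R) : carrier dom a b `<=` `[a, b]%classic.
Proof. by move=> z /carrier_itv; exact: subset_itv_co_cc. Qed.

Lemma selection_opp dom (a b : R) (v om : R -> R) : a < b ->
  {within `[a, b], continuous om} -> selection dom a b v om ->
  selection dom a b (fun x => - v x) (fun x => - om x).
Proof.
move=> ab com [mu hmu hsel]; exists (copp mu); first exact: BV_deriv_opp.
move=> v' nu hv'.
have mC := measurable_carrier dom a b.
have mom : measurable_fun (carrier dom a b) om.
  apply: (@measurable_funS _ _ _ _ (`[a, b]%classic : set MR)) => //.
    exact: carrier_closed_itv.
  exact: subspace_continuous_measurable_fun.
have [N hN] : exists N, forall x, carrier dom a b x -> `|om x| <= N.
  have cn : {within `[a, b], continuous (fun x => `|om x|)}.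
    by move=> x; apply: continuous_comp; [exact: com|exact: norm_continuous].
  have [z _ hz] := EVT_max (ltW ab) cn.
  by exists `|om z| => x /carrier_closed_itv; exact: hz.
have := hsel _ _ (BV_deriv_opp hv').
rewrite (@W_energy_opp dom a b nu (copp nu)); last by move=> A mA; rewrite rc_opp.
rewrite -(@W_energy_opp dom a b mu (copp mu)); last by move=> A mA; rewrite rc_opp.
suff -> : charge_integral (cadd (copp nu) (copp mu)) (carrier dom a b) om =
    charge_integral (cadd nu (copp (copp mu))) (carrier dom a b) (fun x => - om x) by [].
rewrite (@charge_integralN _ _ (cadd nu (copp (copp mu))) _ _ N)//.
  by rewrite /charge_integral !RintegralN; ring.
by move=> A mA; rewrite !rc_add// !rc_opp//; ring.
Qed.

Lemma between_limits_opp (a b : R) (v : R -> R) :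
  between_limits a b v -> between_limits a b (fun x => - v x).
Proof.
move=> bl x xab; have [cl cr /andP[h1 h2]] := bl x xab.
have limN (F : set_system R) : ProperFilter F -> cvg (v @ F) ->
    cvg ((fun x => - v x) @ F) /\ lim ((fun x => - v x) @ F) = - lim (v @ F).
  move=> PF cF; have h : (fun x => - v x) @ F --> - lim (v @ F) by exact: cvgN.
  by split; [apply/cvg_ex; eexists; exact: h|exact: (cvg_lim (@Rhausdorff R))].
have [cl' el] := limN _ _ cl; have [cr' er] := limN _ _ cr.
by split => //; rewrite el er -oppr_max -oppr_min !lerN2 h1 h2.
Qed.

Lemma L2_opp d (X : measurableType d) (mu : {measure set X -> \bar R}) (D : set X)
    (f : X -> R) : L2 mu D f -> L2 mu D (fun x => - f x).
Proof.
move=> [mf h]; split; first exact: measurable_funN.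
by under eq_integral do rewrite sqrrN.
Qed.

Lemma W12_opp dom (a b : R) (f g : R -> R) : W12 dom a b f g ->
  W12 dom a b (fun x => - f x) (fun x => - g x).
Proof.
move=> [cf Lf Lg h]; split; [|exact: L2_opp|exact: L2_opp|].
  by move=> x; apply: cvgN; exact: cf.
move=> phi tphi.
have e (k l : R -> R) : \int[leb]_(x in `]a, b[) (- k x * l x) =
    - \int[leb]_(x in `]a, b[) (k x * l x).
  by rewrite -RintegralN; apply: eq_Rintegral => x _; rewrite mulNr.
by rewrite !e h.
Qed.

Lemma interior_solution_opp dom (a b T : R) (u : R -> R -> R) : a < b ->
  interior_solution dom a b T u -> interior_solution dom a b T (fun x t => - u x t).
Proof.
move=> ab [cu [M hM] bl [ut [Om [dut Lut [Omx [LOm LOmx hOm]] hae]]]].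
have e (k l : R -> R) : \int[leb]_(x in `]a, b[) (- k x * l x) =
    - \int[leb]_(x in `]a, b[) (k x * l x).
  by rewrite -RintegralN; apply: eq_Rintegral => x _; rewrite mulNr.
have eT (k l : R -> R) : \int[leb]_(x in `]0, T[) (- k x * l x) =
    - \int[leb]_(x in `]0, T[) (k x * l x).
  by rewrite -RintegralN; apply: eq_Rintegral => x _; rewrite mulNr.
split.
- move=> t /cu[Lt ct]; split; first exact: L2_opp.
  apply: cvg_trans ct; apply: near_eq_cvg; apply: nearW => s.
  by apply: eq_integral => x _; rewrite -[in RHS]sqrrN; congr (_ ^+ 2)%:E; ring.
- exists M; apply: ae_imp hM _ => t h /h[nu h1 h2]; exists (copp nu).
    exact: BV_deriv_opp.
  by rewrite BV_norm_opp.
- by move=> t /bl; exact: between_limits_opp.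
exists (fun x t => - ut x t), (fun x t => - Om x t); split.
- move=> phi g tphi Lg.
  under eq_Rintegral do rewrite e; under [in RHS]eq_Rintegral do rewrite e.
  by rewrite !eT dut.
- exact: L2_opp.
- exists (fun x t => - Omx x t); split; [exact: L2_opp|exact: L2_opp|].
  by apply: ae_imp hOm _ => t h /h; exact: W12_opp.
apply: ae_imp (ae_and hOm hae) _ => t [h1 h2] tT.
have [com _ _ _] := h1 tT; have [h3 h4] := h2 tT; split; last exact: selection_opp.
by move=> phi tphi; rewrite !e h3.
Qed.

End Negation.

(** * Envelopes, test functions and the two viscosity inequalities *)

Section Viscosity.
Context {R : realType}.
Local Notation MR := (measurableTypeR R).

(** The supremum is nondecreasing in the radius, so its limit at [0^+] exists and is the infimum. *)
Lemma usc_envE (a b T : R) (u : R -> R -> R) (x t : R) :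
  usc_env a b T u x t = ereal_inf [set ereal_sup [set (u z.1 z.2)%:E | z in [set z : R * R |
    [/\ `|z.2 - t| < e, `|x - z.1| < e, z.1 \in `]a, b[ & z.2 \in `]0, T[]]] | e in
    [set e : R | 0 < e]].
Proof.
pose S (e : R) := ereal_sup [set (u z.1 z.2)%:E | z in [set z : R * R |
    [/\ `|z.2 - t| < e, `|x - z.1| < e, z.1 \in `]a, b[ & z.2 \in `]0, T[]]].
have ndS : {in Interval (BRight (0 : R)) +oo%O &, nondecreasing_fun S}.
  move=> e1 e2 _ _ e12; apply: ereal_sup_le => _ [z [h1 h2 h3 h4] <-].
  by exists z => //; split => //; exact: lt_le_trans e12.
have -> : [set e : R | 0 < e] = [set` Interval (BRight (0 : R)) +oo%O].
  by apply/seteqP; split => e /=; rewrite in_itv/= andbT.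
apply: (cvg_lim (@ereal_hausdorff R)).
exact: (@nondecreasing_at_right_cvge R S 0 +oo%O isT ndS).
Qed.

Lemma usc_env_le (a b T M : R) (u : R -> R -> R) (x t : R) :
  (forall y s, a < y < b -> 0 < s < T -> u y s <= M) -> (usc_env a b T u x t <= M%:E)%E.
Proof.
move=> uM; rewrite usc_envE; apply: (le_trans (ereal_inf_lbound (ex_intro2 _ _ 1 _ erefl))).
  exact: ltr01.
by apply: ge_ereal_sup => _ [z [_ _ h3 h4] <-]; rewrite lee_fin; apply: uM; rewrite in_itv in h3 h4.
Qed.

Lemma usc_env_ge (a b T : R) (u : R -> R -> R) (x t : R) : a < x < b -> 0 < t < T ->
  ((u x t)%:E <= usc_env a b T u x t)%E.
Proof.
move=> xab tT; rewrite usc_envE; apply: le_ereal_inf_tmp => _ [e /= e0 <-].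
apply: ereal_sup_ubound; exists (x, t) => //=.
by split; rewrite ?subrr ?normr0 ?in_itv.
Qed.

Lemma usc_env_approx (a b T l e : R) (u : R -> R -> R) (x t : R) :
  (l%:E < usc_env a b T u x t)%E -> 0 < e -> exists y s,
  [/\ a < y < b, 0 < s < T, `|y - x| < e, `|s - t| < e & l < u y s].
Proof.
rewrite usc_envE => h e0; have := lt_le_trans h (ereal_inf_lbound (ex_intro2 _ _ e e0 erefl)).
move=> /ereal_sup_gt[_ [[y s] /= [h1 h2 h3 h4] <-]]; rewrite lte_fin => ls.
by exists y, s; split; rewrite // ?in_itv in h3 h4 *; rewrite 1?distrC.
Qed.

Lemma derive1_near (f g : R -> R) (x : R) : (\forall y \near x, f y = g y) ->
  (f^`())%classic x = (g^`())%classic x.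
Proof. by move=> fg; rewrite !derive1E; exact: near_eq_derive. Qed.

Lemma facet_translate (a b k : R) (f h : R -> R) (p x0 al be : R) : a < x0 < b ->
  (forall x, a < x < b -> h x = f x + k) -> facet a b f p x0 al be -> facet a b h p x0 al be.
Proof.
move=> x0ab hE [[aal beb] ab x0in fE [c [d [/andP[ac ca] /andP[bd db] hne]]]].
have eE x : ell h p x0 x = ell f p x0 x + k by rewrite /ell hE// addrA.
split => //.
  move=> x; rewrite in_itv/= => /andP[ax xb]; rewrite hE ?(lt_le_trans aal)// ?(le_lt_trans xb)//.
  by rewrite eE fE// in_itv/= ax.
exists c, d; rewrite ac ca bd db; split => // x xcd xn; rewrite hE ?eE.
  by move=> /addIr; exact: hne.
by move: xcd; rewrite in_itv/= => /andP[cx xd]; rewrite (le_lt_trans ac cx) (lt_le_trans xd db).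
Qed.

Lemma facet_opp (a b : R) (f : R -> R) (p x0 al be : R) :
  facet a b f p x0 al be -> facet a b (fun x => - f x) (- p) x0 al be.
Proof.
move=> [h1 h2 h3 h4 [c [d [h5 h6 h7]]]].
have eE x : ell (fun x => - f x) (- p) x0 x = - ell f p x0 x by rewrite /ell opprD mulNr.
split => //; first by move=> x xx; rewrite eE h4.
exists c, d; split => // x xcd xn; rewrite eE => /oppr_inj; exact: h7.
Qed.

Lemma transition_left_opp (a b : R) (f : R -> R) (p x0 al be chi : R) :
  transition_left a b f p x0 al be chi ->
  transition_left a b (fun x => - f x) (- p) x0 al be (- chi).
Proof.
have eE x : ell (fun x => - f x) (- p) x0 x = - ell f p x0 x by rewrite /ell opprD mulNr.
move=> [c [d [h1 h2 h]]]; exists c, d; split => //.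
case: h => -[-> h]; [right|left]; split; rewrite ?opprK// => x xcd xx; rewrite eE lerN2; exact: h.
Qed.

Lemma transition_right_opp (a b : R) (f : R -> R) (p x0 al be chi : R) :
  transition_right a b f p x0 al be chi ->
  transition_right a b (fun x => - f x) (- p) x0 al be (- chi).
Proof.
have eE x : ell (fun x => - f x) (- p) x0 x = - ell f p x0 x by rewrite /ell opprD mulNr.
move=> [c [d [h1 h2 h]]]; exists c, d; split => //.
case: h => -[-> h]; [right|left]; split; rewrite ?opprK// => x xcd xx; rewrite eE lerN2; exact: h.
Qed.

(* The hypotheses on the spatial part of a test function at [xh] that survive negation
   and the addition of a constant. *)
Definition faceted_test (a b : R) (h : R -> R) (xh : R) : Prop :=
  (forall x, a < x < b -> derivable h x 1 /\ {for x, continuous (h^`())%classic}) /\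
  (forall p, p = 1 \/ p = - 1 -> (h^`())%classic xh = p ->
     exists al be, facet a b h p xh al be).

Lemma near_itv (a b x : R) : a < x < b -> \forall y \near x, a < y < b.
Proof. by move=> xab; near=> y; rewrite -[_ && _]/(_ \in `]a, b[%R); near: y; exact: near_in_itvoo. Unshelve. all: by end_near. Qed.

Lemma derivable_translate (f : R -> R) (k x : R) : derivable f x 1 ->
  derivable (fun y => f y + k) x 1 /\
  ((fun y => f y + k)^`())%classic x = (f^`())%classic x.
Proof.
move=> df; have -> : (fun y => f y + k) = f + cst k by [].
split; first by apply: derivableD => //; exact: derivable_cst.
by rewrite !derive1E deriveD// derive_cst addr0.
Qed.

Lemma faceted_test_translate (a b k : R) (f h : R -> R) (xh : R) : a < xh < b ->
  (forall x, a < x < b -> h x = f x + k) -> faceted_test a b f xh -> faceted_test a b h xh.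
Proof.
move=> xab hE [df ff].
have nE x : a < x < b -> \forall y \near x, f y + k = h y.
  by move=> /near_itv; apply: filterS => y /hE ->.
have dE x : a < x < b -> (h^`())%classic x = (f^`())%classic x.
  move=> xx; rewrite -(derive1_near (nE x xx)); have [dfx _] := df x xx.
  by have [] := derivable_translate k dfx.
split => [x xx|p hp hpx].
  have [dfx cfx] := df x xx; split.
    by have [d1 _] := derivable_translate k dfx; exact: near_eq_derivable (nE x xx) d1.
  suff : (h^`())%classic y @[y --> x] --> (h^`())%classic x by [].
  rewrite (dE x xx); apply: cvg_trans cfx; apply: near_eq_cvg.
  by apply: filterS (near_itv xx) => y yab; rewrite dE.
have [|al [be hf]] := ff p hp; first by rewrite -dE.
by exists al, be; exact: (facet_translate xab hE hf).
Qed.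

Lemma derive1_opp (f : R -> R) (x : R) : derivable f x 1 ->
  ((fun y => - f y)^`())%classic x = - (f^`())%classic x.
Proof. by move=> df; rewrite !derive1E; exact: deriveN. Qed.

Lemma faceted_test_opp (a b : R) (f : R -> R) (xh : R) : a < xh < b ->
  faceted_test a b f xh -> faceted_test a b (fun x => - f x) xh.
Proof.
move=> xab [df ff]; split => [x xx|p hp].
  have [dfx cfx] := df x xx; split; first exact: derivableN.
  suff : ((fun z => - f z)^`())%classic y @[y --> x] --> ((fun z => - f z)^`())%classic x by [].
  rewrite derive1_opp//; apply: cvg_trans (cvgN cfx); apply: near_eq_cvg.
  by apply: filterS (near_itv xx) => y /df[dy _]; rewrite derive1_opp.
rewrite derive1_opp; last by have [] := df xh xab.
move=> e; have [||al [be hf]] := ff (- p).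
- by case: hp => ->; [right|left; rewrite opprK].
- by rewrite -e opprK.
by exists al, be; rewrite -[p]opprK; exact: facet_opp.
Qed.

(** Oddness is read off the explicit values: negation keeps the facet and changes the sign of both
    transition numbers. *)
Lemma Lambda_W_opp (a b : R) (h : R -> R) (xh : R) : a < xh < b -> faceted_test a b h xh ->
  Lambda_W a b (fun x => - h x) xh = - Lambda_W a b h xh.
Proof.
move=> xab hh; have [dN _] := faceted_test_opp xab hh; have [dh fh] := hh.
have [dx cx] := dh xh xab; have [dxN cxN] := dN xh xab.
have [[p [hp hpx]]|nfac] := pselect (exists p, (p = 1 \/ p = - 1) /\ (h^`())%classic xh = p).
  have [al [be hf]] := fh p hp hpx.
  have [|[chil hl] [chir hr]] := transition_exists _ hf.
    by move=> x /dh[dy _]; apply: differentiable_continuous; apply/derivable1_diffP.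
  rewrite (Lambda_W_facet dx hp hf hl hr).
  rewrite (Lambda_W_facet dxN _ (facet_opp hf) (transition_left_opp hl) (transition_right_opp hr)).
    by rewrite -opprD mulNr.
  by case: hp => ->; [right|left; rewrite opprK].
have n1 : (h^`())%classic xh <> 1 by move=> e; apply: nfac; exists 1; split => //; left.
have n2 : (h^`())%classic xh <> - 1 by move=> e; apply: nfac; exists (-1); split => //; right.
rewrite (Lambda_W_nonfacet a b dx cx n1 n2) oppr0; apply: Lambda_W_nonfacet => //;
  rewrite derive1_opp//.
  by move=> e; apply: n2; rewrite -e opprK.
by move=> /oppr_inj.
Qed.

(** The boundedness of [u] makes the envelope finite at the contact point, which turns the maximum
    condition into the real inequalities of [touching_inequality]. The spatial part is normalized to
    [psi ^~ th] and the temporal one to [g - g th]. *)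
Lemma subsolution_test dom (a b T : R) (u psi : R -> R -> R) (g : R -> R) (xh th : R) :
  a < b -> interior_solution dom a b T u -> a < xh < b -> 0 < th < T ->
  faceted_test a b (psi ^~ th) xh -> derivable g th 1 ->
  (forall x t, a < x < b -> 0 < t < T -> psi x t = psi x th + (g t - g th)) ->
  (forall x t, x \in `]a, b[ -> t \in `]0, T[ ->
    (usc_env a b T u x t - (psi x t)%:E <= usc_env a b T u xh th - (psi xh th)%:E)%E) ->
  (g^`())%classic th <= Lambda_W a b (psi ^~ th) xh.
Proof.
move=> ab hu xab tT [dh fh] dg psiE hmax.
have [M uM] := interior_solution_bounded ab hu.
have fu : usc_env a b T u xh th \is a fin_num.
  rewrite fin_numE; apply/andP; split.
    by rewrite -ltNye (lt_le_trans _ (usc_env_ge _ xab tT))// ltNyr.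
  by rewrite -ltey (le_lt_trans (usc_env_le _ _ uM))// ltry.
pose v := fine (usc_env a b T u xh th).
have vE : usc_env a b T u xh th = v%:E by rewrite fineK.
pose g1 t := g t - g th.
have [dg1 <-] := derivable_translate (- g th) dg.
rewrite -/g1 in dg1 *.
apply: (@touching_inequality R dom a b T u (psi ^~ th) g1 (v - psi xh th) xh th) => //.
  move=> x t xx tt; have := hmax x t; rewrite !in_itv/= xx tt => /(_ isT isT).
  rewrite vE -EFinB => h.
  have : ((u x t)%:E - (psi x t)%:E <= (v - psi xh th)%:E)%E.
    by apply: le_trans h; rewrite leeD2r// usc_env_ge.
  by rewrite -EFinB lee_fin psiE// /g1; lra.
move=> e e0; have [|y [s [yab sT ys ss h]]] := @usc_env_approx a b T (v - e) e u xh th _ e0.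
  by rewrite vE lte_fin ltrBlDr ltrDl.
exists y, s; split => //; apply: le_lt_trans h.
by rewrite le_eqVlt; apply/orP; left; apply/eqP; rewrite /g1; ring.
Qed.

(** [psi] is a sum only on the open cylinder, so its derivatives are transferred from [f] and [g]
    through equality near the point. *)
Lemma A_P_test (a b T : R) (psi : R -> R -> R) (xh th : R) : A_P a b T psi ->
  a < xh < b -> 0 < th < T -> exists g, [/\ faceted_test a b (psi ^~ th) xh,
    derivable g th 1, ((psi xh)^`())%classic th = (g^`())%classic th &
    forall x t, a < x < b -> 0 < t < T -> psi x t = psi x th + (g t - g th)].
Proof.
move=> [f [g [[fC2 fP] gC1 psiE]]] xab tT; exists g.
have hE x t : a < x < b -> 0 < t < T -> psi x t = f x + g t.
  by move=> xx tt; apply: psiE; rewrite in_itv.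
have [dg _] : derivable g th 1 /\ {for th, continuous (g^`())%classic} by apply: gC1; rewrite in_itv.
split; [|exact: dg| |].
- apply: (faceted_test_translate xab (fun x xx => hE x th xx tT)).
  split => [x xx|p hp e]; last by apply: fP; rewrite ?in_itv.
  have [h1 h2 _] : [/\ derivable f x 1, derivable (f^`())%classic x 1 &
      {for x, continuous (f^`(2))%classic}] by apply: fC2; rewrite in_itv.
  split; first exact: h1.
  by apply: differentiable_continuous; apply/derivable1_diffP.
- have nE : \forall t \near th, g t + f xh = psi xh t.
    by apply: filterS (near_itv tT) => t tt; rewrite hE// addrC.
  by rewrite -(derive1_near nE); have [] := derivable_translate (f xh) dg.
- by move=> x t xx tt; rewrite !hE//; ring.
Qed.

End Viscosity.

Theorem theorem5p2 (R : realType) (a b T : R) (hab : a < b) (hT : 0 < T)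
  (bc : boundary_condition R) (u0 : R -> R) (u : R -> R -> R)
  (hu0 : is_BV OpenInterval a b u0)
  (hu : solution bc a b T u)
  (hinit : initial_value a b u0 u) :
  viscosity_solution a b T u.
Proof.
have hi := solution_interior hu; have hiN := interior_solution_opp hab hi.
split; split.
- move=> x t _ _; have [M uM] := interior_solution_bounded hab hi.
  by rewrite (le_lt_trans (usc_env_le _ _ uM))// ltry.
- move=> psi xh th hpsi; rewrite !in_itv/= => xab tT hmax.
  have [g [ft dg eg psiE]] := A_P_test hpsi xab tT.
  by rewrite eg subr_le0; exact: (subsolution_test hab hi xab tT ft dg psiE hmax).
- move=> x t _ _; have [M uM] := interior_solution_bounded hab hiN.
  by rewrite /lsc_env lteNr (le_lt_trans (usc_env_le _ _ uM))// ltry.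
- move=> psi xh th hpsi; rewrite !in_itv/= => xab tT hmin.
  have [g [ft dg eg psiE]] := A_P_test hpsi xab tT.
  (* [lsc_env] of [u] is minus [usc_env] of [- u], so touching [u] from below by [psi] is touching
     [- u], again an interior solution, from above by [- psi]. *)
  rewrite eg subr_ge0 -lerN2 -(Lambda_W_opp xab ft) -(derive1_opp dg).
  apply: (@subsolution_test R _ a b T (fun y s => - u y s) (fun y s => - psi y s)
    (fun t => - g t) xh th hab hiN xab tT (faceted_test_opp xab ft)).
  + exact: derivableN.
  + by move=> x t xx tt; rewrite psiE//; ring.
  + move=> x t xx tt; have := hmin x t xx tt; rewrite /lsc_env.
    by rewrite !EFinN -!fin_num_oppeD// leeN2 !oppeK.
Qed.
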